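(* Let $\mathcal{M}=(M,<,\ldots)$ be an o-minimal structure and let $\mathcal{S}\subseteq \mathcal{P}(M^n)$ be a definable family of sets. The following are equivalent. (1) $\mathcal{S}$ extends to a definable $n$-type (i.e. there is a definable complete $n$-type $p$ over $M$ with $\mathcal{S}\subseteq p$). (2) There exists a definable downward directed family finer than $\mathcal{S}$. (3) $\mathcal{S}$ extends to an $n$-type which has a definable basis consisting of cells. Moreover, for any $A\subseteq M$, the equivalence (1)$\Leftrightarrow$(2) still holds if ''definable'' is replaced everywhere by ''$A$-definable'' (i.e. if $\mathcal{S}$ is $A$-definable, then $\mathcal{S}$ extends to an $A$-definable $n$-type if and only if there exists an $A$-definable downward directed family finer than $\mathcal{S}$).
   Context: $\mathcal{M}$ is an o-minimal structure expanding a dense linear order without endpoints; ''definable'' means definable in $\mathcal{M}$ with parameters, and ''$A$-definable'' means definable with parameters from $A$. A family $\mathcal{S}$ of subsets of $M^n$ is uniform if $\mathcal{S}=\{\varphi(u,M^n):u\in\Omega\}$ for some formula $\varphi(u,v)$ and some set $\Omega$; it is ($A$-)definable if moreover $\varphi$ can be taken over $A$ and $\Omega$ can be taken ($A$-)definable. An $n$-type is a complete type over $M$ in $n$ variables, identified with an ultrafilter on the Boolean algebra of definable subsets of $M^n$. An $n$-type $p$ is ($A$-)definable if for every partitioned formula $\varphi(u,v)$ (with $l(v)=n$, no parameters) the set $\{u:\varphi(u,M^n)\in p\}$ is ($A$-)definable. A family $\mathcal{S}$ of sets is downward directed if $\emptyset\notin\mathcal{S}$ and for all $S,S'\in\mathcal{S}$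 there is $S''\in\mathcal{S}$ with $S''\subseteq S\cap S'$. For consistent families $\mathcal{S},\mathcal{F}$ of definable sets, $\mathcal{S}$ is finer than $\mathcal{F}$ if every $F\in\mathcal{F}$ contains some $S\in\mathcal{S}$. A (uniform) basis of an $n$-type $p$ is a uniform downward directed family $q\subseteq p$ such that $p=\{X: X \text{ definable},\ Y\subseteq X\text{ for some }Y\in q\}$; a definable basis is a basis that is a definable family. Cells are the o-minimal cells. *)

(* Defs.v *)
From HB Require Import structures.
From mathcomp Require Import all_boot all_order all_algebra.
From mathcomp Require Import all_classical topology.

Set Implicit Arguments.
Unset Strict Implicit.
Unset Printing Implicit Defensive.

Import Order.TTheory.
Local Open Scope classical_set_scope.
Local Open Scope order_scope.

(** [M ^n], with the product topology. *)
Definition tup (M : Type) (n : nat) : Type := {ptws 'I_n -> M}.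

(** The order symbol is not part of [language]: it is the built-in atomic
    formula [FLt] below, always interpreted as the order of the carrier, so
    that every [structure L M] is an expansion of [(M, <)]. *)
Record language : Type := Language {
  fsym : Type;
  farity : fsym -> nat;
  rsym : Type;
  rarity : rsym -> nat }.

Record structure (L : language) (M : Type) : Type := Structure {
  finterp : forall f : fsym L, ('I_(farity f) -> M) -> M;
  rinterp : forall r : rsym L, ('I_(rarity r) -> M) -> Prop }.

(** Terms and formulas with free variables indexed by [V] and parameters in
    [M]. A quantifier binds the variable [None] of [option V]. *)
Inductive term (L : language) (M V : Type) : Type :=
| TVar of V
| TPar of M
| TApp (f : fsym L) of ('I_(farity f) -> term L M V).

Inductive formula (L : language) (M V : Type) : Type :=
| FEq of term L M V & term L M V
| FLt of term L M V & term L M V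
| FRel (r : rsym L) of ('I_(rarity r) -> term L M V)
| FNot of formula L M V
| FAnd of formula L M V & formula L M V
| FEx of formula L M (option V).

Fixpoint eval (L : language) (M V : Type) (I : structure L M) (e : V -> M)
    (t : term L M V) : M :=
  match t with
  | TVar v => e v
  | TPar a => a
  | TApp f ts => finterp I (fun i => eval I e (ts i))
  end.

Fixpoint sat (d : Order.disp_t) (M : orderType d) (L : language)
    (I : structure L M) (V : Type) (phi : formula L M V) : (V -> M) -> Prop :=
  match phi with
  | FEq s t => fun e => eval I e s = eval I e t
  | FLt s t => fun e => eval I e s < eval I e t
  | FRel r ts => fun e => rinterp I (fun i => eval I e (ts i))
  | FNot psi => fun e => ~ sat I psi e
  | FAnd psi chi => fun e => sat I psi e /\ sat I chi e
  | FEx psi => fun e =>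
      exists a : M, sat I psi (fun o => if o is Some v then e v else a)
  end.

(** All parameters lie in [A]; [A = set0] means "without parameters". *)
Fixpoint term_over (L : language) (M V : Type) (A : set M)
    (t : term L M V) : Prop :=
  match t with
  | TVar _ => True
  | TPar a => A a
  | TApp f ts => forall i, term_over A (ts i)
  end.

Fixpoint formula_over (L : language) (M V : Type) (A : set M)
    (phi : formula L M V) : Prop :=
  match phi with
  | FEq s t => term_over A s /\ term_over A t
  | FLt s t => term_over A s /\ term_over A t
  | FRel r ts => forall i, term_over A (ts i)
  | FNot psi => formula_over A psi
  | FAnd psi chi => formula_over A psi /\ formula_over A chi
  | FEx psi => formula_over A psi
  end.

Definition definable (d : Order.disp_t) (M : orderType d) (L : language)
    (I : structure L M) (A : set M) (n : nat) (X : set (tup M n)) : Prop :=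
  exists2 phi : formula L M 'I_n, formula_over A phi & X = [set x | sat I phi x].

(** For a partitioned formula [phi(u, v)], with [u] the [inl] variables and
    [v] the [inr] variables, this is [phi(u, M ^n)]. *)
Definition fiber (d : Order.disp_t) (M : orderType d) (L : language)
    (I : structure L M) (m n : nat) (phi : formula L M ('I_m + 'I_n)%type)
    (u : tup M m) : set (tup M n) :=
  [set v | sat I phi (fun s => match s with inl i => u i | inr j => v j end)].

Definition uniform_family (d : Order.disp_t) (M : orderType d) (L : language)
    (I : structure L M) (n : nat) (S : set (set (tup M n))) : Prop :=
  exists m (phi : formula L M ('I_m + 'I_n)%type) (Omega : set (tup M m)),
    S = [set fiber I phi u | u in Omega].

Definition definable_family (d : Order.disp_t) (M : orderType d)
    (L : language) (I : structure L M) (A : set M) (n : nat)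
    (S : set (set (tup M n))) : Prop :=
  exists m (phi : formula L M ('I_m + 'I_n)%type) (Omega : set (tup M m)),
    [/\ formula_over A phi, definable I A Omega
      & S = [set fiber I phi u | u in Omega]].

Definition downward_directed (T : Type) (S : set (set T)) : Prop :=
  ~ S set0 /\
  forall X Y, S X -> S Y -> exists2 Z, S Z & Z `<=` X `&` Y.

(** [S] is finer than [F]. *)
Definition finer (T : Type) (S F : set (set T)) : Prop :=
  forall X, F X -> exists2 Y, S Y & Y `<=` X.

(** Complete [n]-types over [M], as ultrafilters on the Boolean algebra of
    subsets of [M ^n] definable with parameters. *)
Record n_type (d : Order.disp_t) (M : orderType d) (L : language)
    (I : structure L M) (n : nat) (p : set (set (tup M n))) : Prop := NType {
  n_type_definable : forall X, p X -> definable I setT X;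
  n_type_proper : ~ p set0;
  n_type_setI : forall X Y, p X -> p Y -> p (X `&` Y);
  n_type_up : forall X Y, p X -> definable I setT Y -> X `<=` Y -> p Y;
  n_type_ultra : forall X, definable I setT X -> p X \/ p (~` X) }.

Definition definable_type (d : Order.disp_t) (M : orderType d)
    (L : language) (I : structure L M) (A : set M) (n : nat)
    (p : set (set (tup M n))) : Prop :=
  forall m (phi : formula L M ('I_m + 'I_n)%type), formula_over set0 phi ->
    definable I A [set u : tup M m | p (fiber I phi u)].

Definition basis_of_type (d : Order.disp_t) (M : orderType d) (L : language)
    (I : structure L M) (n : nat) (p q : set (set (tup M n))) : Prop :=
  [/\ uniform_family I q, downward_directed q, q `<=` p
    & p = [set X | definable I setT X /\ exists2 Y, q Y & Y `<=` X]].

(** An [interval M] has endpoints in [M] or infinite, and includes the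
    one-point intervals [`[a, a]]. First-order structures are nonempty. *)
Record o_minimal (d : Order.disp_t) (M : orderType d) (L : language)
    (I : structure L M) : Prop := OMinimal {
  omin_nonempty : exists x : M, True;
  omin_dense : forall x y : M, x < y -> exists z, x < z < y;
  omin_no_min : forall x : M, exists y, y < x;
  omin_no_max : forall x : M, exists y, x < y;
  omin_itv : forall X : set (tup M 1), definable I setT X ->
    exists s : seq (interval M), X = [set x | has (fun i => x ord0 \in i) s] }.

(** First [n] coordinates of a point of [M ^n.+1]. *)
Definition tup_init (M : Type) (n : nat) (x : tup M n.+1) : tup M n :=
  fun i => x (widen_ord (leqnSn n) i).

(** Partial functions [C -> M] are represented by total functions, of which
    only the restriction to [C] matters. *)
Definition fgraph_on (M : Type) (n : nat) (C : set (tup M n))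
    (f : tup M n -> M) : set (tup M n.+1) :=
  [set x | C (tup_init x) /\ x ord_max = f (tup_init x)].

Definition definable_continuous (d : Order.disp_t)
    (M : orderTopologicalType d) (L : language) (I : structure L M) (n : nat)
    (C : set (tup M n)) (f : tup M n -> M) : Prop :=
  definable I setT (fgraph_on C f) /\
  {within (C : set {ptws 'I_n -> M}), continuous f}.

(** The band between [f] and [g] over [C]; [None] stands for [-oo] as a lower
    bound and for [+oo] as an upper bound. *)
Definition band (d : Order.disp_t) (M : orderType d) (n : nat)
    (C : set (tup M n)) (f g : option (tup M n -> M)) : set (tup M n.+1) :=
  [set x | [/\ C (tup_init x),
    (if f is Some f0 then f0 (tup_init x) < x ord_max : Prop else True)
    & (if g is Some g0 then x ord_max < g0 (tup_init x) : Prop else True)]].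

(** The one-point space [M ^0] is a cell, so that at [n = 1] the two clauses
    give the points and the open intervals. *)
Fixpoint is_cell (d : Order.disp_t) (M : orderTopologicalType d)
    (L : language) (I : structure L M) (n : nat) : set (tup M n) -> Prop :=
  match n with
  | 0 => fun X => X = setT
  | n'.+1 => fun X => exists2 C : set (tup M n'), is_cell I C &
      (exists2 f, definable_continuous I C f & X = fgraph_on C f) \/
      (exists f g : option (tup M n' -> M),
        [/\ (forall f0, f = Some f0 -> definable_continuous I C f0),
            (forall g0, g = Some g0 -> definable_continuous I C g0),
            (forall f0 g0, f = Some f0 -> g = Some g0 ->
               forall x, C x -> f0 x < g0 x)
          & X = band C f g])
  end.

(* Main.v *)
Require Import Defs.
From mathcomp Require Import all_boot all_order all_algebra.
From mathcomp Require Import all_classical topology.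

(** Definable families contained in a definable type [p] on [M ^n.+1]: by uniform finiteness
    each member can be cut down to a component with convex fibres. The up-closures (and the
    down-closures) of the fibres of two components are nested, and which way round is decided
    by the projection [q] of [p], definably. By induction a definable directed family
    contained in [q] witnesses all these inclusions, and intersections of up-closures and
    down-closures over its members form a directed family in [p].

    Conversely, a directed family is extended to a type by induction on the dimension. Given
    a type [q] extending the projection, add the cut lying just above all the infima of the
    fibres, as germs along [q]: uniform finiteness makes this a complete type, and it is
    definable over the same parameters. For a basis of cells, one first looks for a definable
    function whose graph meets, [q]-generically, every member of the family, and takes its
    graph; if there is none, the endpoints of the components of the family are cofinal on
    both sides of the cut, so that the bands between them form a basis.

    Uniform finiteness and piecewise continuity are proved by a simultaneous induction on the
    dimension which does not use cell decomposition: a set containing no box is covered by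
    finitely many graphs over coordinate hyperplanes, and functions are continuous, and
    finite fibres locally constant in number, outside a set containing no box. *)

(** The structure need not carry a group, so definable choice may fail: points cannot be picked
    uniformly in the fibres of a family, and no curve runs through a directed family. Its substitute
    is the total preorder that a definable type [q] on the base puts on the indices, by generic
    inclusion of up-closures. Limits along this preorder exist because the invariant followed, a
    stratum number bounded by uniform finiteness, moves in one direction only.

    Parameters shape the rest. An infimum is never named where [A] matters: the up-closure of the
    fibre stands for it, whether the infimum is attained, missed or [-oo]. Cells, on the contrary,
    need functions, and both the default values of partial functions and the function whose graph is
    taken bring in arbitrary parameters. This is why types are built twice, once with a basis of
    cells over all of [M] and once over [A] using cuts alone. Finally, definability of a type only
    tests parameter-free formulas, hence the passage that turns parameters into variables. *)

Set Implicit Arguments.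
Unset Strict Implicit.
Unset Printing Implicit Defensive.

Import Order.TTheory.
Local Open Scope classical_set_scope.
Local Open Scope order_scope.

(** * The calculus of definable sets *)

Section Tuples.
Context {M : Type}.

Definition ext (V : Type) (x : V -> M) (t : M) : option V -> M :=
  fun o => if o is Some v then x v else t.

Definition pr (V W : Type) (x : V -> M) (y : W -> M) : V + W -> M :=
  fun s => match s with inl i => x i | inr j => y j end.

Definition ins (n : nat) (i : 'I_n.+1) (x : 'I_n -> M) (t : M) : 'I_n.+1 -> M :=
  fun j => if unlift i j is Some k then x k else t.

Definition del (n : nat) (i : 'I_n.+1) (x : 'I_n.+1 -> M) : 'I_n -> M :=
  fun k => x (lift i k).

Definition upd (n : nat) (i : 'I_n) (x : 'I_n -> M) (t : M) : 'I_n -> M :=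
  fun j => if j == i then t else x j.

Lemma prE (V W : Type) (e : V + W -> M) :
  pr (fun v => e (inl v)) (fun w => e (inr w)) = e.
Proof. by apply/funext => -[]. Qed.

Lemma ins_del n (i : 'I_n.+1) x : ins i (del i x) (x i) = x.
Proof. by apply/funext => j; rewrite /ins /del; case: unliftP => [k|] ->. Qed.

Lemma del_ins n (i : 'I_n.+1) x t : del i (ins i x t) = x.
Proof. by apply/funext => j; rewrite /ins /del liftK. Qed.

Lemma ins_id n (i : 'I_n.+1) x t : ins i x t i = t.
Proof. by rewrite /ins unlift_none. Qed.

Lemma ins_lift n (i : 'I_n.+1) x t j : ins i x t (lift i j) = x j.
Proof. by rewrite /ins liftK. Qed.

Lemma upd_ins n (i : 'I_n.+1) x s t : upd i (ins i x s) t = ins i x t.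
Proof.
apply/funext => j; rewrite /upd /ins; case: eqVneq => [->|ji]; first by rewrite unlift_none.
by case: unliftP ji => [k -> //|->]; rewrite eqxx.
Qed.

Lemma upd_at n (i : 'I_n) x t : upd i x t i = t.
Proof. by rewrite /upd eqxx. Qed.

Lemma ins_upd n (i : 'I_n.+1) (j : 'I_n) x s t :
  upd (lift i j) (ins i x t) s = ins i (upd j x s) t.
Proof.
apply/funext => k; rewrite /upd /ins; case: unliftP => [l ->|->].
  by rewrite (inj_eq lift_inj).
by rewrite (negbTE (neq_lift i j)).
Qed.

Lemma tup_init_del n (x : tup M n.+1) : tup_init x = del ord_max x.
Proof.
apply/funext => i; congr (x _); apply/val_inj => /=.
by rewrite /bump leqNgt ltn_ord.
Qed.

End Tuples.

Section Definability.
Context {d : Order.disp_t} {M : orderType d} {L : language} (I : structure L M).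

(** Variables range over an arbitrary type instead of ['I_n], so that quantifiers ([option V]) and
    pairs of tuples ([V + W]) require no renumbering; [definableE] leads back to the official
    notion. *)
Definition def (A : set M) (V : Type) (X : (V -> M) -> Prop) : Prop :=
  exists2 phi : formula L M V, formula_over A phi & forall e, sat I phi e <-> X e.

Fixpoint tsub (V W : Type) (s : V -> W + M) (t : term L M V) : term L M W :=
  match t with
  | TVar v => match s v with inl w => TVar L M w | inr a => TPar L W a end
  | TPar a => TPar L W a
  | TApp f ts => TApp (fun i => tsub s (ts i))
  end.

Definition slift (V W : Type) (s : V -> W + M) (o : option V) : option W + M :=
  if o is Some v then match s v with inl w => inl (Some w) | inr a => inr a end
  else inl None.

Fixpoint fsub (V : Type) (phi : formula L M V) :
    forall W : Type, (V -> W + M) -> formula L M W :=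
  match phi with
  | FEq t u => fun W s => FEq (tsub s t) (tsub s u)
  | FLt t u => fun W s => FLt (tsub s t) (tsub s u)
  | FRel r ts => fun W s => FRel (fun i => tsub s (ts i))
  | FNot psi => fun W s => FNot (fsub psi s)
  | FAnd psi chi => fun W s => FAnd (fsub psi s) (fsub chi s)
  | FEx psi => fun W s => FEx (fsub psi (slift s))
  end.

Definition venv (V W : Type) (s : V -> W + M) (e : W -> M) (v : V) : M :=
  match s v with inl w => e w | inr a => a end.

Lemma eval_tsub (V W : Type) (s : V -> W + M) e (t : term L M V) :
  Defs.eval I e (tsub s t) = Defs.eval I (venv s e) t.
Proof.
elim: t => [v|a|f ts IH] //=; first by rewrite /venv; case: (s v).
by congr finterp; apply/funext => i; apply: IH.
Qed.

Lemma venv_slift (V W : Type) (s : V -> W + M) (e : W -> M) (a : M) :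
  venv (slift s) (ext e a) = ext (venv s e) a.
Proof. by apply/funext => -[v|] //=; rewrite /venv /=; case: (s v). Qed.

Lemma sat_fsub (V : Type) (phi : formula L M V) : forall W (s : V -> W + M) e,
  sat I (fsub phi s) e <-> sat I phi (venv s e).
Proof.
elim: phi => {V} [V t u|V t u|V r ts|V psi IH|V psi IH1 chi IH2|V psi IH] W s e /=.
- by rewrite !eval_tsub.
- by rewrite !eval_tsub.
- suff -> : (fun i => Defs.eval I e (tsub s (ts i))) = (fun i => Defs.eval I (venv s e) (ts i)) by [].
  by apply/funext => i; apply: eval_tsub.
- by split=> H /IH.
- by split=> -[/IH1 ? /IH2 ?].
- split=> -[a H]; exists a.
    by move/IH: H; rewrite -/(ext e a) venv_slift.
  by apply/IH; rewrite -/(ext e a) venv_slift.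
Qed.

Lemma over_tsub (A : set M) (V W : Type) (s : V -> W + M) (t : term L M V) :
  (forall v a, s v = inr a -> A a) -> term_over A t -> term_over A (tsub s t).
Proof.
move=> sA; elim: t => [v|a|f ts IH] //=; last by move=> H i; apply: IH.
by move=> _; case E: (s v) => [w|a] //=; apply: sA E.
Qed.

Lemma over_fsub (A : set M) (V : Type) (phi : formula L M V) :
  forall W (s : V -> W + M), (forall v a, s v = inr a -> A a) ->
  formula_over A phi -> formula_over A (fsub phi s).
Proof.
elim: phi => {V} [V t u|V t u|V r ts|V psi IH|V psi IH1 chi IH2|V psi IH] W s sA /=.
- by move=> [? ?]; split; apply: over_tsub.
- by move=> [? ?]; split; apply: over_tsub.
- by move=> H i; apply: over_tsub.
- exact: IH.
- by move=> [? ?]; split; [apply: IH1|apply: IH2].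
- by apply: IH => -[v|] a //=; case E: (s v) => [|b] //= [<-]; apply: sA E.
Qed.

Section Rules.
Variable A : set M.
Notation D := (def A).

Lemma def_iff (V : Type) (X Y : (V -> M) -> Prop) :
  (forall e, X e <-> Y e) -> D X -> D Y.
Proof. by move=> XY [phi Aphi E]; exists phi => // e; rewrite E XY. Qed.

Lemma def_not (V : Type) (X : (V -> M) -> Prop) : D X -> D (fun e => ~ X e).
Proof.
move=> [phi Aphi E]; exists (FNot phi) => // e /=.
by split=> H /E.
Qed.

Lemma def_and (V : Type) (X Y : (V -> M) -> Prop) :
  D X -> D Y -> D (fun e => X e /\ Y e).
Proof.
move=> [phi Aphi E] [psi Apsi F]; exists (FAnd phi psi) => // e /=.
by split=> -[/E ? /F ?].
Qed.

Lemma def_and3 (V : Type) (X Y Z : (V -> M) -> Prop) :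
  D X -> D Y -> D Z -> D (fun e => [/\ X e, Y e & Z e]).
Proof.
move=> dX dY dZ; apply: def_iff (def_and dX (def_and dY dZ)) => e.
by split=> [[? []]|[]].
Qed.

Lemma def_and4 (V : Type) (X Y Z W : (V -> M) -> Prop) :
  D X -> D Y -> D Z -> D W -> D (fun e => [/\ X e, Y e, Z e & W e]).
Proof.
move=> dX dY dZ dW; apply: def_iff (def_and dX (def_and3 dY dZ dW)) => e.
by split=> [[? []]|[]].
Qed.

Lemma def_or (V : Type) (X Y : (V -> M) -> Prop) :
  D X -> D Y -> D (fun e => X e \/ Y e).
Proof.
move=> dX dY; apply: def_iff (def_not (def_and (def_not dX) (def_not dY))) => e.
by rewrite not_andE !notE.
Qed.

Lemma def_imp (V : Type) (X Y : (V -> M) -> Prop) :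
  D X -> D Y -> D (fun e => X e -> Y e).
Proof.
move=> dX dY; apply: def_iff (def_or (def_not dX) dY) => e.
by rewrite implyE.
Qed.

Lemma def_equiv (V : Type) (X Y : (V -> M) -> Prop) :
  D X -> D Y -> D (fun e => X e <-> Y e).
Proof. by move=> dX dY; apply: def_and; apply: def_imp. Qed.

Lemma def_ex (V : Type) (X : (V -> M) -> M -> Prop) :
  D (fun e : option V -> M => X (fun v => e (Some v)) (e None)) ->
  D (fun e => exists t, X e t).
Proof.
move=> [phi Aphi E]; exists (FEx phi) => // e /=.
by split=> -[a H]; exists a; [apply: (E (ext e a)).1 H|apply: (E (ext e a)).2 H].
Qed.

Lemma def_ex2 (V T : Type) (X Y : (V -> M) -> T -> Prop) :
  D (fun e => exists t, X e t /\ Y e t) -> D (fun e => exists2 t, X e t & Y e t).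
Proof. by apply: def_iff => e; split=> [[t []]|[t]]; exists t. Qed.

Lemma def_all (V : Type) (X : (V -> M) -> M -> Prop) :
  D (fun e : option V -> M => X (fun v => e (Some v)) (e None)) ->
  D (fun e => forall t, X e t).
Proof.
move=> dX; apply: def_iff (def_not (def_ex (X := fun e t => ~ X e t) (def_not dX))) => e.
by split=> [H t|H [t]]; [apply: contrapT => nX; apply: H; exists t|apply].
Qed.

Lemma def_cst (V : Type) (P : Prop) : D (fun _ : V -> M => P).
Proof.
(* [V] may be empty and [A] too, so that no atomic formula is at hand; a contradiction is expressed
   with a quantifier. *)
have dF : D (fun e : V -> M => exists t : M, ~ (t = t)).
  by exists (FEx (FNot (FEq (TVar L M None) (TVar L M None)))).
case: (pselect P) => hP.
  by apply: def_iff (def_not dF) => e; split=> // _ [t].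
by apply: def_iff dF => e; split=> // -[t].
Qed.

Lemma def_sub (V W : Type) (X : (W -> M) -> Prop) (F : (V -> M) -> W -> M) :
  D X ->
  (forall w, (exists v, forall e, F e w = e v) \/ (exists2 a, A a & forall e, F e w = a)) ->
  D (fun e => X (F e)).
Proof.
move=> [phi Aphi E] HF.
have /choice [s sE] : forall w, exists z : V + M,
    (forall e, F e w = match z with inl v => e v | inr a => a end) /\
    (forall a, z = inr a -> A a).
  move=> w; case: (HF w) => [[v Hv]|[a Aa Ha]]; first by exists (inl v); split.
  by exists (inr a); split=> // _ [<-].
exists (fsub phi s); first by apply: over_fsub => // v a; apply: (sE v).2.
move=> e; rewrite sat_fsub E; suff -> : venv s e = F e by [].
by apply/funext => w; rewrite (sE w).1.
Qed.

Lemma def_ren (V W : Type) (X : (W -> M) -> Prop) (s : W -> V) :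
  D X -> D (fun e => X (fun w => e (s w))).
Proof. by move=> dX; apply: (def_sub dX) => w; left; exists (s w). Qed.

Lemma def_exI k : forall (V : Type) (X : (V -> M) -> ('I_k -> M) -> Prop),
  D (fun e : V + 'I_k -> M => X (fun v => e (inl v)) (fun i => e (inr i))) ->
  D (fun e => exists z, X e z).
Proof.
elim: k => [|k IH] V X dX.
  have z0 : 'I_0 -> M by case.
  have z0E z : z = z0 by apply/funext; case.
  apply: (def_iff (X := fun e => X e z0)).
    by move=> e; split=> [Xz|[z]]; [exists z0|rewrite (z0E z)].
  apply: (def_sub (F := fun e : V -> M => pr e z0) dX) => -[v|[]//].
  by left; exists v.
have := IH (option V) (fun e z => X (fun v => e (Some v)) (ins ord0 z (e None))).
move=> H; apply: def_iff (def_ex (X := fun e t => exists z, X e (ins ord0 z t)) (H _)).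
  move=> e; split=> [[t [z Xz]]|[z Xz]]; first by eexists; eassumption.
  by exists (z ord0), (del ord0 z); rewrite ins_del.
pose F (e : option V + 'I_k -> M) : V + 'I_k.+1 -> M :=
  fun s => match s with inl v => e (inl (Some v))
           | inr i => if unlift ord0 i is Some j then e (inr j) else e (inl None) end.
apply: (def_sub (F := F) dX) => -[v|i] /=; first by left; exists (inl (Some v)).
by left; case: (unlift ord0 i) => [j|]; [exists (inr j)|exists (inl None)].
Qed.

Lemma def_exfin (V : Type) (W : finType) (X : (V -> M) -> (W -> M) -> Prop) :
  D (fun e : V + W -> M => X (fun v => e (inl v)) (fun i => e (inr i))) ->
  D (fun e => exists z, X e z).
Proof.
move=> dX; have := @def_exI #|W| V (fun e z => X e (fun w => z (enum_rank w))).
move=> H; apply: def_iff (H _).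
  move=> e; split=> [[z Xz]|[z Xz]]; first by eexists; eassumption.
  exists (fun i => z (enum_val i)); rewrite (_ : (fun w => _) = z) //.
  by apply/funext => w; rewrite enum_rankK.
pose s (o : V + W) : V + 'I_#|W| :=
  match o with inl v => inl v | inr w => inr (enum_rank w) end.
exact: (def_ren s dX).
Qed.

Lemma def_allfin (V : Type) (W : finType) (X : (V -> M) -> (W -> M) -> Prop) :
  D (fun e : V + W -> M => X (fun v => e (inl v)) (fun i => e (inr i))) ->
  D (fun e => forall z, X e z).
Proof.
move=> dX; apply: def_iff (def_not (def_exfin (X := fun e t => ~ X e t) (def_not dX))) => e.
by split=> [H t|H [t]]; [apply: contrapT => nX; apply: H; exists t|apply].
Qed.

Lemma def_allseq (V : Type) (J : Type) (s : seq J) (X : (V -> M) -> J -> Prop) :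
  (forall i, D (fun e => X e i)) -> D (fun e => foldr (fun i P => X e i /\ P) True s).
Proof.
by move=> dX; elim: s => [|i s IH] /=; [apply: def_cst|apply: def_and].
Qed.

Lemma def_alli (V : Type) (J : finType) (X : (V -> M) -> J -> Prop) :
  (forall i, D (fun e => X e i)) -> D (fun e => forall i, X e i).
Proof.
move=> /(@def_allseq V _ (enum J)); apply: def_iff => e.
have -> : (forall i, X e i) <-> (forall i, i \in enum J -> X e i).
  by split=> H i; [|apply: H; rewrite mem_enum].
elim: (enum J) => [|j s IH] /=; first by split.
rewrite IH; split=> [[Xj H] i|H].
  by rewrite inE => /orP[/eqP ->|/H].
by split=> [|i si]; apply: H; rewrite inE ?eqxx // si orbT.
Qed.

Lemma def_exi (V : Type) (J : finType) (X : (V -> M) -> J -> Prop) :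
  (forall i, D (fun e => X e i)) -> D (fun e => exists i, X e i).
Proof.
move=> dX; apply: def_iff (def_not (def_alli (fun i => def_not (dX i)))) => e.
split=> [nX|[i Xi] /(_ i)//].
by apply: contrapT => nE; apply: nX => i Xi; apply: nE; exists i.
Qed.

Definition dfn (V : Type) (g : (V -> M) -> M) : Prop :=
  D (fun e : option V -> M => e None = g (fun v => e (Some v))).

Lemma dfn_var (V : Type) (v : V) : dfn (fun e => e v).
Proof. by exists (FEq (TVar L M None) (TVar L M (Some v))). Qed.

Lemma dfn_par (V : Type) (a : M) : A a -> dfn (fun _ : V -> M => a).
Proof. by move=> Aa; exists (FEq (TVar L M None) (TPar L _ a)). Qed.

(** A definable function is only given by its graph, not by a term; its values are quantified over,
    which is where finiteness of [W] enters. *)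
Lemma def_app (V : Type) (W : finType) (X : (W -> M) -> Prop) (F : (V -> M) -> W -> M) :
  D X -> (forall w, dfn (fun e => F e w)) -> D (fun e => X (F e)).
Proof.
move=> dX dF.
apply: (def_iff (X := fun e => exists z : W -> M, (forall w, z w = F e w) /\ X z)).
  move=> e; split=> [[z [zE Xz]]|XF]; last by exists (F e).
  by rewrite (_ : F e = z) //; apply/funext.
apply: (def_exfin (X := fun e z => (forall w, z w = F e w) /\ X z)).
apply: def_and; last exact: (def_ren inr dX).
apply: def_alli => w.
have := def_ren (fun o : option V => if o is Some v then inl v else inr w) (dF w).
exact.
Qed.

Lemma dfn_app (V : Type) (W : finType) (f : (W -> M) -> M) (F : (V -> M) -> W -> M) :
  dfn f -> (forall w, dfn (fun e => F e w)) -> dfn (fun e => f (F e)).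
Proof.
move=> df dF.
have := @def_app (option V) _ _
  (fun e => ext (F (fun v => e (Some v))) (e None)) df.
apply=> -[w|] /=; last exact: dfn_var.
pose s (o : option V) : option (option V) := if o is Some v then Some (Some v) else None.
exact: (def_ren s (dF w)).
Qed.

Lemma def_eq (V : Type) (g h : (V -> M) -> M) :
  dfn g -> dfn h -> D (fun e => g e = h e).
Proof.
move=> dg dh.
have dE : D (fun e : bool -> M => e true = e false).
  by exists (FEq (TVar L M true) (TVar L M false)).
have := def_app (F := fun e (b : bool) => if b then g e else h e) dE.
by apply; case.
Qed.

Lemma def_lt (V : Type) (g h : (V -> M) -> M) :
  dfn g -> dfn h -> D (fun e => g e < h e).
Proof.
move=> dg dh.
have dE : D (fun e : bool -> M => e true < e false).
  by exists (FLt (TVar L M true) (TVar L M false)).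
have := def_app (F := fun e (b : bool) => if b then g e else h e) dE.
by apply; case.
Qed.

Lemma def_le (V : Type) (g h : (V -> M) -> M) :
  dfn g -> dfn h -> D (fun e => g e <= h e).
Proof.
move=> dg dh; apply: def_iff (def_or (def_lt dg dh) (def_eq dg dh)) => e.
by split=> [[/ltW|->]//|]; rewrite le_eqVlt => /orP[/eqP|]; [right|left].
Qed.

Lemma dfn_ext (V : Type) (W : Type) (F : (V -> M) -> W -> M) (g : (V -> M) -> M) w :
  (forall w, dfn (fun e => F e w)) -> dfn g -> dfn (fun e => ext (F e) (g e) w).
Proof. by case: w => [w|] dF dg; [exact: dF|exact: dg]. Qed.

Lemma dfn_pr (V : Type) (W W' : Type) (F : (V -> M) -> W -> M) (G : (V -> M) -> W' -> M) w :
  (forall w, dfn (fun e => F e w)) -> (forall w, dfn (fun e => G e w)) ->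
  dfn (fun e => pr (F e) (G e) w).
Proof. by case: w => w dF dG; [exact: dF|exact: dG]. Qed.

Lemma dfn_ins (V : Type) n (i : 'I_n.+1) (F : (V -> M) -> 'I_n -> M) (g : (V -> M) -> M) j :
  (forall w, dfn (fun e => F e w)) -> dfn g -> dfn (fun e => ins i (F e) (g e) j).
Proof. by rewrite /ins => dF dg; case: (unlift i j) => [k|]; [exact: dF|exact: dg]. Qed.

Lemma dfn_upd (V : Type) n (i : 'I_n) (F : (V -> M) -> 'I_n -> M) (g : (V -> M) -> M) j :
  (forall w, dfn (fun e => F e w)) -> dfn g -> dfn (fun e => upd i (F e) (g e) j).
Proof. by rewrite /upd => dF dg; case: (j == i); [exact: dg|exact: dF]. Qed.

Lemma dfn_del (V : Type) n (i : 'I_n.+1) (F : (V -> M) -> 'I_n.+1 -> M) j :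
  (forall w, dfn (fun e => F e w)) -> dfn (fun e => del i (F e) j).
Proof. by move=> dF; apply: dF. Qed.

Definition def1 (X : M -> Prop) : Prop := D (fun e : unit -> M => X (e tt)).

Definition def2 (W : Type) (X : (W -> M) -> M -> Prop) : Prop :=
  D (fun e : option W -> M => X (fun w => e (Some w)) (e None)).

Definition defp (W V : Type) (X : (W -> M) -> (V -> M) -> Prop) : Prop :=
  D (fun e : W + V -> M => X (fun w => e (inl w)) (fun v => e (inr v))).

Definition def3 (W V : Type) (X : (W -> M) -> (V -> M) -> M -> Prop) : Prop :=
  D (fun e : W + option V -> M =>
    X (fun w => e (inl w)) (fun v => e (inr (Some v))) (e (inr None))).

Definition defr (R : M -> M -> Prop) : Prop :=
  forall (V : Type) (g h : (V -> M) -> M), dfn g -> dfn h -> D (fun e => R (g e) (h e)).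

Definition dfn1 (f : M -> M) : Prop :=
  forall (V : Type) (g : (V -> M) -> M), dfn g -> dfn (fun e => f (g e)).

Lemma def1_app (V : Type) (X : M -> Prop) (g : (V -> M) -> M) :
  def1 X -> dfn g -> D (fun e => X (g e)).
Proof. by move=> dX dg; apply: (def_app (F := fun e _ => g e) dX). Qed.

Lemma def2_app (V : Type) (W : finType) (X : (W -> M) -> M -> Prop)
    (F : (V -> M) -> W -> M) (g : (V -> M) -> M) :
  def2 X -> (forall w, dfn (fun e => F e w)) -> dfn g -> D (fun e => X (F e) (g e)).
Proof.
by move=> dX dF dg; apply: (def_app (F := fun e => ext (F e) (g e)) dX) => -[].
Qed.

Lemma defp_app (V : Type) (W W' : finType) (X : (W -> M) -> (W' -> M) -> Prop)
    (F : (V -> M) -> W -> M) (G : (V -> M) -> W' -> M) :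
  defp X -> (forall w, dfn (fun e => F e w)) -> (forall w, dfn (fun e => G e w)) ->
  D (fun e => X (F e) (G e)).
Proof.
by move=> dX dF dg; apply: (def_app (F := fun e => pr (F e) (G e)) dX) => -[].
Qed.

Lemma def3_app (V : Type) (W W' : finType) (X : (W -> M) -> (W' -> M) -> M -> Prop)
    (F : (V -> M) -> W -> M) (G : (V -> M) -> W' -> M) (g : (V -> M) -> M) :
  def3 X -> (forall w, dfn (fun e => F e w)) -> (forall w, dfn (fun e => G e w)) ->
  dfn g -> D (fun e => X (F e) (G e) (g e)).
Proof.
move=> dX dF dG dg.
by apply: (def_app (F := fun e => pr (F e) (ext (G e) (g e))) dX) => -[|[]].
Qed.

End Rules.

Lemma def_mono (A B : set M) (V : Type) (X : (V -> M) -> Prop) :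
  A `<=` B -> def A X -> def B X.
Proof.
move=> AB [phi Aphi E]; exists phi => //; move: Aphi {E}.
have tm U (t : term L M U) : term_over A t -> term_over B t.
  elim: t => [v|a|f ts IH] //=; [exact: AB|by move=> H i; apply: IH].
elim: phi => {V X} [V t u|V t u|V r ts|V psi IH|V psi IH1 chi IH2|V psi IH] //=.
- by move=> [/tm ? /tm ?].
- by move=> [/tm ? /tm ?].
- by move=> H i; apply: tm.
- by move=> [/IH1 ? /IH2 ?].
Qed.

Lemma definableE (A : set M) n (X : set (tup M n)) : definable I A X <-> def A X.
Proof.
split=> [[phi Aphi ->]|[phi Aphi E]]; exists phi => //.
by apply/seteqP; split=> x; rewrite /mkset /= E.
Qed.

End Definability.

(* Extended below, by unfolding, each time a new definable notion is introduced. *)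
Ltac dhook := fail.

Ltac dstep :=
  cbn beta;
  match goal with
  | H : ?P |- ?P => exact: H
  | |- forall _, _ => let w := fresh "w" in move=> w; cbn beta
  | |- dfn _ _ (fun e => ext _ _ _) => apply: dfn_ext
  | |- dfn _ _ (fun e => pr _ _ _) => apply: dfn_pr
  | |- dfn _ _ (fun e => ins _ _ _ _) => apply: dfn_ins
  | |- dfn _ _ (fun e => upd _ _ _ _) => apply: dfn_upd
  | |- dfn _ _ (fun e => del _ _ _) => apply: dfn_del
  | H : dfn _ _ ?f |- dfn _ _ (fun e => ?f (@?F e)) => apply: (dfn_app (F := F) H)
  | |- dfn _ _ (fun e => e ?v) => exact: dfn_var
  | |- dfn _ _ (fun e => ?a) => by apply: dfn_par
  | H : dfn1 _ _ ?f |- dfn _ _ (fun e => ?f (@?g e)) => apply: (H _ g)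
  | H : defr _ _ ?R |- def _ _ (fun e => ?R (@?g e) (@?h e)) => apply: (H _ g h)
  | H : def1 _ _ ?X |- def _ _ (fun e => ?X (@?g e)) => apply: (def1_app (g := g) H)
  | H : def2 _ _ ?X |- def _ _ (fun e => ?X (@?F e) (@?g e)) =>
      apply: (def2_app (F := F) (g := g) H)
  | H : defp _ _ ?X |- def _ _ (fun e => ?X (@?F e) (@?G e)) =>
      apply: (defp_app (F := F) (G := G) H)
  | H : def3 _ _ ?X |- def _ _ (fun e => ?X (@?F e) (@?G e) (@?g e)) =>
      apply: (def3_app (F := F) (G := G) (g := g) H)
  | H : def _ _ ?X |- def _ _ (fun e => ?X (@?F e)) => apply: (def_app (F := F) H)
  | |- def _ _ (fun e => _ /\ _) => apply: def_and
  | |- def _ _ (fun e => [/\ _, _ & _]) => apply: def_and3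
  | |- def _ _ (fun e => [/\ _, _, _ & _]) => apply: def_and4
  | |- def _ _ (fun e => ~ _) => apply: def_not
  | |- def _ _ (fun e => _ \/ _) => apply: def_or
  | |- def _ _ (fun e => _ <-> _) => apply: def_equiv
  | |- def _ _ (fun e => is_true (_ < _)%O) => apply: def_lt
  | |- def _ _ (fun e => is_true (_ <= _)%O) => apply: def_le
  | |- def _ _ (fun e => _ = _) => apply: def_eq
  | |- def _ _ (fun e => ?P) => exact: def_cst
  | |- def _ _ (fun e => exists _ : _, _) =>
      first [apply: def_ex | apply: def_exfin | apply: def_exi]; cbn beta
  | |- def _ _ (fun e => exists2 _ : _, _ & _) => apply: def_ex2
  | |- def _ _ (fun e => forall _ : _, _) =>
      first [apply: def_imp | apply: def_all | apply: def_allfin | apply: def_alli]; cbn beta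
  | |- defr _ _ _ => rewrite /defr
  | |- dfn1 _ _ _ => rewrite /dfn1
  | |- def1 _ _ _ => rewrite /def1
  | |- def2 _ _ _ => rewrite /def2
  | |- defp _ _ _ => rewrite /defp
  | |- def3 _ _ _ => rewrite /def3
  | |- _ => progress dhook
  | |- def ?I ?A ?X =>
      lazymatch X with (fun _ => _) => fail | _ => change (def I A (fun e => X e)) end
  end.

Ltac dsolve := repeat dstep.

(** * Definable subsets of the line *)

(** Searches, with bounded depth, for a chain of order hypotheses starting at the left end of the
    goal; [ord] also looks for a cycle containing a strict inequality. *)
Ltac ordle n :=
  lazymatch n with
  | O => fail
  | S ?m => first
    [ exact: lexx | eassumption | (apply: ltW; eassumption)
    | match goal with
      | H : is_true (?x < ?z)%O |- is_true (?x <= _)%O => apply: (le_trans (ltW H)); ordle m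
      | H : is_true (?x <= ?z)%O |- is_true (?x <= _)%O => apply: (le_trans H); ordle m
      end ]
  end.

Ltac ordlt n :=
  lazymatch n with
  | O => fail
  | S ?m => first
    [ eassumption
    | match goal with
      | H : is_true (?x < ?z)%O |- is_true (?x < _)%O => apply: (lt_le_trans H); ordle m
      | H : is_true (?x <= ?z)%O |- is_true (?x < _)%O => apply: (le_lt_trans H); ordlt m
      end ]
  end.

Ltac ordF n :=
  match goal with
  | H : is_true (?x < ?x)%O |- _ => by rewrite ltxx in H
  | H : is_true (?x < ?y)%O |- _ =>
      let h := fresh in
      assert (h : is_true (y <= x)%O) by ordle n;
      exfalso; move: h; by rewrite leNgt H
  end.

Ltac ord := intros; solve [ ordlt 6 | ordle 6 | ordF 6 ].

Section OneDim.
Context {d : Order.disp_t} {M : orderType d} {L : language} (I : structure L M).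
Hypothesis om : o_minimal I.
Notation D := (def I setT).

Lemma btw (x y : M) : x < y -> exists z, x < z /\ z < y.
Proof. by move=> /(omin_dense om)[z /andP[]]; exists z. Qed.

Lemma btw22 (a1 a2 b1 b2 : M) : a1 < b1 -> a1 < b2 -> a2 < b1 -> a2 < b2 ->
  exists z, [/\ a1 < z, a2 < z, z < b1 & z < b2].
Proof.
move=> h1 h2 h3 h4.
have [a [a1a a2a ab1 ab2]] : exists a, [/\ a1 <= a, a2 <= a, a < b1 & a < b2].
  by case: (leP a1 a2) => h; [exists a2|exists a1]; split=> //; apply: ltW.
have [b [bb1 bb2 ab]] : exists b, [/\ b <= b1, b <= b2 & a < b].
  by case: (leP b1 b2) => h; [exists b1|exists b2]; split=> //; apply: ltW.
by have [z [az zb]] := btw ab; exists z; split; ord.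
Qed.

Lemma btw21 (a1 a2 b : M) : a1 < b -> a2 < b -> exists z, [/\ a1 < z, a2 < z & z < b].
Proof. by move=> h1 h2; have [z []] := btw22 h1 h1 h2 h2; exists z. Qed.

Lemma btw12 (a b1 b2 : M) : a < b1 -> a < b2 -> exists z, [/\ a < z, z < b1 & z < b2].
Proof. by move=> h1 h2; have [z []] := btw22 h1 h2 h1 h2; exists z. Qed.

Lemma min_lt (a b c : M) : a < b -> a < c -> exists e, [/\ a < e, e <= b & e <= c].
Proof. by case: (leP b c) => bc ab ac; [exists b|exists c]; split=> //; apply: ltW. Qed.

Lemma max_lt (a b c : M) : b < a -> c < a -> exists e, [/\ e < a, b <= e & c <= e].
Proof. by case: (leP b c) => bc ab ac; [exists c|exists b]; split=> //; apply: ltW. Qed.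

Lemma omin1 (P : M -> Prop) : def1 I setT P ->
  exists s : seq (interval M), forall t, P t <-> has (fun i => t \in i) s.
Proof.
move=> dP; pose X := [set x : tup M 1 | P (x ord0)].
have dX : definable I setT X.
  by apply/definableE; apply: (def_ren (fun _ : unit => ord0) dP).
have [s sE] := omin_itv om dX; exists s => t.
by have -> : P t = X (fun _ => t) by []; rewrite sE.
Qed.

Definition rgerm (a : M) (P : M -> Prop) := exists2 b, a < b & forall t, a < t -> t < b -> P t.
Definition lgerm (a : M) (P : M -> Prop) := exists2 b, b < a & forall t, b < t -> t < a -> P t.

Lemma rgerm_and a P Q : rgerm a P -> rgerm a Q -> rgerm a (fun t => P t /\ Q t).
Proof.
move=> [b ab HP] [c ac HQ]; have [e [ae eb ec]] := min_lt ab ac.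
by exists e => // t at_ te; split; [apply: HP|apply: HQ] => //; ord.
Qed.

Lemma lgerm_and a P Q : lgerm a P -> lgerm a Q -> lgerm a (fun t => P t /\ Q t).
Proof.
move=> [b ab HP] [c ac HQ]; have [e [ae eb ec]] := max_lt ab ac.
by exists e => // t at_ te; split; [apply: HP|apply: HQ] => //; ord.
Qed.

Lemma rgerm_sub a P Q : (forall t, P t -> Q t) -> rgerm a P -> rgerm a Q.
Proof. by move=> PQ [b ab HP]; exists b => // t at_ tb; apply/PQ/HP. Qed.

Lemma lgerm_sub a P Q : (forall t, P t -> Q t) -> lgerm a P -> lgerm a Q.
Proof. by move=> PQ [b ab HP]; exists b => // t at_ tb; apply/PQ/HP. Qed.

Lemma rgerm_ex a P b : rgerm a P -> a < b -> exists t, [/\ a < t, t < b & P t].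
Proof.
move=> [c ac HP] ab; have [t [? ? ?]] := btw12 ab ac.
by exists t; split=> //; apply: HP.
Qed.

Lemma lgerm_ex a P b : lgerm a P -> b < a -> exists t, [/\ b < t, t < a & P t].
Proof.
move=> [c ac HP] ab; have [t [? ? ?]] := btw21 ab ac.
by exists t; split=> //; apply: HP.
Qed.

Lemma rgerm_itv a b : a < b -> rgerm a (fun t => a < t /\ t < b).
Proof. by exists b. Qed.

Lemma lgerm_itv a b : b < a -> lgerm a (fun t => b < t /\ t < a).
Proof. by exists b. Qed.

(** An interval is the intersection of two half-lines, and membership in a half-line is constant
    immediately to the right of [a]. *)
Lemma rgerm_has (s : seq (interval M)) a :
  rgerm a (fun t => has (fun i => t \in i) s) \/ rgerm a (fun t => ~ has (fun i => t \in i) s).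
Proof.
have [b0 ab0] := omin_no_max om a.
elim: s => [|i s [IH|IH]] /=; first by right; exists b0.
  by left; apply: rgerm_sub IH => t ->; rewrite orbT.
have [Hl|Hl] : rgerm a (fun t => t \in Interval i.1 +oo) \/
    rgerm a (fun t => t \notin Interval i.1 +oo).
  case: i => [[bl l|[]] r] /=; rewrite /rgerm /=; last 2 first.
  - by left; exists b0.
  - by right; exists b0.
  have [la|al] := leP l a; [left|right].
    by exists b0 => // t at_ _; rewrite in_itv /= andbT; case: bl => /=; ord.
  exists l => // t at_ tl; rewrite in_itv /= andbT; case: bl => /=.
    by rewrite -ltNge.
  by rewrite -leNgt ltW.
- have [Hr|Hr] : rgerm a (fun t => t \in Interval -oo i.2) \/
      rgerm a (fun t => t \notin Interval -oo i.2).
    case: i {Hl} => [l [br r|[]]] /=; rewrite /rgerm /=; last 2 first.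
    + by right; exists b0.
    + by left; exists b0.
    have [ra|ar] := leP r a; [right|left].
      exists b0 => // t at_ _; rewrite in_itv /=.
      by case: br => /=; rewrite -?leNgt -?ltNge; ord.
    exists r => // t at_ tl; rewrite in_itv /=.
    by case: br => /=; ord.
  - left; apply: rgerm_sub (rgerm_and Hl Hr) => t; rewrite !in_itv /=.
    by case: i {Hl Hr} => l r; rewrite /= andbT => -[-> ->].
  right; apply: rgerm_sub (rgerm_and IH Hr) => t; rewrite !in_itv /= => -[nh].
  by case: i {Hl Hr} => l r; rewrite /= => /negbTE ->; rewrite andbF.
right; apply: rgerm_sub (rgerm_and IH Hl) => t; rewrite !in_itv /= => -[nh].
by case: i {Hl} => l r; rewrite /= andbT => /negbTE ->.
Qed.

Lemma lgerm_has (s : seq (interval M)) a :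
  lgerm a (fun t => has (fun i => t \in i) s) \/ lgerm a (fun t => ~ has (fun i => t \in i) s).
Proof.
have [b0 ab0] := omin_no_min om a.
elim: s => [|i s [IH|IH]] /=; first by right; exists b0.
  by left; apply: lgerm_sub IH => t ->; rewrite orbT.
have [Hl|Hl] : lgerm a (fun t => t \in Interval i.1 +oo) \/
    lgerm a (fun t => t \notin Interval i.1 +oo).
  case: i => [[bl l|[]] r] /=; rewrite /lgerm /=; last 2 first.
  - by left; exists b0.
  - by right; exists b0.
  have [al|la] := leP a l; [right|left].
    exists b0 => // t tb ta; rewrite in_itv /= andbT.
    by case: bl => /=; rewrite -?leNgt -?ltNge; ord.
  exists l => // t at_ tl; rewrite in_itv /= andbT.
  by case: bl => /=; ord.
- have [Hr|Hr] : lgerm a (fun t => t \in Interval -oo i.2) \/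
      lgerm a (fun t => t \notin Interval -oo i.2).
    case: i {Hl} => [l [br r|[]]] /=; rewrite /lgerm /=; last 2 first.
    + by right; exists b0.
    + by left; exists b0.
    have [ar|ra] := leP a r; [left|right].
      exists b0 => // t tb ta; rewrite in_itv /=.
      by case: br => /=; ord.
    exists r => // t rt ta; rewrite in_itv /=.
    by case: br => /=; rewrite -?leNgt -?ltNge; ord.
  - left; apply: lgerm_sub (lgerm_and Hl Hr) => t; rewrite !in_itv /=.
    by case: i {Hl Hr} => l r; rewrite /= andbT => -[-> ->].
  right; apply: lgerm_sub (lgerm_and IH Hr) => t; rewrite !in_itv /= => -[nh].
  by case: i {Hl Hr} => l r; rewrite /= => /negbTE ->; rewrite andbF.
right; apply: lgerm_sub (lgerm_and IH Hl) => t; rewrite !in_itv /= => -[nh].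
by case: i {Hl} => l r; rewrite /= andbT => /negbTE ->.
Qed.

Lemma rgerm_dec P a : def1 I setT P -> rgerm a P \/ rgerm a (fun t => ~ P t).
Proof.
move=> /omin1[s sE]; have [H|H] := rgerm_has s a; [left|right];
  by apply: rgerm_sub H => t /sE.
Qed.

Lemma lgerm_dec P a : def1 I setT P -> lgerm a P \/ lgerm a (fun t => ~ P t).
Proof.
move=> /omin1[s sE]; have [H|H] := lgerm_has s a; [left|right];
  by apply: lgerm_sub H => t /sE.
Qed.

Definition is_sup (P : M -> Prop) (s : M) :=
  (forall t, P t -> t <= s) /\ (forall u, u < s -> exists2 t, P t & u < t).
Definition is_inf (P : M -> Prop) (s : M) :=
  (forall t, P t -> s <= t) /\ (forall u, s < u -> exists2 t, P t & t < u).

(** The order is not complete; the supremum is found among the right endpoints of the finitely many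
    intervals. *)
Lemma has_sup P b : def1 I setT P -> (exists t, P t) -> (forall t, P t -> t <= b) ->
  exists s, is_sup P s.
Proof.
move=> /omin1[s sE] [t0 Pt0] Pb.
have {Pb}: forall t, has (fun i => t \in i) s -> t <= b by move=> t /sE/Pb.
have {Pt0}: exists t, has (fun i => t \in i) s by exists t0; apply/sE.
suff H : (forall t, has (fun i => t \in i) s -> t <= b) ->
    (exists t, has (fun i => t \in i) s) -> exists s', is_sup (fun t => has (fun i => t \in i) s) s'.
  move=> E B; have [s' [H1 H2]] := H B E; exists s'; split; first by move=> t /sE/H1.
  by move=> u /H2[t /sE Pt ut]; exists t.
elim: s {sE t0} => [|i s IH] Hb [t0]; first by [].
have {}IH := IH (fun t st => Hb t (introT orP (or_intror st))).
have supi : (exists t, t \in i) -> exists s', is_sup (fun t => t \in i) s'.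
  move=> [t ti]; have Hib u : u \in i -> u <= b by move=> ui; apply: Hb => /=; rewrite ui.
  case: i ti Hib {Hb} => [l [br r|[]]]; rewrite in_itv => /andP[tl tr] Hib.
  - have tr' : t <= r by case: br tr {Hib} => /=; ord.
    exists r; split; first by move=> u; rewrite in_itv => /andP[_]; case: (br) => /=; ord.
    move: tr'; rewrite le_eqVlt => /orP[/eqP tE|tr'].
      by move=> u ur; exists t; rewrite ?in_itv ?tl ?tr // tE.
    move=> u ur; have [z [uz tz zr]] := btw21 ur tr'; exists z => //.
    rewrite in_itv; apply/andP; split; last by case: (br) => /=; ord.
    by case: l tl {Hib} => [[] l|[]] //=; ord.
  - by rewrite /= in tr.
  have [c bc] := omin_no_max om b.
  (* An interval unbounded to the right would contain [c], which lies above the bound [b]. *)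
  have : c \in Interval l +oo.
    rewrite in_itv andbT.
    have tb : t <= b by apply: Hib; rewrite in_itv tl.
    by case: l tl {Hib} => [[] l|[]] //=; ord.
  move/Hib => cb; ord.
move=> /= H0.
have [[ti]|Ei] := pselect (exists t, t \in i); last first.
  have {}Ei t : (t \in i) = false by apply/negP => ti; apply: Ei; exists t.
  have [|s' [H1 H2]] := IH; first by exists t0; move: H0; rewrite Ei.
  exists s'; split=> [t|u /H2[t st ut]]; first by rewrite Ei => /H1.
  by exists t => //=; rewrite st orbT.
move=> tiP; have [|s1 [A1 A2]] := supi; first by exists ti.
have [[ts hts]|Es] := pselect (exists t, has (fun i => t \in i) s); last first.
  exists s1; split=> [t /orP[/A1 //|st]|u /A2[t st ut]]; first by case: Es; exists t.
  by exists t => //=; rewrite st.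
have [|s2 [B1 B2]] := IH; first by exists ts.
case: (leP s1 s2) => s12; [exists s2|exists s1]; split=> [t /orP[/A1|/B1]|u us]; try by ord.
- by have [t st ut] := B2 _ us; exists t => //=; rewrite st orbT.
- by have [t st ut] := A2 _ us; exists t => //=; rewrite st.
Qed.

Lemma has_inf P b : def1 I setT P -> (exists t, P t) -> (forall t, P t -> b <= t) ->
  exists s, is_inf P s.
Proof.
move=> dP [t0 Pt0] Pb.
have dQ : def1 I setT (fun u => forall t, P t -> u <= t) by dsolve.
have [||s [H1 H2]] := has_sup (b := t0) dQ; first by exists b.
  by move=> t /(_ _ Pt0).
exists s; split=> [t Pt|u su]; last first.
  apply: contrapT => nE; have : u <= s.
    by apply: H1 => t Pt; rewrite leNgt; apply/negP => tu; apply: nE; exists t.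
  by move=> ?; ord.
rewrite leNgt; apply/negP => /H2[u Hu tu].
by have := Hu _ Pt => ?; ord.
Qed.

Definition fin (P : M -> Prop) := exists s : seq M, forall t, P t -> t \in s.

(** Two points in one of the intervals of the decomposition would bring along everything between
    them, so that each interval contributes at most one point. *)
Lemma no_itv_fin P : def1 I setT P ->
  (forall a b, a < b -> exists t, [/\ a < t, t < b & ~ P t]) -> fin P.
Proof.
move=> /omin1[s sE] H.
have {}H a b : a < b -> exists t, [/\ a < t, t < b & ~ has (fun i => t \in i) s].
  by move=> /H[t [at_ tb nP]]; exists t; split=> // /sE.
suff [r rP] : exists r : seq M, forall t, has (fun i => t \in i) s -> t \in r.
  by exists r => t /sE/rP.
elim: s {sE P} H => [|i s IH] H; first by exists [::].
have [|r rP] := IH.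
  by move=> a b /H[t [at_ tb nP]]; exists t; split=> // st; apply: nP; rewrite /= st orbT.
have i1 t u : t \in i -> u \in i -> t < u -> False.
  move=> ti ui /H[v [tv vu]]; apply => /=.
  move: ti ui; case: i {H} => [l r']; rewrite !in_itv => /andP[tl tr] /andP[ul ur].
  apply/orP; left; apply/andP; split.
    by case: l tl {ul} => [[] l|[]] //=; ord.
  by case: r' ur {tr} => [[] l'|[]] //=; ord.
have [[t0 t0i]|nE] := pselect (exists t, t \in i).
  exists (t0 :: r) => t /= /orP[ti|/rP tr]; rewrite inE ?tr ?orbT //.
  by case: (ltgtP t t0) => // [/(i1 _ _ ti t0i)|/(i1 _ _ t0i ti)].
exists r => t /= /orP[ti|/rP //].
by case: nE; exists t.
Qed.

Lemma fin_lgerm P a : fin P -> lgerm a (fun t => ~ P t).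
Proof.
move=> [s sP]; have : lgerm a (fun t => t \notin s).
  elim: s {sP} => [|u s IH]; first by have [b ab] := omin_no_min om a; exists b.
  have [ua|au] := leP a u.
    case: IH => b ab H; exists b => // t at_ tb; rewrite inE negb_or H // andbT.
    by apply/eqP => tu; subst; ord.
  apply: lgerm_sub (lgerm_and IH (lgerm_itv au)) => t [ts [tu _]].
  by rewrite inE negb_or ts andbT; apply/eqP => E; subst; ord.
by apply: lgerm_sub => t /negP nts /sP.
Qed.

(** The topological boundary of [P], as the set of points where [P] is not locally constant; this
    form is visibly first-order. *)
Definition bd (P : M -> Prop) (t : M) :=
  ~ exists c e, [/\ c < t, t < e & forall u, c < u -> u < e -> (P u <-> P t)].

End OneDim.

(** * Monotonicity *)

Ltac dhook ::=
  match goal with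
  | |- def _ _ (fun e => bd _ _) => rewrite /bd
  | |- def _ _ (fun e => rgerm _ _) => rewrite /rgerm
  | |- def _ _ (fun e => lgerm _ _) => rewrite /lgerm
  | |- def _ _ (fun e => is_inf _ _) => rewrite /is_inf
  | |- def _ _ (fun e => is_sup _ _) => rewrite /is_sup
  end.

Section Monotonicity.
Context {d : Order.disp_t} {M : orderType d} {L : language} (I : structure L M).
Hypothesis om : o_minimal I.
Notation D := (def I setT).

(** The infimum of the failures of [Q] would contradict one of the two steps. For definable [Q] this
    replaces the connectedness and the compactness of closed intervals. *)
Lemma itv_induction (Q : M -> Prop) t1 t2 : def1 I setT Q -> Q t1 ->
  (forall s, t1 <= s -> s < t2 -> (forall u, t1 <= u -> u <= s -> Q u) -> rgerm s Q) ->
  (forall s, t1 < s -> s <= t2 -> (forall u, t1 <= u -> u < s -> Q u) -> Q s) ->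
  forall s, t1 <= s -> s <= t2 -> Q s.
Proof.
move=> dQ Q1 Hr Hl s0 ts0 st0; apply: contrapT => nQ.
have dB : def1 I setT (fun u => [/\ t1 <= u, u <= t2 & ~ Q u]).
  by dsolve.
have [||s [H1 H2]] := has_inf om (b := t1) dB; first by exists s0.
  by move=> t [].
have ts : t1 <= s.
  by rewrite leNgt; apply/negP => /H2[u [? _ _] ?]; ord.
have ss0 : s <= s0 by apply: H1.
have Qb u : t1 <= u -> u < s -> Q u.
  move=> tu us; apply: contrapT => nQu.
  have : s <= u by apply: H1; split=> //; ord.
  by move=> ?; ord.
have Qs : Q s.
  move: ts; rewrite le_eqVlt => /orP[/eqP <- //|ts].
  by apply: Hl => //; ord.
have ss0' : s < s0.
  by rewrite lt_neqAle ss0 andbT; apply/eqP => E; apply: nQ; rewrite -E.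
have [e se He] : rgerm s Q.
  apply: Hr => //; first by ord.
  by move=> u tu; rewrite le_eqVlt => /orP[/eqP -> //|]; apply: Qb.
have [u [? ? nQu] ue] := H2 _ se.
have su : s <= u by apply: H1.
apply: nQu; move: su; rewrite le_eqVlt => /orP[/eqP <- //|su].
exact: He.
Qed.

(** Immediately to the right of any point [P] is constant, so no interval consists of boundary
    points. *)
Lemma bd_fin (P : M -> Prop) : def1 I setT P -> fin (bd P).
Proof.
move=> dP; apply: (no_itv_fin om); first by dsolve.
move=> a b ab; have [H|H] := rgerm_dec om a dP.
  have [c ac Hc] := rgerm_and H (rgerm_itv ab).
  have [t [at_ tb tc]] := btw12 om ab ac.
  exists t; split=> // nb; apply: nb; exists a, c; split=> // u au uc.
  by split=> _; [apply: (Hc t _ _).1|apply: (Hc u _ _).1].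
have [c ac Hc] := rgerm_and H (rgerm_itv ab).
have [t [at_ tb tc]] := btw12 om ab ac.
exists t; split=> // nb; apply: nb; exists a, c; split=> // u au uc.
by split=> // ?; exfalso; [apply: (Hc u _ _).1|apply: (Hc t _ _).1].
Qed.

Lemma bd_const (P : M -> Prop) t1 t2 : def1 I setT P -> t1 <= t2 ->
  (forall t, t1 <= t -> t <= t2 -> ~ bd P t) -> P t1 <-> P t2.
Proof.
move=> dP t12 nb.
have {}nb t : t1 <= t -> t <= t2 ->
    exists c e, [/\ c < t, t < e & forall u, c < u -> u < e -> (P u <-> P t)].
  by move=> h1 h2; apply: contrapT => ?; apply: (nb t h1 h2).
suff H : forall s, t1 <= s -> s <= t2 -> (P t1 <-> P s) by exact: H.
apply: itv_induction => //; first by dsolve.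
  move=> s ts st H; have [c [e [cs se He]]] := nb s ts (ltW st).
  exists e => // u su ue; rewrite (H s) // He //.
  by ord.
move=> s ts st H; have [c [e [cs se He]]] := nb s (ltW ts) st.
have [u [tu cu us]] := btw21 om ts cs.
rewrite (H u) ?(ltW tu) // He //.
by ord.
Qed.

Lemma loc_glob (R : M -> M -> Prop) a b : defr I setT R ->
  (forall x y z, R x y -> R y z -> R x z) ->
  (forall x, a < x -> x < b -> lgerm x (fun z => R z x)) ->
  (forall x, a < x -> x < b -> rgerm x (fun z => R x z)) ->
  forall x y, a < x -> x < y -> y < b -> R x y.
Proof.
move=> dR tr Hl Hr x y ax xy yb.
suff : forall s, x <= s -> s <= y -> s = x \/ R x s.
  by move=> /(_ y)[]//; [ord|move=> E; subst; ord].
apply: itv_induction; [by dsolve|by left| |].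
  move=> s xs sy H; have [||e se He] := Hr s; [by ord|by ord|].
  exists e => // u su ue; right; have [E|xs'] := H s xs (lexx _); first by rewrite -E; apply: He.
  by apply: tr xs' _; apply: He.
move=> s xs sy H; have [||e se He] := Hl s; [by ord|by ord|].
have [u [xu eu us]] := btw21 om xs se.
right; have [E|xu'] := H u (ltW xu) us; first by subst; ord.
by apply: tr xu' _; apply: He.
Qed.

Section NoLocalMax.
Variable R : M -> M -> Prop.
Hypothesis dR : defr I setT R.
Hypothesis tr : forall x y z, R x y -> R y z -> R x z.
Hypothesis irr : forall x, ~ R x x.

(** With [R z x] read as [z] being lower than [x], the point [x] dominates the whole of [(x, y]]. *)
Let Dm x y := x < y /\ forall z, x < z -> z <= y -> R z x.

(** Suppose every point is a strict local maximum, and fix [e0]. In some [(x1, e0)] only finitely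
    many points are undominated, and every other point is dominated by one of them. Each of these
    stops dominating before [e0], so a point [e1] past all these places has no dominator left. *)
Lemma no_local_max a b : a < b ->
  ~ (forall x, a < x -> x < b -> lgerm x (fun z => R z x) /\ rgerm x (fun z => R z x)).
Proof.
move=> ab H.
have dD x y : Dm x y -> forall z, x < z -> z < y -> Dm x z.
  by move=> [xy Dxy] z xz zy; split=> // w xw wz; apply: Dxy => //; ord.
have Dl x c e : a < x -> x < b -> c < x -> x < e ->
    ~ (forall z, c < z -> z < e -> Dm z e).
  move=> ax xb cx xe HD; have [Hl _] := H x ax xb.
  have [z [cz zx Rzx]] := lgerm_ex om Hl cx.
  have [_ /(_ x zx (ltW xe)) Rxz] := HD z cz (lt_trans zx xe).
  exact: (irr (tr Rzx Rxz)).
(* If the points just after [e] all dominated up to [y], each would beat the later ones, although a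
   later one is a local maximum and beats those right before it. *)
have a1 e y : a <= e -> e < b -> e < y -> rgerm e (fun x => ~ Dm x y).
  move=> ae eb ey; have dP : def1 I setT (Dm^~ y) by rewrite /Dm; dsolve.
  have [[c ec Hc]|//] := rgerm_dec om e dP; exfalso.
  have [z [ez zc zb]] := btw12 om ec eb.
  have [w [zw wc wy]] : exists w, [/\ z < w, w <= c & w <= y].
    apply: min_lt => //.
    by have [] := Hc z ez zc.
  apply: (Dl z e w) => //; first by ord.
  move=> x ex xw; have [xy Hx] := Hc x ex (lt_le_trans xw wc).
  by split=> // u xu uw; apply: Hx => //; ord.
have [e0 [ae0 e0b]] := btw om ab.
have [[c0 c0e Hc0] _] := H e0 ae0 e0b.
pose G x := forall e', x < e' -> e' < e0 -> Dm x e'.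
have dG : def1 I setT G by rewrite /G /Dm; dsolve.
(* A point [x] close to [e0] beats those immediately before it, which therefore do not dominate up
   to [e0]. *)
have [c1 c1e Hc1] : lgerm e0 (fun x => ~ G x).
  have [[c ce Hc]|//] := lgerm_dec om e0 dG; exfalso.
  have [x [ax cx xe]] := btw21 om ae0 ce.
  have [Hl _] := H x ax (lt_trans xe e0b).
  have [z [cz zx Rzx]] := lgerm_ex om Hl cx.
  have [_ /(_ x zx (lexx _)) Rxz] := Hc z cz (lt_trans zx xe) x zx xe.
  exact: (irr (tr Rzx Rxz)).
have [m0 [m0e c0m c1m]] := max_lt c0e c1e.
have [x1 [ax1 m0x1 x1e]] := btw21 om ae0 m0e.
(* The undominated points. They contain no interval, because each point dominates those immediately
   after it; hence they are finitely many. *)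
pose Mx x := x1 < x /\ x < e0 /\ forall x', x1 < x' -> x' < x -> ~ Dm x' x.
have dMx : def1 I setT Mx by rewrite /Mx /Dm; dsolve.
have [s sP] : fin Mx.
  apply: (no_itv_fin om dMx) => c e ce; apply: contrapT => nE.
  have {}nE t : c < t -> t < e -> Mx t.
    by move=> ct te; apply: contrapT => nM; apply: nE; exists t.
  have [x' [cx' x'e]] := btw om ce.
  have [x1x' [x'e0 _]] := nE x' cx' x'e.
  have [_ [f x'f Hf]] := H x' (lt_trans ax1 x1x') (lt_trans x'e0 e0b).
  have [x [x'x xf xe]] := btw12 om x'f x'e.
  have [_ [_ /(_ x' x1x' x'x)]] := nE x (lt_trans cx' x'x) xe; apply.
  by split=> // z x'z zx; apply: Hf => //; ord.
(* By [a1] the infimum of the dominators of [e'] is one of them, and the first dominator is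
   undominated by transitivity. *)
have cover e' : x1 < e' -> e' < e0 -> exists m, Mx m /\ (m = e' \/ Dm m e').
  move=> x1e' e'e0; have [Me|nMe] := pselect (Mx e'); first by exists e'; split=> //; left.
  have [x' [x1x' [x'e' Dx']]] : exists x', x1 < x' /\ x' < e' /\ Dm x' e'.
    apply: contrapT => nE; apply: nMe; split=> //; split=> // x' h1 h2 h3.
    by apply: nE; exists x'.
  have dP : def1 I setT (fun x' => x1 < x' /\ x' < e' /\ Dm x' e') by rewrite /Dm; dsolve.
  have [||xs [H1 H2]] := has_inf om (b := x1) dP; first by exists x'.
    by move=> t [/ltW].
  have attain e1 : a <= e1 -> e1 <= xs -> e1 < e' -> xs = e1 -> x1 < e1 /\ e1 < e' /\ Dm e1 e'.
    move=> ae1 e1xs e1e' E; have [|c ec Hc] := a1 e1 e' ae1 _ e1e'; first by ord.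
    have [t [x1t [te' Dt]] tc] : exists2 t, x1 < t /\ t < e' /\ Dm t e' & t < c.
      by apply: H2; rewrite E.
    have := H1 t (conj x1t (conj te' Dt)); rewrite E le_eqVlt => /orP[/eqP -> //|et].
    by have := Hc t et tc Dt.
  have xsx' : xs <= x' by apply: H1.
  have x1xs : x1 <= xs.
    by rewrite leNgt; apply/negP => /H2[t [? _] ?]; ord.
  have [x1s [xse' Dxs]] : x1 < xs /\ xs < e' /\ Dm xs e'.
    by apply: attain => //; ord.
  exists xs; split; last by right.
  split=> //; split; first by ord.
  move=> w x1w wxs [_ Dw].
  have : xs <= w; last by move=> ?; ord.
  apply: H1; split=> //; split; first by ord.
  split=> [|z wz ze]; first by ord.
  have [zx|xz] := leP z xs; first exact: Dw.
  by apply: tr (Dxs.2 z xz ze) (Dw xs wxs (lexx _)).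
(* Failure to dominate persists to the right ([push]), so the failures of finitely many points can
   be moved to a common [e1]. *)
have [e1 [x1e1 e1e0 He1]] : exists e', [/\ x1 < e', e' < e0 &
    forall m, m \in s -> Mx m -> m < e' /\ ~ Dm m e'].
  elim: s {sP} => [|m s [e' [x1e' e'e0 He']]].
    by have [e' []] := btw om x1e; exists e'.
  have [Mm|nM] := pselect (Mx m); last first.
    by exists e'; split=> // m'; rewrite inE => /orP[/eqP ->|/He'].
  have [x1m [me0 _]] := Mm.
  have [em [mem [eme0 nD]]] : exists em, m < em /\ em < e0 /\ ~ Dm m em.
    apply: contrapT => nE; apply: (Hc1 m) => //; first by ord.
    move=> e'' me'' e''e; apply: contrapT => nD; apply: nE.
    by exists e''.
  have push m' f g : m' < f -> ~ Dm m' f -> f <= g -> m' < g /\ ~ Dm m' g.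
    move=> mf nDf fg; split; first by ord.
    move: fg; rewrite le_eqVlt => /orP[/eqP <- //|fg] Dg.
    by apply: nDf; apply: (dD _ _ Dg).
  have [e2 [e2e0 he' hem]] := max_lt e'e0 eme0.
  exists e2; split=> //; first by ord.
  move=> m'; rewrite inE => /orP[/eqP -> _|m's Mm']; first exact: (push m em).
  by have [h1 h2] := He' m' m's Mm'; apply: (push m' e').
have [m [Mm [E|DE]]] := cover e1 x1e1 e1e0.
  by have [] := He1 m (sP _ Mm) Mm; rewrite E; ord.
by have [_] := He1 m (sP _ Mm) Mm.
Qed.

End NoLocalMax.

Lemma rgerm_or P Q a b : def1 I setT P -> a < b ->
  (forall t, a < t -> t < b -> P t \/ Q t) -> rgerm a P \/ rgerm a Q.
Proof.
move=> dP ab H; have [|nP] := rgerm_dec om a dP; [by left|right].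
apply: rgerm_sub (rgerm_and nP (rgerm_itv ab)) => t [nPt [at_ tb]].
by case: (H t at_ tb).
Qed.

Lemma rgerm_seq (J : eqType) (s : seq J) (P : J -> M -> Prop) a b :
  (forall j, def1 I setT (P j)) -> a < b ->
  (forall t, a < t -> t < b -> exists2 j, j \in s & P j t) ->
  exists2 j, j \in s & rgerm a (P j).
Proof.
move=> dP; elim: s b => [|j s IH] b ab H.
  by have [t [at_ tb]] := btw om ab; have [j] := H t at_ tb.
have [|nP] := rgerm_dec om a (dP j); first by exists j; rewrite ?inE ?eqxx.
have [c ac Hc] := rgerm_and nP (rgerm_itv ab).
have [|j' j's Hj'] := IH c ac; last by exists j' => //; rewrite inE j's orbT.
move=> t at_ tc; have [nPj [_ tb]] := Hc t at_ tc.
by have [j'] := H t at_ tb; rewrite inE => /orP[/eqP ->//|]; exists j'.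
Qed.

Definition cont1 (f : M -> M) x := forall c e, c < f x -> f x < e ->
  exists c' e', c' < x /\ x < e' /\ forall y, c' < y -> y < e' -> c < f y /\ f y < e.

(* Weak monotonicity, stated symmetrically in the two directions. *)
Definition qmono (f : M -> M) a b := forall t1 t t2 c e, a < t1 -> t1 < t -> t < t2 -> t2 < b ->
  c < f t1 -> f t1 < e -> c < f t2 -> f t2 < e -> c < f t /\ f t < e.

(** Were discontinuities to fill a germ, the image of the germ would contain an interval. At a
    preimage of an interior value, preimages of nearby values on both sides trap [f] by weak
    monotonicity, which is continuity there. *)
Lemma inj_qmono_cont (f : M -> M) a b : dfn1 I setT f -> a < b ->
  (forall x y, a < x -> x < y -> y < b -> f x <> f y) -> qmono f a b ->
  exists2 b', a < b' & b' <= b /\ forall x, a < x -> x < b' -> cont1 f x.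
Proof.
move=> df ab inj qm.
have dC : def1 I setT (cont1 f) by rewrite /cont1; dsolve.
have [C|nC] := rgerm_dec om a dC.
  have [b' ab' H] := rgerm_and C (rgerm_itv ab).
  have [b2 [ab2 b2b b2b']] := min_lt ab ab'.
  by exists b2 => //; split=> // x ax xb; apply: (H x ax _).1; ord.
exfalso; have [b1 ab1 H] := rgerm_and nC (rgerm_itv ab).
have [b' [ab' b'b b'b1]] := min_lt ab ab1.
have {H}nC x : a < x -> x < b' -> ~ cont1 f x.
  by move=> ax xb'; apply: (H x ax _).1; ord.
pose Im y := exists x, a < x /\ x < b' /\ f x = y.
have dIm : def1 I setT Im by rewrite /Im; dsolve.
(* Otherwise the image is finite and [f] takes one of its values on a whole germ, against
   injectivity. *)
have [c [e [ce He]]] : exists c e, c < e /\ forall y, c < y -> y < e -> Im y.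
  apply: contrapT => nE.
  have [|s sP] := no_itv_fin om dIm.
    move=> c e ce; apply: contrapT => nE'; apply: nE; exists c, e; split=> // y cy ye.
    by apply: contrapT => nI; apply: nE'; exists y.
  have [||y ys [g ag Hg]] := @rgerm_seq _ s (fun y x => f x = y) a b' _ ab'.
  - by move=> y; dsolve.
  - by move=> t at_ tb'; exists (f t) => //; apply: sP; exists t.
  have [x2 [ax2 x2g x2b]] := btw12 om ag ab.
  have [x1 [ax1 x1x2]] := btw om ax2.
  by apply: (inj x1 x2) => //; rewrite (Hg x1) ?(Hg x2) //; ord.
have [y0 [cy0 y0e]] := btw om ce.
have [x0 [ax0 [x0b' fx0]]] := He y0 cy0 y0e.
apply: (nC x0 ax0 x0b') => c' e'; rewrite fx0 => cy0' ye0'.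
have [y1 [cy1 cy1' y1y0]] := btw21 om cy0 cy0'.
have [y2 [y0y2 y2e y2e']] := btw12 om y0e ye0'.
have [x1 [ax1 [x1b' fx1]]] := He y1 cy1 (lt_trans y1y0 y0e).
have [x2 [ax2 [x2b' fx2]]] := He y2 (lt_trans cy0 y0y2) y2e.
(* [x0] lies between [x1] and [x2], otherwise [qmono] fails *)
have K u v w : a < u -> u < v -> v < w -> w < b' ->
    forall c e, c < f u -> f u < e -> c < f w -> f w < e -> c < f v /\ f v < e.
  by move=> *; apply: (qm u v w) => //; ord.
have [lo _] := omin_no_min om y1; have [hi y2hi] := omin_no_max om y2.
have [lo' lo'y1] := omin_no_min om y1.
have B12 : (x1 < x0 /\ x0 < x2) \/ (x2 < x0 /\ x0 < x1).
  case: (ltgtP x1 x0) => [h1|h1|E]; last by move: y1y0; rewrite -fx1 -fx0 E ltxx.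
    case: (ltgtP x0 x2) => [|h2|E]; [by left| |by move: y0y2; rewrite -fx2 -fx0 E ltxx].
    exfalso; case: (ltgtP x1 x2) => [h3|h3|E].
    - have [||||] := K x1 x2 x0 ax1 h3 h2 x0b' lo' y2; rewrite ?fx1 ?fx2 ?fx0 => *; ord.
    - have [||||] := K x2 x1 x0 ax2 h3 h1 x0b' y1 hi; rewrite ?fx1 ?fx2 ?fx0 => *; ord.
    - by have := lt_trans y1y0 y0y2; rewrite -fx1 -fx2 E ltxx.
  case: (ltgtP x0 x2) => [h2||E]; [|by right|by move: y0y2; rewrite -fx2 -fx0 E ltxx].
  exfalso; case: (ltgtP x1 x2) => [h3|h3|E].
  - have [||||] := K x0 x1 x2 ax0 h1 h3 x2b' y1 hi; rewrite ?fx1 ?fx2 ?fx0 => *; ord.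
  - have [||||] := K x0 x2 x1 ax0 h2 h3 x1b' lo' y2; rewrite ?fx1 ?fx2 ?fx0 => *; ord.
  - by have := lt_trans y1y0 y0y2; rewrite -fx1 -fx2 E ltxx.
case: B12 => -[h1 h2].
  exists x1, x2; split=> //; split=> // y h3 h4.
  by apply: (K x1 y x2) => //; rewrite ?fx1 ?fx2; ord.
exists x2, x1; split=> //; split=> // y h3 h4.
by apply: (K x2 y x1) => //; rewrite ?fx1 ?fx2; ord.
Qed.

(** How [f z] compares with [f x] for [z] just after [x], and for [z] just before [x], does not
    depend on [x] near [a]. Of the nine combinations, two make every point a strict extremum and
    fall to [no_local_max]; [mix] and [mix'] exclude equality on one side only; the remaining three
    are the constant, increasing and decreasing cases. *)
Theorem monotonicity (f : M -> M) a : dfn1 I setT f ->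
  exists2 b, a < b & (forall x, a < x -> x < b -> cont1 f x) /\ qmono f a b.
Proof.
move=> df; have [b0 ab0] := omin_no_max om a.
pose Rl (z x : M) : Prop := f z < f x; pose Re z x := f z = f x.
pose Rg (z x : M) : Prop := f x < f z.
have dl : defr I setT Rl by rewrite /Rl; dsolve.
have de : defr I setT Re by rewrite /Re; dsolve.
have dg : defr I setT Rg by rewrite /Rg; dsolve.
have dr R : defr I setT R -> def1 I setT (fun x => rgerm x (fun z => R z x)).
  by move=> dR; dsolve.
have dll R : defr I setT R -> def1 I setT (fun x => lgerm x (fun z => R z x)).
  by move=> dR; dsolve.
have tot x z : Rl z x \/ Re z x \/ Rg z x.
  by rewrite /Rl /Re /Rg; case: (ltgtP (f z) (f x)) => ?; auto.
have r3 : exists R, [/\ R = Rl \/ R = Re \/ R = Rg, defr I setT R &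
    rgerm a (fun x => rgerm x (fun z => R z x))].
  have T x : a < x -> x < b0 -> rgerm x (fun z => Rl z x) \/
      (rgerm x (fun z => Re z x) \/ rgerm x (fun z => Rg z x)).
    have [c xc] := omin_no_max om x => _ _.
    have d1 : def1 I setT (fun z => Rl z x) by dsolve.
    have d2 : def1 I setT (fun z => Re z x) by dsolve.
    have [|[e xe He]] := rgerm_or d1 xc (fun t _ _ => tot x t); first by left.
    by right; apply: (rgerm_or d2 xe).
  have [|H] := rgerm_or (dr _ dl) ab0 T; first by exists Rl; split=> //; left.
  case: H => c ac Hc.
  have [|H] := rgerm_or (dr _ de) ac Hc; first by exists Re; split=> //; auto.
  by exists Rg; split=> //; auto.
have l3 : exists R, [/\ R = Rl \/ R = Re \/ R = Rg, defr I setT R &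
    rgerm a (fun x => lgerm x (fun z => R z x))].
  have T x : a < x -> x < b0 -> lgerm x (fun z => Rl z x) \/
      (lgerm x (fun z => Re z x) \/ lgerm x (fun z => Rg z x)).
    move=> _ _.
    have d1 : def1 I setT (fun z => Rl z x) by dsolve.
    have d2 : def1 I setT (fun z => Re z x) by dsolve.
    have [|H1] := lgerm_dec om x d1; first by left.
    have [|H2] := lgerm_dec om x d2; first by right; left.
    right; right; apply: lgerm_sub (lgerm_and H1 H2) => z [n1 n2].
    by case: (tot x z) => // -[].
  have [|H] := rgerm_or (dll _ dl) ab0 T; first by exists Rl; split=> //; left.
  case: H => c ac Hc.
  have [|H] := rgerm_or (dll _ de) ac Hc; first by exists Re; split=> //; auto.
  by exists Rg; split=> //; auto.
have [R [HR dR gR]] := r3; have [R' [HR' dR' gR']] := l3.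
have [b ab Hb] := rgerm_and gR gR'.
have Hr x : a < x -> x < b -> rgerm x (fun z => R z x) by move=> h1 h2; apply: (Hb x h1 h2).1.
have Hl x : a < x -> x < b -> lgerm x (fun z => R' z x) by move=> h1 h2; apply: (Hb x h1 h2).2.
have fin_inj : (forall x y, a < x -> x < y -> y < b -> f x <> f y) -> qmono f a b ->
    exists2 b, a < b & (forall x, a < x -> x < b -> cont1 f x) /\ qmono f a b.
  move=> inj qm; have [b' ab' [b'b Hc]] := inj_qmono_cont df ab inj qm.
  exists b' => //; split=> // t1 t t2 c e h1 h2 h3 h4.
  by apply: qm => //; ord.
(* a right germ on which [f] is constant meets the left germs inside it *)
have mix : R = Re -> R' = Re.
  move=> ER; have [x [ax xb]] := btw om ab.
  have := Hr x ax xb; rewrite ER => -[c xc Hc].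
  have [z [xz zc zb]] := btw12 om xc xb.
  have [w [xw wz RR]] := lgerm_ex om (Hl z (lt_trans ax xz) zb) xz.
  have : f w = f z by rewrite (Hc z) // (Hc w) //; ord.
  by case: HR' RR => [->|[->//|->]]; rewrite /Rl /Rg => + E; rewrite E ltxx.
have mix' : R' = Re -> R = Re.
  move=> ER; have [x [ax xb]] := btw om ab.
  have := Hl x ax xb; rewrite ER => -[c xc Hc].
  have [z [xz zc zb]] := btw21 om xc ax.
  have [w [xw wz RR]] := rgerm_ex om (Hr z zc (lt_trans zb xb)) zb.
  have : f w = f z by rewrite (Hc z) // (Hc w) //; ord.
  by case: HR RR => [->|[->//|->]]; rewrite /Rl /Rg => + E; rewrite E ltxx.
have glob R0 : defr I setT R0 -> (forall x y z, R0 x y -> R0 y z -> R0 x z) ->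
    (forall x z, R' z x -> R0 z x) -> (forall x z, R z x -> R0 x z) ->
    forall x y, a < x -> x < y -> y < b -> R0 x y.
  move=> d0 t0 H1 H2; apply: loc_glob => // x ax xb.
    by apply: lgerm_sub (Hl x ax xb) => z; apply: H1.
  by apply: rgerm_sub (Hr x ax xb) => z; apply: H2.
have mono_fin R0 : (forall x y, R0 x y -> f x < f y \/ f y < f x) ->
    (forall x y z c e, R0 x y -> R0 y z -> c < f x -> f x < e -> c < f z -> f z < e ->
      c < f y /\ f y < e) ->
    (forall x y, a < x -> x < y -> y < b -> R0 x y) ->
    exists2 b, a < b & (forall x, a < x -> x < b -> cont1 f x) /\ qmono f a b.
  move=> H1 H2 H3; apply: fin_inj => [x y ax xy yb E|t1 t t2 c e h1 h2 h3 h4].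
    by have := H1 _ _ (H3 x y ax xy yb); rewrite E ltxx => -[].
  by apply: H2; apply: H3 => //; ord.
have [ER|nER] := pselect (R = Re).
  have ER' := mix ER.
  have C : forall x y, a < x -> x < y -> y < b -> Re x y.
    by apply: glob => //; rewrite ?ER ?ER' /Re // => x y z -> ->.
  have C' x y : a < x -> x < b -> a < y -> y < b -> f x = f y.
    by move=> h1 h2 h3 h4; case: (ltgtP x y) => [h|h|->//]; [|apply/esym]; apply: C.
  exists b => //; split=> [x ax xb c e cx xe|].
    by exists a, b; split=> //; split=> // y ay yb; rewrite -(C' x).
  move=> t1 t t2 c e h1 h2 h3 h4 h5 h6 _ _; rewrite -(C' t1) //; ord.
have nER' : R' <> Re by move=> /mix'.
case: HR => [ER|[//|ER]]; case: HR' => [ER'|[//|ER']].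
- exfalso; apply: (@no_local_max Rl dl _ _ a b ab).
  + by move=> x y z; apply: lt_trans.
  + by move=> x; rewrite /Rl ltxx.
  by move=> x ax xb; split; [rewrite -ER'; apply: Hl|rewrite -ER; apply: Hr].
- apply: (mono_fin Rg); last first.
  + by apply: glob => //; rewrite ?ER ?ER' // /Rg => x y z h1 h2; ord.
  + by rewrite /Rg => *; split; ord.
  by rewrite /Rg; auto.
- apply: (mono_fin Rl); last first.
  + by apply: glob => //; rewrite ?ER ?ER' // /Rl => x y z h1 h2; ord.
  + by rewrite /Rl => *; split; ord.
  by rewrite /Rl; auto.
exfalso; apply: (@no_local_max Rg dg _ _ a b ab).
- by move=> x y z h1 h2; apply: lt_trans h2 h1.
- by move=> x; rewrite /Rg ltxx.
by move=> x ax xb; split; [rewrite -ER'; apply: Hl|rewrite -ER; apply: Hr].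
Qed.

End Monotonicity.

(** * Counting, boxes, and the induction on the dimension *)

Section Counting.
Context {d : Order.disp_t} {M : orderType d}.
Implicit Types P Q : M -> Prop.

(** The only form in which cardinalities enter formulas: [els] and [cnt] live outside the language
    and are made definable through it. *)
Definition atl (k : nat) P : Prop :=
  exists z : 'I_k -> M, (forall i j, z i = z j -> i = j) /\ forall i, P (z i).

Lemma atl_size k P (s : seq M) : uniq s -> (forall t, P t <-> t \in s) ->
  atl k P <-> (k <= size s)%N.
Proof.
move=> us sP; split=> [[z [zi zP]]|ks].
  have := @uniq_leq_size _ (map z (enum 'I_k)) s.
  rewrite size_map size_enum_ord; apply.
    by rewrite map_inj_uniq ?enum_uniq // => i j /zi.
  by move=> t /mapP[i _ ->]; apply/sP.
case: s us sP ks => [|t0 s] us sP ks.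
  (* Nothing says here that [M] is inhabited, so the empty enumeration is built by elimination from
     ['I_0]. *)
  by case: k ks => // _; exists (fun i : 'I_0 => let: Ordinal m h := i in match notF h with end); split=> -[].
exists (fun i => nth t0 (t0 :: s) i); split=> [i j /eqP|i].
  by rewrite nth_uniq ?(leq_trans (ltn_ord _) ks) // => /eqP /val_inj.
by apply/sP/mem_nth; apply: leq_trans ks.
Qed.

Lemma fin_els P : fin P -> exists s : seq M, sorted <%O s /\ forall t, P t <-> t \in s.
Proof.
move=> [s sP]; exists (sort <=%O (undup [seq t <- s | `[< P t >]])); split.
  by rewrite sort_lt_sorted undup_uniq.
move=> t; rewrite mem_sort mem_undup mem_filter; split=> [Pt|/andP[/asboolP]//].
by apply/andP; split; [apply/asboolP|apply: sP].
Qed.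

(** The increasing enumeration of a finite [P], with the empty list as junk value when [P] is
    infinite. *)
Definition els P : seq M :=
  if pselect (fin P) is left h then sval (cid (fin_els h)) else [::].

Lemma els_sorted P : sorted <%O (els P).
Proof. by rewrite /els; case: pselect => // h; case: cid => s []. Qed.

Lemma els_uniq P : uniq (els P).
Proof. by apply: (sorted_uniq lt_trans ltxx); apply: els_sorted. Qed.

Lemma mem_els P t : fin P -> P t <-> t \in els P.
Proof. by rewrite /els; case: pselect => // h _; case: cid => s []. Qed.

Definition cnt P (t : M) := count (fun u => u < t) (els P).

Lemma cnt_atl k P t : fin P -> atl k (fun u => P u /\ u < t) <-> (k <= cnt P t)%N.
Proof.
move=> fP; rewrite (@atl_size k _ [seq u <- els P | u < t]); last 2 first.
- by rewrite filter_uniq // els_uniq.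
- by move=> u; rewrite mem_filter mem_els //; split=> [[-> ->]|/andP[]].
by rewrite size_filter.
Qed.

Lemma cnt_exact k P t : fin P ->
  atl k (fun u => P u /\ u < t) /\ ~ atl k.+1 (fun u => P u /\ u < t) <-> cnt P t = k.
Proof.
move=> fP; rewrite !cnt_atl //; split=> [[h1 /negP]|<-]; last by rewrite ltnn; split.
by rewrite -leqNgt => h2; apply/eqP; rewrite eqn_leq h1 h2.
Qed.

Lemma els_atl k P : fin P -> atl k P <-> (k <= size (els P))%N.
Proof. by move=> fP; apply: atl_size; [apply: els_uniq|move=> t; apply: mem_els]. Qed.

Lemma cnt_le P t t' : t <= t' -> (cnt P t <= cnt P t')%N.
Proof. by move=> tt'; apply: sub_count => u /= ut; apply: lt_le_trans ut tt'. Qed.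

Lemma cnt_size P t : (cnt P t <= size (els P))%N.
Proof. exact: count_size. Qed.

Lemma cnt_split P t t' : t <= t' ->
  cnt P t' = (cnt P t + count (fun u => (t <= u)%O && (u < t')%O) (els P))%N.
Proof.
move=> tt'; rewrite /cnt -count_predUI [X in (_ + X)%N](_ : _ = 0%N) ?addn0; last first.
  by apply/eqP; rewrite eqn0Ngt -has_count -all_predC; apply/allP => u _ /=; case: leP.
apply: eq_count => u /=; case: ltP => ut' /=; case: ltP => ut //=.
by exfalso; move: (lt_le_trans ut tt'); rewrite ltNge ut'.
Qed.

Lemma cnt_lt P t t' : fin P -> P t -> t < t' -> (cnt P t < cnt P t')%N.
Proof.
move=> fP Pt tt'; rewrite (cnt_split P (ltW tt')) -[X in (X < _)%N]addn0 ltn_add2l -has_count.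
by apply/hasP; exists t; [apply/mem_els|rewrite lexx].
Qed.

Lemma cnt_const P t t' : fin P -> t <= t' -> (forall u, t <= u -> u < t' -> ~ P u) ->
  cnt P t = cnt P t'.
Proof.
move=> fP tt' H; rewrite (cnt_split P tt') [X in (_ + X)%N](_ : _ = 0%N) ?addn0 //.
apply/eqP; rewrite eqn0Ngt -has_count; apply/hasP => -[u /(mem_els _ fP) Pu /andP[tu ut]].
exact: H Pu.
Qed.

Lemma cnt_const_inv P t t' u : fin P -> cnt P t = cnt P t' -> t <= u -> u < t' -> ~ P u.
Proof.
move=> fP E tu ut' Pu; have := cnt_lt fP Pu ut'.
by rewrite -E ltnNge cnt_le.
Qed.

Lemma cnt_one P t t' v : fin P -> t <= v -> v < t' -> P v ->
  (forall u, t <= u -> u < t' -> P u -> u = v) -> cnt P t' = (cnt P t).+1.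
Proof.
move=> fP tv vt' Pv H; rewrite (cnt_split P (le_trans tv (ltW vt'))).
rewrite -addn1; congr (_ + _)%N.
rewrite (@eq_in_count _ _ (pred1 v)) ?count_uniq_mem ?els_uniq //.
  by have -> : v \in els P by apply/mem_els.
move=> u /(mem_els _ fP) Pu /=; apply/idP/eqP => [/andP[h1 h2]|->]; first exact: H.
by rewrite tv vt'.
Qed.

Lemma cnt0 P t : fin P -> (forall u, u < t -> ~ P u) -> cnt P t = 0%N.
Proof.
move=> fP H; apply/eqP; rewrite eqn0Ngt -has_count; apply/hasP => -[u /(mem_els _ fP) Pu ut].
exact: H Pu.
Qed.

Lemma cnt_all P t : fin P -> (forall u, P u -> u < t) -> cnt P t = size (els P).
Proof.
move=> fP H; apply/eqP; rewrite -all_count; apply/allP => u /(mem_els _ fP).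
exact: H.
Qed.

Lemma cnt_inj P t t' : fin P -> P t -> P t' -> cnt P t = cnt P t' -> t = t'.
Proof.
move=> fP Pt Pt' E; case: (ltgtP t t') => //.
  by move/(cnt_lt fP Pt); rewrite E ltnn.
by move/(cnt_lt fP Pt'); rewrite E ltnn.
Qed.

Lemma cnt_nth P j : fin P -> (j < size (els P))%N -> exists2 u, P u & cnt P u = j.
Proof.
move=> fP; case E : (els P) => [//|u0 s0]; rewrite -E => js.
set u := nth u0 (els P) j; exists u; first by apply/mem_els => //; apply: mem_nth.
have so := els_sorted P; rewrite /cnt -[X in count _ X](cat_take_drop j) count_cat.
have nthlt a b : (a < b)%N -> (b < size (els P))%N -> nth u0 (els P) a < nth u0 (els P) b.
  by move=> ab bs; apply: (sorted_ltn_nth lt_trans u0 so) => //; rewrite inE // (ltn_trans ab).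
rewrite [X in (_ + X)%N](_ : _ = 0%N) ?addn0; last first.
  apply/eqP; rewrite eqn0Ngt -has_count; apply/(has_nthP u0) => -[i].
  rewrite size_drop nth_drop => ij; rewrite ltNge le_eqVlt.
  case: i ij => [|i] ij; first by rewrite addn0 eqxx.
  have h : u < nth u0 (els P) (j + i.+1).
    by apply: nthlt; [rewrite addnS ltnS leq_addr|rewrite -ltn_subRL].
  by rewrite h orbT.
have -> : count (fun u1 => u1 < u) (take j (els P)) = size (take j (els P)).
  apply/eqP; rewrite -all_count; apply/(all_nthP u0) => i; rewrite size_take js => ij.
  by rewrite nth_take // nthlt.
by rewrite size_take js.
Qed.

Lemma cnt_ex P j t : fin P -> (j < cnt P t)%N -> exists u, [/\ P u, cnt P u = j & u < t].
Proof.
move=> fP jt; have [u Pu uE] := cnt_nth fP (leq_trans jt (cnt_size P t)).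
exists u; split=> //; rewrite ltNge; apply/negP => /(cnt_le P).
by rewrite uE leqNgt jt.
Qed.

Lemma fin_min P : fin P -> (exists t, P t) -> exists2 m, P m & forall t, P t -> m <= t.
Proof.
move=> fP [t Pt]; have : (0 < size (els P))%N.
  by rewrite -has_predT; apply/hasP; exists t => //; apply/mem_els.
move=> /(cnt_nth fP)[u Pu uE]; exists u => // v Pv; rewrite leNgt; apply/negP => /(cnt_lt fP Pv).
by rewrite uE.
Qed.

Lemma fin_max P : fin P -> (exists t, P t) -> exists2 m, P m & forall t, P t -> t <= m.
Proof.
move=> fP [t Pt]; have s0 : (0 < size (els P))%N.
  by rewrite -has_predT; apply/hasP; exists t => //; apply/mem_els.
have [|u Pu uE] := @cnt_nth P (size (els P)).-1 fP; first by rewrite prednK.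
exists u => // v Pv; rewrite leNgt; apply/negP => /(cnt_lt fP Pu).
rewrite uE prednK // => H.
have : all (fun w => w < v) (els P) by rewrite all_count eqn_leq H cnt_size.
by move=> /allP /(_ v); rewrite -(mem_els v fP) ltxx => /(_ Pv).
Qed.

End Counting.

(** * Boxes as basic neighbourhoods *)

Section Boxes.
Context {d : Order.disp_t} {M : orderType d}.

Definition bx n (lo hi x : 'I_n -> M) : Prop := forall i, lo i < x i /\ x i < hi i.

Definition nbx n (x : 'I_n -> M) (P : ('I_n -> M) -> Prop) : Prop :=
  exists lo hi, bx lo hi x /\ forall y, bx lo hi y -> P y.

Definition hasbox n (X : ('I_n -> M) -> Prop) : Prop := exists x, nbx x X.

(** Continuity at [x] along [C], expressed with boxes so as to be first-order; [conton_continuous]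
    translates it to the product topology. *)
Definition contpt n (C : ('I_n -> M) -> Prop) (f : ('I_n -> M) -> M) (x : 'I_n -> M) : Prop :=
  forall c e, c < f x -> f x < e -> nbx x (fun y => C y -> c < f y /\ f y < e).

Definition conton n (C : ('I_n -> M) -> Prop) (f : ('I_n -> M) -> M) : Prop :=
  forall x, C x -> contpt C f x.

Lemma nbx_in n (x : 'I_n -> M) P : nbx x P -> P x.
Proof. by move=> [lo [hi [xb]]]; apply. Qed.

Lemma nbx_sub n (x : 'I_n -> M) (P Q : ('I_n -> M) -> Prop) :
  (forall y, P y -> Q y) -> nbx x P -> nbx x Q.
Proof. by move=> PQ [lo [hi [xb H]]]; exists lo, hi; split=> // y /H/PQ. Qed.

Lemma nbx_and n (x : 'I_n -> M) P Q : nbx x P -> nbx x Q -> nbx x (fun y => P y /\ Q y).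
Proof.
move=> [lo [hi [xb H]]] [lo' [hi' [xb' H']]].
exists (fun i => Order.max (lo i) (lo' i)), (fun i => Order.min (hi i) (hi' i)).
split=> [i|y yb]; first by rewrite gt_max lt_min; have [-> ->] := xb i; have [-> ->] := xb' i.
by split; [apply: H|apply: H'] => i; have := yb i; rewrite gt_max lt_min => -[/andP[? ?] /andP[? ?]].
Qed.

Lemma nbx_nbx n (x : 'I_n -> M) P : nbx x P -> nbx x (fun y => nbx y P).
Proof. by move=> [lo [hi [xb H]]]; exists lo, hi; split=> // y yb; exists lo, hi. Qed.

Lemma hasbox_sub n (X Y : ('I_n -> M) -> Prop) :
  (forall x, X x -> Y x) -> hasbox X -> hasbox Y.
Proof. by move=> XY [x nX]; exists x; apply: nbx_sub nX. Qed.

Lemma nbx_ins n (i : 'I_n.+1) (y : 'I_n -> M) P a b s : nbx y P -> a < s -> s < b ->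
  nbx (ins i y s) (fun z => [/\ P (del i z), a < z i & z i < b]).
Proof.
move=> [lo [hi [yb H]]] as_ sb; exists (ins i lo a), (ins i hi b); split=> [j|z zb].
  by rewrite /ins; case: unliftP => [k _|_]; [apply: yb|].
have := zb i; rewrite !ins_id => -[? ?]; split=> //; apply: H => k.
by have := zb (lift i k); rewrite !ins_lift.
Qed.

Lemma nbx_del n (i : 'I_n.+1) (x : 'I_n.+1 -> M) P : nbx x P ->
  exists a b, [/\ a < x i, x i < b &
    nbx (del i x) (fun y => forall s, a < s -> s < b -> P (ins i y s))].
Proof.
move=> [lo [hi [xb H]]]; exists (lo i), (hi i); have [? ?] := xb i; split=> //.
exists (del i lo), (del i hi); split=> [k|y yb s as_ sb]; first exact: xb.
apply: H => j; rewrite /ins; case: unliftP => [k ->|->] //; exact: yb.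
Qed.

End Boxes.

Ltac dhook ::=
  match goal with
  | |- def _ _ (fun e => bd _ _) => rewrite /bd
  | |- def _ _ (fun e => rgerm _ _) => rewrite /rgerm
  | |- def _ _ (fun e => lgerm _ _) => rewrite /lgerm
  | |- def _ _ (fun e => is_inf _ _) => rewrite /is_inf
  | |- def _ _ (fun e => is_sup _ _) => rewrite /is_sup
  | |- def _ _ (fun e => cont1 _ _) => rewrite /cont1
  | |- def _ _ (fun e => qmono _ _ _) => rewrite /qmono
  | |- def _ _ (fun e => atl _ _) => rewrite /atl
  | |- def _ _ (fun e => nbx _ _) => rewrite /nbx /bx
  | |- def _ _ (fun e => hasbox _) => rewrite /hasbox
  | |- def _ _ (fun e => contpt _ _ _) => rewrite /contpt
  | |- def _ _ (fun e => conton _ _) => rewrite /conton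
  end.

(** * Statements of the induction; boxes, thin sets and graphs *)

Section Uniform.
Context {d : Order.disp_t} {M : orderType d} {L : language} (I : structure L M).
Hypothesis om : o_minimal I.
Notation D := (def I setT).

Lemma nbxT n (x : 'I_n -> M) (P : ('I_n -> M) -> Prop) : (forall y, P y) -> nbx x P.
Proof.
move=> HP; have /choice[lo Hlo] i := omin_no_min om (x i).
have /choice[hi Hhi] i := omin_no_max om (x i).
by exists lo, hi; split=> // i; split.
Qed.

(** Off the domain of the partial function the value is an arbitrary point [p]. This point is a new
    parameter, so the function is obtained over [setT] only. *)
Lemma select_fun (W : finType) (R : (W -> M) -> M -> Prop) : def2 I setT R ->
  (forall x t t', R x t -> R x t' -> t = t') ->
  exists2 f, dfn I setT f & forall x t, R x t -> f x = t.
Proof.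
move=> dR uR; have [p _] := omin_nonempty om.
have /choice[f fP] : forall x, exists t, R x t \/ ((~ exists t', R x t') /\ t = p).
  move=> x; have [[t Rt]|nE] := pselect (exists t, R x t); first by exists t; left.
  by exists p; right.
exists f; last first.
  by move=> x t Rt; case: (fP x) => [|[[]]]; [move/uR; apply|exists t].
have H : D (fun e : option W -> M => R (fun v => e (Some v)) (e None) \/
    ((~ exists t', R (fun v => e (Some v)) t') /\ e None = p)) by dsolve.
apply: def_iff H => e; split=> [[Rt|[nE ->]]|->]; last exact: fP.
  by case: (fP (fun v => e (Some v))) => [/uR/(_ Rt)-> //|[[]]]; exists (e None).
by case: (fP (fun v => e (Some v))) => [Rt|[_ ->//]]; case: nE; exists (f (fun v => e (Some v))).
Qed.

Definition pw_continuous n := forall f : ('I_n -> M) -> M, dfn I setT f ->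
  exists (J : finType) (P : J -> ('I_n -> M) -> Prop),
    [/\ forall j, D (P j), forall x, exists j, P j x & forall j, conton (P j) f].

Definition unif_finite n := forall Y : ('I_n -> M) -> M -> Prop, def2 I setT Y ->
  (forall x, fin (Y x)) -> exists N, forall x, ~ atl N (Y x).

Definition Tint n (i : 'I_n) (X : ('I_n -> M) -> Prop) (x : 'I_n -> M) : Prop :=
  X x /\ exists c e, [/\ c < x i, x i < e & forall s, c < s -> s < e -> X (upd i x s)].

(* [chain X (enum 'I_n)] keeps the points of [X] interior to their fibres in every coordinate
   direction, taken successively from the last one; what is discarded is thin. *)
Definition chain n (X : ('I_n -> M) -> Prop) (s : seq 'I_n) : ('I_n -> M) -> Prop :=
  foldr (@Tint n) X s.

Definition chain_has_box n := forall X, D X -> forall x, chain X (enum 'I_n) x -> hasbox X.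

Definition thin n (i : 'I_n) (Z : ('I_n -> M) -> Prop) : Prop :=
  forall x, fin (fun s => Z (upd i x s)).

Definition thin_no_box n := forall Z : 'I_n -> ('I_n -> M) -> Prop,
  (forall i, D (Z i)) -> (forall i, thin i (Z i)) -> ~ hasbox (fun x => exists i, Z i x).

Definition box_of_union n := forall X Y : ('I_n -> M) -> Prop, D X -> D Y ->
  hasbox (fun x => X x \/ Y x) -> hasbox X \/ hasbox Y.

Definition small_in_graphs n := forall X : ('I_n.+1 -> M) -> Prop, D X -> ~ hasbox X ->
  exists (J : finType) (i : J -> 'I_n.+1) (h : J -> ('I_n -> M) -> M),
    (forall j, dfn I setT (h j)) /\
    forall x, X x -> exists j, x (i j) = h j (del (i j) x).

Lemma def_Tint n (i : 'I_n) X : D X -> D (Tint i X).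
Proof. by move=> dX; rewrite /Tint; dsolve. Qed.

Lemma def_chain n X (s : seq 'I_n) : D X -> D (chain X s).
Proof. by move=> dX; elim: s => [|i s IH] //=; apply: def_Tint. Qed.

Lemma fin_sub (P Q : M -> Prop) : (forall t, P t -> Q t) -> fin Q -> fin P.
Proof. by move=> PQ [s sP]; exists s => t /PQ/sP. Qed.

Lemma fin_or (P Q : M -> Prop) : fin P -> fin Q -> fin (fun t => P t \/ Q t).
Proof.
move=> [s sP] [r rP]; exists (s ++ r) => t.
by rewrite mem_cat => -[/sP ->|/rP ->]; rewrite ?orbT.
Qed.

Lemma fin_bigor (J : finType) (P : J -> M -> Prop) :
  (forall j, fin (P j)) -> fin (fun t => exists j, P j t).
Proof.
move=> /choice[s sP]; exists (flatten [seq s j | j <- enum J]) => t [j /sP ts].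
by apply/flattenP; exists (s j) => //; apply/map_f; rewrite mem_enum.
Qed.

(** What a step of the chain discards on a line in its direction consists of boundary points of the
    fibre, and these are finitely many. *)
Lemma thin_cover n X (s : seq 'I_n) : D X -> exists Z : 'I_n -> ('I_n -> M) -> Prop,
  [/\ forall i, D (Z i), forall i, thin i (Z i) &
      forall x, X x -> chain X s x \/ exists i, Z i x].
Proof.
move=> dX; elim: s => [|i s [Z [dZ tZ XZ]]].
  exists (fun _ _ => False); split=> [i|i x|x]; [exact: def_cst|by exists [::]|by left].
exists (fun j x => Z j x \/ (j = i /\ chain X s x /\ ~ Tint i (chain X s) x)).
have dC := def_chain s dX; have dT := def_Tint i dC.
split=> [j|j x|x]; first by have := dZ j; dsolve.
  apply: fin_or; first exact: tZ.
  have [->|ji] := eqVneq j i; last by exists [::] => t [E]; rewrite E eqxx in ji.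
  apply: fin_sub (bd_fin om (P := fun t => chain X s (upd i x t)) _); last by dsolve.
  move=> t [_ [Ct nT]] [c [e [ct te H]]]; apply: nT; split=> //.
  rewrite upd_at; exists c, e; split=> // u cu ue.
  rewrite (_ : upd i (upd i x t) u = upd i x u); first by apply/(H u cu ue).
  by apply/funext => k; rewrite /upd; case: eqP.
move=> /XZ[Cx|[j Zj]]; last by right; exists j; left.
have [Tx|nT] := pselect (Tint i (chain X s) x); first by left.
by right; exists i; right.
Qed.

Lemma inj_itv N (a b : M) : a < b ->
  exists z : 'I_N -> M, (forall i j, z i = z j -> i = j) /\ forall i, a < z i /\ z i < b.
Proof.
move=> ab; suff [s [ss us sP]] : exists s : seq M, [/\ size s = N, uniq s &
    forall t, t \in s -> a < t /\ t < b].
  exists (fun i => nth a s i); split=> [i j /eqP|i]; last by apply/sP/mem_nth; rewrite ss.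
  by rewrite nth_uniq ?ss // => /eqP/val_inj.
elim: N b ab => [|N IH] b ab; first by exists [::].
have [t [at_ tb]] := btw om ab; have [s [ss us sP]] := IH t at_.
exists (t :: s); split=> /=; [by rewrite ss| |].
  by rewrite us andbT; apply/negP => /sP[_]; rewrite ltxx.
move=> u; rewrite inE => /orP[/eqP ->//|/sP[h1 h2]]; split=> //; ord.
Qed.

(** The set thin in the last direction has fewer than [N] points on each vertical line, so over
    every base point one of [N] fixed heights avoids it. The slices at these heights of the other
    thin sets would then cover a box of the base. *)
Lemma thin_no_box_step n : unif_finite n -> thin_no_box n -> thin_no_box n.+1.
Proof.
move=> uf nt Z dZ tZ [x nx].
have [N HN] : exists N, forall y, ~ atl N (fun s => Z ord_max (ins ord_max y s)).
  apply: uf; first by have := dZ ord_max; dsolve.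
  move=> y; have := tZ ord_max (ins ord_max y (x ord_max)).
  by apply: fin_sub => s; rewrite upd_ins.
have [a [b [ax xb H]]] := nbx_del ord_max nx.
have [z [zi zP]] := inj_itv N (lt_trans ax xb).
apply: (nt (fun i y => exists k : 'I_N, Z (lift ord_max i) (ins ord_max y (z k)))).
- by move=> i; have := dZ (lift ord_max i); dsolve.
- move=> i y; apply: fin_bigor => k.
  apply: fin_sub (tZ (lift ord_max i) (ins ord_max y (z k))) => s.
  by rewrite ins_upd.
exists (del ord_max x); apply: nbx_sub H => y H.
have [k nZ] : exists k, ~ Z ord_max (ins ord_max y (z k)).
  apply: contrapT => nE; apply: (HN y); exists z; split=> // i.
  by apply: contrapT => nZ; apply: nE; exists i.
have [i Zi] := H (z k) (zP k).1 (zP k).2.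
case: (unliftP ord_max i) Zi => [j ->|-> //] Zj.
by exists j, k.
Qed.

(** If neither set contains a box, both chains are empty and the union is covered by thin sets. *)
Lemma box_of_union_of n : chain_has_box n -> thin_no_box n -> box_of_union n.
Proof.
move=> dn nt X Y dX dY [x nx]; apply: contrapT => /not_orP[nX nY].
have [Z [dZ tZ XZ]] := thin_cover (enum 'I_n) dX.
have [Z' [dZ' tZ' YZ]] := thin_cover (enum 'I_n) dY.
apply: (nt (fun i x => Z i x \/ Z' i x)).
- by move=> i; have := dZ i; have := dZ' i; dsolve.
- by move=> i y; apply: fin_or; [apply: tZ|apply: tZ'].
exists x; apply: nbx_sub nx => y [/XZ|/YZ] [C|[i Zi]].
- by case: nX; apply: dn C.
- by exists i; left.
- by case: nY; apply: dn C.
- by exists i; right.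
Qed.

Lemma box_of_union_cover n (J : finType) (P : J -> ('I_n -> M) -> Prop) X : box_of_union n -> D X ->
  (forall j, D (P j)) -> (forall x, X x -> exists j, P j x) -> hasbox X ->
  exists j, hasbox (fun x => X x /\ P j x).
Proof.
move=> un dX dP XP hX.
suff : forall s : seq J, hasbox (fun x => X x /\ exists2 j, j \in s & P j x) ->
    exists j, hasbox (fun x => X x /\ P j x).
  move=> H; apply: (H (enum J)).
  apply: hasbox_sub hX => x Xx; split=> //; have [j Pj] := XP x Xx.
  by exists j => //; rewrite mem_enum.
elim=> [|j s IH] hs; first by have [x /nbx_in[_ []]] := hs.
have dPj := dP j.
have dXP : D (fun x => X x /\ P j x) by dsolve.
have dE : D (fun x => X x /\ exists2 j, j \in s & P j x).
  apply: def_and => //; apply: def_iff (def_exi (X := fun x j => j \in s /\ P j x) _).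
    by move=> x; split=> [[k []]|[k]]; exists k.
  by move=> k; apply: def_and; [exact: def_cst|exact: dP].
have [||h] := un _ _ dXP dE; [|by exists j|exact: IH h].
apply: hasbox_sub hs => x [Xx [k]]; rewrite inE => /orP[/eqP ->|ks Pk]; first by left.
by right; split=> //; exists k.
Qed.

Lemma shrinkP n (X P : ('I_n -> M) -> Prop) : box_of_union n -> D X -> D P -> hasbox X ->
  hasbox (fun x => X x /\ P x) \/ hasbox (fun x => X x /\ ~ P x).
Proof.
move=> un dX dP hX; apply: un; [by dsolve|by dsolve|].
by apply: hasbox_sub hX => x Xx; have [Px|nP] := pselect (P x); [left|right].
Qed.

Notation contT f x := (contpt (fun _ => True) f x).

(** Some piece of continuity of [f] contains a box, and inside a box continuity along the piece is
    plain continuity. *)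
Lemma shrinkf n (X : ('I_n -> M) -> Prop) f :
  box_of_union n -> pw_continuous n -> D X -> dfn I setT f ->
  hasbox X -> hasbox (fun x => X x /\ contT f x).
Proof.
move=> un pc dX df hX; have [J [P [dP cP kP]]] := pc f df.
have [j [x nx]] := box_of_union_cover un dX dP (fun x _ => cP x) hX.
exists x; apply: nbx_sub (nbx_nbx nx) => y ny; have [Xy Py] := nbx_in ny.
split=> // c e cf fe; have := nbx_and ny (kP j y Py c e cf fe).
by apply: nbx_sub => w [[_ Pw] H] _; apply: H.
Qed.

(** The [k]-th graph consists of the points having exactly [k] points of [Z] below them on their
    line; uniform finiteness bounds [k]. *)
Lemma thin_graphs n (i : 'I_n.+1) Z : unif_finite n -> D Z -> thin i Z ->
  exists N (h : 'I_N -> ('I_n -> M) -> M), (forall k, dfn I setT (h k)) /\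
    forall x, Z x -> exists k, x i = h k (del i x).
Proof.
move=> uf dZ tZ; have [p _] := omin_nonempty om.
pose P y t := Z (ins i y t).
have fP y : fin (P y).
  by apply: fin_sub (tZ (ins i y p)) => s; rewrite upd_ins.
have dP : def2 I setT P by rewrite /P; dsolve.
have [N HN] := uf P dP fP.
pose R k y t := P y t /\ atl k (fun u => P y u /\ u < t) /\ ~ atl k.+1 (fun u => P y u /\ u < t).
have RE k y t : R k y t <-> P y t /\ cnt (P y) t = k.
  by rewrite /R cnt_exact.
have /choice[h hP] : forall k : 'I_N, exists f, dfn I setT f /\ forall y t, R k y t -> f y = t.
  move=> k; have [||f df fR] := @select_fun _ (R k); last by exists f.
    by rewrite /R; dsolve.
  by move=> y t t' /RE[Pt E] /RE[Pt' E']; apply: (cnt_inj (fP y)) => //; rewrite E.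
exists N, h; split=> [k|x Zx]; first by have [] := hP k.
have Px : P (del i x) (x i) by rewrite /P ins_del.
have kN : (cnt (P (del i x)) (x i) < N)%N.
  rewrite ltnNge; apply/negP => H; apply: (HN (del i x)).
  by apply/els_atl => //; apply: leq_trans H (cnt_size _ _).
exists (Ordinal kN); have [_ H] := hP (Ordinal kN); rewrite (H _ (x i)) //.
exact/RE.
Qed.

Lemma small_in_graphs_of n : unif_finite n -> chain_has_box n.+1 -> small_in_graphs n.
Proof.
move=> uf dn X dX nX; have [Z [dZ tZ XZ]] := thin_cover (enum 'I_n.+1) dX.
have /choice[G hG] : forall i, exists G : {N : nat & 'I_N -> ('I_n -> M) -> M},
    (forall k, dfn I setT (tagged G k)) /\
    forall x, Z i x -> exists k, x i = tagged G k (del i x).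
  by move=> i; have [N [h hP]] := thin_graphs uf (dZ i) (tZ i); exists (existT _ N h).
exists {i : 'I_n.+1 & 'I_(tag (G i))}, (fun j => tag j), (fun j => tagged (G (tag j)) (tagged j)).
split=> [[i k]|x /XZ[C|[i Zi]]]; first by have [] := hG i.
  by case: nX; apply: dn C.
have [_ /(_ x Zi)[k E]] := hG i.
by exists (Tagged (fun i => 'I_(tag (G i))) k).
Qed.

Lemma chain_slice n (X : ('I_n.+1 -> M) -> Prop) t (s : seq 'I_n) y :
  chain X (map (lift ord_max) s) (ins ord_max y t) <->
  chain (fun y => X (ins ord_max y t)) s y.
Proof.
elim: s y => [|i s IH] y //=; rewrite /Tint ins_lift.
split=> -[/IH Cy [c [e [cy ye H]]]]; split=> //; exists c, e; split=> // u cu ue.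
  by apply/IH; rewrite -ins_upd; apply: H.
by rewrite ins_upd; apply/IH; apply: H.
Qed.

(** Slice at height [t] the points interior in the last direction; by induction the slice contains a
    box of the base. The room [g] available above [t] is a definable function exceeding [t], so near
    a point of continuity it stays above a constant [s], and a box fits between [t] and [s]. *)
Lemma chain_has_box_step n :
  chain_has_box n -> box_of_union n -> pw_continuous n -> chain_has_box n.+1.
Proof.
move=> dn un pc X dX x; rewrite enum_ordSr.
have -> : map (widen_ord (leqnSn n)) (enum 'I_n) = map (lift ord_max) (enum 'I_n).
  by apply: eq_map => i; apply/val_inj; rewrite /= /bump leqNgt ltn_ord.
rewrite /chain foldr_rcons -/(chain _ _) -(ins_del ord_max x) chain_slice.
set t := x ord_max; have dT := def_Tint ord_max dX.
set T := Tint ord_max X in dT *; pose S y := T (ins ord_max y t).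
have dS : D S by rewrite /S; dsolve.
move/(dn _ dS) => hS; have [t1 tt1] := omin_no_max om t.
(* The cap [t1] keeps this set bounded, so that its supremum exists in [M]. *)
pose Q y s := [/\ t < s, s <= t1 & forall u, t < u -> u < s -> X (ins ord_max y u)].
have [||g dg gP] := @select_fun _ (fun y s => is_sup (Q y) s).
- by rewrite /Q; dsolve.
- move=> y s s' [h1 h2] [h1' h2']; apply/eqP; rewrite eq_le.
  apply/andP; split; rewrite leNgt; apply/negP.
    by move=> /h2[w /h1' w1 w2]; ord.
  by move=> /h2'[w /h1 w1 w2]; ord.
have gS y : S y -> t < g y /\ is_sup (Q y) (g y).
  move=> [_ [c [e [ct te H]]]]; rewrite ins_id in ct te.
  have [w [tw we wt1]] := min_lt te tt1.
  have Qw : Q y w.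
    by split=> // u tu uw; have := H u; rewrite upd_ins; apply; ord.
  have dQ : def1 I setT (Q y) by rewrite /Q; dsolve.
  have [||s sP] := has_sup om (b := t1) dQ; [by exists w|by move=> ? []|].
  rewrite (gP _ _ sP); split=> //.
  by have := sP.1 w Qw => ?; ord.
have [y0 ny0] := shrinkf un pc dS dg hS.
have [Sy0 cg] := nbx_in ny0; have [tg _] := gS _ Sy0.
have [s [ts sg]] := btw om tg; have [e ge] := omin_no_max om (g y0).
have H := nbx_and ny0 (cg s e sg ge).
have [u [tu us]] := btw om ts; exists (ins ord_max y0 u).
apply: nbx_sub (nbx_ins ord_max H tu us) => z [[[Sz _] /(_ Logic.I)[sgz _]] tz zs].
have [_ [_ /(_ _ sgz)[v [tv vt1 Hv] sv]]] := gS _ Sz.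
by rewrite -(ins_del ord_max z); apply: Hv => //; ord.
Qed.

End Uniform.

(** * Induction steps for piecewise continuity and for locally constant functions *)

Section InductionSteps.
Context {d : Order.disp_t} {M : orderType d} {L : language} (I : structure L M).
Hypothesis om : o_minimal I.
Notation D := (def I setT).
Notation contT f x := (contpt (fun _ => True) f x).

Lemma is_sup_uniq (P : M -> Prop) s s' : is_sup P s -> is_sup P s' -> s = s'.
Proof.
move=> [h1 h2] [h1' h2']; apply/eqP; rewrite eq_le.
apply/andP; split; rewrite leNgt; apply/negP.
  by move=> /h2[w /h1' w1 w2]; ord.
by move=> /h2'[w /h1 w1 w2]; ord.
Qed.

(** Just above the bottom [a] of the box [f] is continuous and weakly monotone on vertical lines, up
    to a height [b] that can be made independent of the base point. If moreover [f] is continuous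
    along the horizontal slices at two heights [t2], [t3] around the point, weak monotonicity
    squeezes the values in between, which gives joint continuity. *)
Lemma contT_dense n (f : ('I_n.+1 -> M) -> M) X :
  box_of_union I n -> pw_continuous I n -> box_of_union I n.+1 ->
  dfn I setT f -> D X -> hasbox X -> exists2 z, X z & contT f z.
Proof.
move=> un pc un1 df dX [x0 nx0]; have [a [t1 [ax xt1 nX]]] := nbx_del ord_max nx0.
have {ax xt1} at1 := lt_trans ax xt1.
pose fy y s := f (ins ord_max y s).
pose Q y u := [/\ a < u, u <= t1, forall s, a < s -> s < u -> cont1 (fy y) s & qmono (fy y) a u].
have dfy y : dfn1 I setT (fy y) by rewrite /fy; dsolve.
have dQ : def2 I setT Q by rewrite /Q /fy; dsolve.
have [||g dg gP] := @select_fun _ _ _ _ om _ (fun y s => is_sup (Q y) s).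
- by dsolve.
- by move=> y s s'; apply: is_sup_uniq.
have gS y : a < g y /\ is_sup (Q y) (g y).
  have [b ab [cb qb]] := monotonicity om a (dfy y).
  have [w [aw wb wt1]] := min_lt ab at1.
  have Qw : Q y w.
    split=> // [s as_ sw|s1 s s2 c e h1 h2 h3 h4]; first by apply: cb => //; ord.
    by apply: qb => //; ord.
  have dQy : def1 I setT (Q y) by dsolve.
  have [||s sP] := has_sup om (b := t1) dQy; [by exists w|by move=> ? []|].
  rewrite (gP _ _ sP); split=> //.
  by have := sP.1 w Qw => ?; ord.
pose B y := forall s, a < s -> s < t1 -> X (ins ord_max y s).
have dB : D B by rewrite /B; dsolve.
have [|y1 ny1] := shrinkf un pc dB dg; first by exists (del ord_max x0).
have [_ cg] := nbx_in ny1; have [ag _] := gS y1.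
have [b [ab bg]] := btw om ag; have [e ge] := omin_no_max om (g y1).
pose B1 y := B y /\ b < g y.
have dB1 : D B1 by rewrite /B1; dsolve.
have {ny1 cg} nB1 : nbx y1 B1.
  by apply: nbx_sub (nbx_and ny1 (cg b e bg ge)) => y [[By _] /(_ Logic.I)[]].
have B1P y : B1 y -> [/\ b <= t1, forall s, a < s -> s < b -> cont1 (fy y) s & qmono (fy y) a b].
  move=> [_ bgy]; have [_ [_ /(_ _ bgy)[u [au ut1 cu qu] bu]]] := gS y.
  split=> [|s as_ sb|s1 s s2 c e' h1 h2 h3 h4]; first by ord.
    by apply: cu => //; ord.
  by apply: qu => //; ord.
have bt1 : b <= t1 by have [] := B1P _ (nbx_in nB1).
pose Qz (z : 'I_n.+1 -> M) := [/\ B1 (del ord_max z), a < z ord_max & z ord_max < b].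
have dQz : D Qz by rewrite /Qz; dsolve.
pose P (z : 'I_n.+1 -> M) := contT (fun y => f (ins ord_max y (z ord_max))) (del ord_max z).
have dP : D P by rewrite /P; dsolve.
have [s0 [as0 s0b]] := btw om ab.
have [|[z nz]|[z nz]] := shrinkP un1 dQz dP.
- by exists (ins ord_max y1 s0); apply: nbx_ins.
- have [[[Bz _] az zb] _] := nbx_in nz.
  set y := del ord_max z in Bz *; set r := z ord_max in az zb *.
  exists z; first by rewrite -(ins_del ord_max z); apply: Bz => //; ord.
  move=> c e'; rewrite -{1 2}(ins_del ord_max z) -/y -/r => cf fe.
  have [B1y _ _] := (nbx_in nz).1; have [_ cy _] := B1P _ B1y.
  have [c' [e'' [c'r [re'' H]]]] := cy r az zb c e' cf fe.
  have [lo [hi [loz zhi nP]]] := nbx_del ord_max nz.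
  have PP s : lo < s -> s < hi -> P (ins ord_max y s).
    by move=> h1 h2; apply: ((nbx_in nP) s h1 h2).2.
  have [t2 [c't2 at2 lot2 t2r]] : exists t2, [/\ c' < t2, a < t2, lo < t2 & t2 < r].
    have [m [mr am lom]] := max_lt az loz.
    by have [t2 [? ? ?]] := btw21 om c'r mr; exists t2; split=> //; ord.
  have [t3 [rt3 t3e t3b t3hi]] : exists t3, [/\ r < t3, t3 < e'', t3 < b & t3 < hi].
    have [m [mr am lom]] := min_lt zb zhi.
    by have [t2' [? ? ?]] := btw12 om re'' mr; exists t2'; split=> //; ord.
  have cp s : lo < s -> s < hi -> c' < s -> s < e'' ->
      nbx y (fun y' => c < f (ins ord_max y' s) /\ f (ins ord_max y' s) < e').
    move=> h1 h2 h3 h4; have := PP s h1 h2; rewrite /P ins_id del_ins => /(_ c e').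
    by have [k1 k2] := H s h3 h4 => /(_ k1 k2); apply: nbx_sub => y' /(_ Logic.I).
  have n2 : nbx y (fun y' => c < f (ins ord_max y' t2) /\ f (ins ord_max y' t2) < e').
    by apply: cp => //; ord.
  have n3 : nbx y (fun y' => c < f (ins ord_max y' t3) /\ f (ins ord_max y' t3) < e').
    by apply: cp => //; ord.
  have nB : nbx y B1.
    apply: nbx_sub nP => y' Hy; have [||[]] := Hy r; [by ord|by ord|].
    by rewrite del_ins.
  have := nbx_ins ord_max (nbx_and nB (nbx_and n2 n3)) t2r rt3.
  rewrite ins_del; apply: nbx_sub => z' [[B1z' [[h1 h2] [h3 h4]]] h5 h6] _.
  have [_ _ qz'] := B1P _ B1z'.
  have := qz' t2 (z' ord_max) t3 c e' at2 h5 h6 t3b h1 h2 h3 h4.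
  by rewrite /fy ins_del.
(* Horizontal continuity cannot fail on a whole box: the slice at height [r] is a definable function
   of [n] variables, and it has a point of continuity in every box of the base. *)
have [lo [hi [loz zhi nP]]] := nbx_del ord_max nz.
set r := z ord_max in loz zhi.
have df' : dfn I setT (fun y => f (ins ord_max y r)) by dsolve.
have dT : D (fun y => forall s : M, lo < s -> s < hi -> Qz (ins ord_max y s) /\ ~ P (ins ord_max y s)).
  by dsolve.
have [|y ny] := shrinkf un pc dT df'; first by exists (del ord_max z).
have [H cy] := nbx_in ny; have [_] := H r loz zhi.
by rewrite /P ins_id del_ins.
Qed.

(** The discontinuities contain no box, hence lie on finitely many graphs; along a graph [f] is a
    function of the [n] remaining coordinates. *)
Lemma pw_continuous_step n : box_of_union I n -> pw_continuous I n ->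
  box_of_union I n.+1 -> small_in_graphs I n -> pw_continuous I n.+1.
Proof.
move=> un pc un1 sm f df.
pose W x := contT f x; have dW : D W by rewrite /W; dsolve.
have nW : ~ hasbox (fun x => ~ W x).
  move=> hW; have [|z nz] := contT_dense un pc un1 df _ hW; last by [].
  by dsolve.
have [|J [i [h [dh hP]]]] := sm _ _ nW; first by dsolve.
have /choice[G hG] : forall j, exists G : {K : finType & K -> ('I_n -> M) -> Prop},
    [/\ forall k, D (tagged G k), forall y, exists k, tagged G k y &
      forall k, conton (tagged G k) (fun y => f (ins (i j) y (h j y)))].
  move=> j; have [|K [P HP]] := pc (fun y => f (ins (i j) y (h j y))).
    by have := dh j; dsolve.
  by exists (existT _ K P).
pose P (o : option {j : J & tag (G j)}) x := match o with
  | None => W x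
  | Some k => x (i (tag k)) = h (tag k) (del (i (tag k)) x) /\
      tagged (G (tag k)) (tagged k) (del (i (tag k)) x)
  end.
exists (option {j : J & tag (G j)}), P; split.
- case=> [[j k]|] //=; have [dG _ _] := hG j; have dGk := dG k; have dhj := dh j.
  by rewrite /P /=; dsolve.
- move=> x; have [Wx|/hP[j xE]] := pselect (W x); first by exists None.
  have [_ /(_ (del (i j) x))[k Gk] _] := hG j.
  by exists (Some (Tagged (fun j => tag (G j)) k)).
case=> [[j k]|] x /=; last first.
  by move=> Wx c e cf fe; apply: nbx_sub (Wx c e cf fe) => y H _; apply: H.
move=> [xE Gx] c e cf fe; have [_ _ /(_ k _ Gx c e)] := hG j.
rewrite -xE ins_del => /(_ cf fe) H.
have [lo lox] := omin_no_min om (x (i j)); have [hi xhi] := omin_no_max om (x (i j)).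
have := nbx_ins (i j) H lox xhi; rewrite ins_del; apply: nbx_sub => y [Hy _ _] [yE Gy].
by have := Hy Gy; rewrite -yE ins_del.
Qed.

(** Stands in for the finiteness of the number of connected components of [G], which would call for
    a cell decomposition. *)
Definition loc_const_bounded n := forall (G : ('I_n -> M) -> Prop) (N : ('I_n -> M) -> nat), D G ->
  (forall k, D (fun x => (k <= N x)%N)) ->
  (forall x, G x -> nbx x (fun y => G y -> N y = N x)) ->
  exists K, forall x, G x -> (N x <= K)%N.

(** Local constancy will be available only along pieces where some auxiliary [f] is continuous;
    passing to the finitely many pieces costs a maximum. *)
Lemma loc_const_bounded_pieces n (f : ('I_n -> M) -> M) G N :
  loc_const_bounded n -> pw_continuous I n -> dfn I setT f -> D G ->
  (forall k, D (fun x => (k <= N x)%N)) ->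
  (forall C x, conton C f -> C x -> G x -> nbx x (fun y => C y -> G y -> N y = N x)) ->
  exists K, forall x, G x -> (N x <= K)%N.
Proof.
move=> lc pc df dG dN H; have [J [P [dP cP kP]]] := pc f df.
have /choice[K hK] : forall j, exists K, forall x, G x /\ P j x -> (N x <= K)%N.
  move=> j; apply: lc => //; first by have := dP j; dsolve.
  move=> x [Gx Px]; apply: nbx_sub (H (P j) x (kP j) Px Gx) => y Hy [Gy Py].
  exact: Hy.
exists (\max_j K j) => x Gx; have [j Pj] := cP x.
by apply: leq_trans (hK j x _) (leq_bigmax j).
Qed.

(** The boundary points of the fibres of [G] are uniformly few and cut the fibres into strata.
    Boundary points form graphs over the base. On an open stratum [N] is constant, so it descends to
    a function [N' j] of the base point, and this is locally constant wherever the two ends of the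
    stratum move continuously. *)
Lemma loc_const_bounded_step n :
  loc_const_bounded n -> pw_continuous I n -> unif_finite I n -> loc_const_bounded n.+1.
Proof.
move=> lc pc uf G N dG dN locN.
pose Gy y t := G (ins ord_max y t).
pose B y := bd (Gy y).
have dB : def2 I setT B by rewrite /B /Gy; dsolve.
have fB y : fin (B y) by apply: bd_fin => //; rewrite /Gy; dsolve.
have [K0 HK0] := uf B dB fB.
have cK y t : (cnt (B y) t < K0)%N.
  rewrite ltnNge; apply/negP => H; apply: (HK0 y); apply/els_atl => //.
  by apply: leq_trans H (cnt_size _ _).
pose ex j y t := atl j (fun u => B y u /\ u < t) /\ ~ atl j.+1 (fun u => B y u /\ u < t).
have exE j y t : ex j y t <-> cnt (B y) t = j by apply: cnt_exact.
have dex j : def2 I setT (ex j) by rewrite /ex; dsolve.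
have /choice[E hE] : forall j, exists f, dfn I setT f /\
    forall y t, B y t -> cnt (B y) t = j -> f y = t.
  move=> j; have dexj := dex j.
  have [||f df fR] := @select_fun _ _ _ _ om _ (fun y t => B y t /\ ex j y t).
  - by dsolve.
  - by move=> y t t' [Bt /exE et] [Bt' /exE et']; apply: (cnt_inj (fB y)) => //; rewrite et.
  by exists f; split=> // y t Bt et; apply: fR; split=> //; apply/exE.
have dE j : dfn I setT (E j) by have [] := hE j.
have EP j y t : B y t -> cnt (B y) t = j -> E j y = t by have [_] := hE j; apply.
have /choice[KA hKA] : forall j, exists K, forall y, Gy y (E j y) ->
    (N (ins ord_max y (E j y)) <= K)%N.
  move=> j; have dEj := dE j.
  apply: (loc_const_bounded_pieces (f := E j)) => //.
  - by rewrite /Gy; dsolve.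
  - by move=> k; have dNk := dN k; apply: (def_app (F := fun y => ins ord_max y (E j y)) dNk); dsolve.
  move=> C y cC Cy Gyy; have [a [b [ay yb H]]] := nbx_del ord_max (locN _ Gyy).
  rewrite del_ins in H; rewrite ins_id in ay yb.
  have := nbx_and H (cC y Cy a b ay yb); apply: nbx_sub => y' [H1 H2] Cy' Gy'.
  by have [h1 h2] := H2 Cy'; apply: (H1 _ h1 h2 Gy').
pose S j y t := [/\ Gy y t, ~ B y t & ex j y t].
have dS j : def2 I setT (S j) by have := dex j; rewrite /S /Gy; dsolve.
have nob j y t t' u : ~ B y t -> ~ B y t' -> ex j y t -> ex j y t' -> t <= u -> u <= t' -> ~ B y u.
  move=> nt nt' /exE et /exE et' tu; rewrite le_eqVlt => /orP[/eqP -> //|ut'].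
  by apply: (cnt_const_inv (fB y)) tu ut'; rewrite et et'.
have dGy y : def1 I setT (Gy y) by rewrite /Gy; dsolve.
have constG j y t t' : ~ B y t -> ~ B y t' -> ex j y t -> ex j y t' -> Gy y t -> Gy y t'.
  move=> nt nt' et et' Gt; case/orP: (le_total t t') => tt'.
    by apply/(bd_const om (dGy y) tt') => // u h1 h2; apply: (nob j y t t').
  by apply/(bd_const om (dGy y) tt') => // u h1 h2; apply: (nob j y t' t).
have constS j y t t' : t <= t' -> S j y t -> S j y t' ->
    N (ins ord_max y t) = N (ins ord_max y t').
  move=> tt' [Gt nt et] [Gt' nt' et'].
  have H s : t <= s -> s <= t' -> Gy y s.
    move=> ts st'; apply/(bd_const om (dGy y) ts) => // u h1 h2.
    by apply: (nob j y t t') => //; ord.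
  have Lc s : t <= s -> s <= t' -> exists a b, [/\ a < s, s < b &
      forall u, a < u -> u < b -> Gy y u -> N (ins ord_max y u) = N (ins ord_max y s)].
    move=> h1 h2; have [a [b [h3 h4]]] := nbx_del ord_max (locN _ (H s h1 h2)).
    rewrite ins_id in h3 h4; rewrite del_ins => /nbx_in h5.
    by exists a, b; split.
  suff : forall s, t <= s -> s <= t' -> N (ins ord_max y s) = N (ins ord_max y t).
    by move=> ->.
  apply: (itv_induction om) => //.
  - pose k := N (ins ord_max y t); have d1 := dN k; have d2 := dN k.+1.
    apply: (def_iff (X := fun e : unit -> M =>
        (k <= N (ins ord_max y (e tt)))%N /\ ~ (k < N (ins ord_max y (e tt)))%N)).
      move=> e; rewrite -/k; split=> [[h /negP]|->]; last by rewrite ltnn leqnn.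
      by rewrite -leqNgt => h'; apply/eqP; rewrite eqn_leq h h'.
    apply: def_and; first by apply: (def_app (F := fun e : unit -> M => ins ord_max y (e tt)) d1); dsolve.
    by apply: def_not; apply: (def_app (F := fun e : unit -> M => ins ord_max y (e tt)) d2); dsolve.
  - move=> s ts st' Hs; have [a [b [as_ sb Hab]]] := Lc s ts (ltW st').
    have [c [sc cb ct]] := min_lt sb st'.
    exists c => // u su uc; rewrite (Hab u) ?(Hs s) //; [by ord|by ord|].
    by apply: H; ord.
  move=> s ts st' Hs; have [a [b [as_ sb Hab]]] := Lc s (ltW ts) st'.
  have [u [tu au us]] := btw21 om ts as_.
  rewrite -(Hs u) ?(ltW tu) // (Hab u) //; first by ord.
  by apply: H; ord.
(* The value of [N] on the [j]-th open stratum, which is independent of the point by [constS]; 0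
   when no point of that stratum is in [G]. *)
pose N' j y := if pselect (exists t, S j y t) is left h then N (ins ord_max y (sval (cid h))) else 0%N.
have N'E j y t : S j y t -> N' j y = N (ins ord_max y t).
  rewrite /N' => St; case: pselect => [h|[]]; last by exists t.
  case: cid => t' /= St'; case/orP: (le_total t t') => tt'.
    by rewrite (constS j y t t').
  by rewrite (constS j y t' t).
have dN' j k : D (fun y => (k <= N' j y)%N).
  have dNk := dN k; have dSj := dS j.
  have d1 : def2 I setT (fun y t => (k <= N (ins ord_max y t))%N).
    rewrite /def2.
    by apply: (def_app (F := fun e : option 'I_n -> M => ins ord_max (fun w => e (Some w)) (e None)) dNk); dsolve.
  apply: (def_iff (X := fun y => (exists t, S j y t /\ (k <= N (ins ord_max y t))%N) \/
     ((~ exists t, S j y t) /\ k = 0%N))).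
    move=> y; split=> [[[t [St]]|[nE ->]]|]; [by rewrite -(N'E j)|by []|].
    have [[t St]|nE] := pselect (exists t, S j y t).
      by rewrite (N'E j y t St) => h; left; exists t.
    by rewrite /N'; case: pselect => // _; rewrite leqn0 => /eqP; right.
  apply: def_or; last by dsolve.
  by apply: def_ex; apply: def_and; [dsolve|exact: d1].
(* [Gu] fixes whether the stratum has an upper end, namely the boundary point of index [j]. Its
   lower end is the boundary point of index [j.-1] and is absent for [j = 0]. *)
have lastK j (Gu : bool) : exists K, forall y,
    (exists t, S j y t) /\ ((exists u, B y u /\ ex j y u) <-> Gu) -> (N' j y <= K)%N.
  have dSj := dS j; have dexj := dex j.
  have dGG : D (fun y => (exists t, S j y t) /\ ((exists u, B y u /\ ex j y u) <-> Gu)).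
    by dsolve.
  have [J [P [dP cP PCP]]] := pc (E j.-1) (dE j.-1).
  have /choice[K hK] : forall i, exists K, forall y,
      ((exists t, S j y t) /\ ((exists u, B y u /\ ex j y u) <-> Gu)) /\ P i y -> (N' j y <= K)%N.
    move=> i; have dPi := dP i.
    apply: (loc_const_bounded_pieces (f := E j)) => //; first by dsolve.
    move=> C y cC Cy [[[t0 St0] Gl] Py].
    have [Gt0 nBt0 et0] := St0.
    have [c0 c0E] := omin_no_min om (E j.-1 y); have [e0 Ee0] := omin_no_max om (E j y).
    have lowN : nbx y (fun y' => P i y' -> (0 < j)%N -> E j.-1 y' < t0).
      case: (posnP j) => [->|j0]; first by apply: (nbxT om).
      have [v [Bv ev vt]] : exists v, [/\ B y v, cnt (B y) v = j.-1 & v < t0].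
        by apply: cnt_ex => //; move/exE: et0 => ->; rewrite prednK.
      rewrite (EP _ _ _ Bv ev) in c0E.
      apply: nbx_sub (PCP i y Py c0 t0 _ _) => [y' H Py' _||]; last 2 first.
      - by rewrite (EP _ _ _ Bv ev).
      - by rewrite (EP _ _ _ Bv ev).
      by have [] := H Py'.
    have upN : nbx y (fun y' => C y' -> Gu -> t0 < E j y').
      case: Gu Gl {dGG} => [[_ /(_ isT)[u [Bu eu]]]|_]; last by apply: (nbxT om).
      have t0u : t0 < u.
        rewrite ltNge le_eqVlt; apply/negP => /orP[/eqP uE|]; first by rewrite uE in Bu.
        by move/(cnt_lt (fB y) Bu); move/exE: eu => ->; move/exE: et0 => ->; rewrite ltnn.
      move/exE: eu => eu; rewrite (EP _ _ _ Bu eu) in Ee0.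
      apply: nbx_sub (cC y Cy t0 e0 _ _) => [y' H Cy' _||]; last 2 first.
      - by rewrite (EP _ _ _ Bu eu).
      - by rewrite (EP _ _ _ Bu eu).
      by have [] := H Cy'.
    have [a [b [at0 t0b locy]]] := nbx_del ord_max (locN _ Gt0).
    rewrite ins_id in at0 t0b; rewrite del_ins in locy.
    apply: nbx_sub (nbx_and locy (nbx_and lowN upN)) => y' [Hl [Hlow Hup]] Cy' [[[t1 [Gt1 nBt1 et1]] Gy'] Py'].
    have jc : (j <= cnt (B y') t0)%N.
      case: (posnP j) => [->//|j0].
      have [v [Bv ev vt]] : exists v, [/\ B y' v, cnt (B y') v = j.-1 & v < t1].
        by apply: cnt_ex => //; move/exE: et1 => ->; rewrite prednK.
      have := Hlow Py' j0; rewrite (EP _ _ _ Bv ev) => /(cnt_lt (fB y') Bv).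
      by rewrite ev prednK.
    have up u : B y' u -> cnt (B y') u = j -> t0 < u.
      move=> Bu eu; have GuT : Gu by apply/Gy'; exists u; split=> //; apply/exE.
      by have := Hup Cy' GuT; rewrite (EP _ _ _ Bu eu).
    have cE : cnt (B y') t0 = j.
      apply/eqP; rewrite eqn_leq jc andbT leqNgt; apply/negP => /(cnt_ex (fB y'))[u [Bu eu ut]].
      by have := up u Bu eu => ?; ord.
    have nB0 : ~ B y' t0 by move=> /up /(_ cE); rewrite ltxx.
    have St0' : S j y' t0.
      by split=> //; [apply: (constG j y' t1)|]; rewrite // ?exE.
    rewrite (N'E j y' t0 St0') (N'E j y t0 St0).
    by apply: (Hl t0 at0 t0b); case: St0'.
  exists (\max_i K i) => y Gyy; have [i Pi] := cP y.
  by apply: leq_trans (hK i y _) (leq_bigmax i).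
have /choice[KB hKB] : forall p : 'I_K0 * bool, exists K, forall y,
    (exists t, S p.1 y t) /\ ((exists u, B y u /\ ex p.1 y u) <-> p.2) -> (N' p.1 y <= K)%N.
  by move=> [j b]; apply: (lastK j b).
exists (maxn (\max_(j < K0) KA j) (\max_p KB p)) => x Gx.
set y := del ord_max x; set t := x ord_max.
have Gt : Gy y t by rewrite /Gy ins_del.
rewrite -(ins_del ord_max x) -/y -/t leq_max.
pose j := Ordinal (cK y t).
have [Bt|nBt] := pselect (B y t).
  apply/orP; left; have Ejt : E j y = t by apply: EP.
  rewrite -Ejt; apply: leq_trans (hKA j y _) (leq_bigmax j).
  by rewrite Ejt.
have St : S j y t by split=> //; apply/exE.
apply/orP; right; rewrite -(N'E j y t St).
pose b := `[< exists u, B y u /\ ex j y u >].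
apply: leq_trans (hKB (j, b) y _) (leq_bigmax (j, b)).
by split; [exists t|split=> [?|/asboolP//]; apply/asboolP].
Qed.

End InductionSteps.

(** * Uniform finiteness through normal points *)

Section UniformFiniteness.
Context {d : Order.disp_t} {M : orderType d} {L : language} (I : structure L M).
Hypothesis om : o_minimal I.
Notation D := (def I setT).
Notation contT f x := (contpt (fun _ => True) f x).

Section Step.
Variables (n : nat) (Y : ('I_n -> M) -> M -> Prop).
Hypotheses (dY : def2 I setT Y) (fY : forall x, fin (Y x)).

(* [(x, b)] is normal if, near it, [Y] is empty or the graph of a function continuous at [x];
   [nrmL], [nrmR] are the analogues for [b = -oo], [+oo]. *)
Definition nrm x b := exists c e, [/\ c < b, b < e &
  nbx x (fun y => forall t, c < t -> t < e -> ~ Y y t) \/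
  [/\ Y x b, nbx x (fun y => forall t t', c < t -> t < e -> c < t' -> t' < e ->
                        Y y t -> Y y t' -> t = t') &
      forall c' e', c' < b -> b < e' -> nbx x (fun y => exists t, [/\ c' < t, t < e' & Y y t])]].
Definition nrmL x := exists c, nbx x (fun y => forall t, t < c -> ~ Y y t).
Definition nrmR x := exists c, nbx x (fun y => forall t, c < t -> ~ Y y t).
Definition good x := [/\ nrmL x, nrmR x & forall b, nrm x b].

Lemma def_nrm : def2 I setT nrm. Proof. by rewrite /nrm; dsolve. Qed.
Lemma def_nrmL : D nrmL. Proof. by rewrite /nrmL; dsolve. Qed.
Lemma def_nrmR : D nrmR. Proof. by rewrite /nrmR; dsolve. Qed.

Lemma def_good : D good.
Proof.
by have := def_nrm; have := def_nrmL; have := def_nrmR => ? ? ?; rewrite /good; dsolve.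
Qed.

(** A branch of [Y] through [(x, s)] stays close to [s] near [x], so at any other nearby height [Y]
    is locally empty. *)
Lemma nrm_open x s : nrm x s ->
  exists c e, [/\ c < s, s < e & forall b, c < b -> b < e -> nrm x b].
Proof.
move=> H; have [c [e [cs se HY]]] := H; exists c, e; split=> // b cb be.
case: HY => [HE|[Ys Hu Hx]]; first by exists c, e; split=> //; left.
case: (ltgtP b s) => [bs|sb|->//].
  have [c' [bc' c's]] := btw om bs; exists c, c'; split=> //; left.
  apply: nbx_sub (nbx_and Hu (Hx c' e c's se)) => y [Hu' [t [c't te Yt]]] u cu uc' Yu.
  have E : u = t by apply: Hu' => //; ord.
  by subst; ord.
have [c' [sc' c'b]] := btw om sb; exists c', e; split=> //; left.
apply: nbx_sub (nbx_and Hu (Hx c c' cs sc')) => y [Hu' [t [c't te Yt]]] u cu uc' Yu.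
have E : u = t by apply: Hu' => //; ord.
by subst; ord.
Qed.

Hypotheses (un : box_of_union I n) (pc : pw_continuous I n).

Lemma def_extremum (R : M -> M -> Prop) (P : ('I_n -> M) -> M -> Prop) :
  defr I setT R -> (forall s t, R s t -> R t s -> s = t) -> def2 I setT P ->
  exists2 f, dfn I setT f & forall x t, P x t -> (forall u, P x u -> R t u) -> f x = t.
Proof.
move=> dR aR dP.
have [||f df fP] := @select_fun _ _ _ _ om _ (fun x t => P x t /\ forall u, P x u -> R t u).
- by dsolve.
- by move=> x t t' [Pt Ht] [Pt' Ht']; apply: aR; [apply: Ht|apply: Ht'].
by exists f => // x t Pt Ht; apply: fP.
Qed.

Lemma least_fun (P : ('I_n -> M) -> M -> Prop) : def2 I setT P ->
  exists2 f, dfn I setT f & forall x t, P x t -> (forall u, P x u -> t <= u) -> f x = t.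
Proof.
move=> dP; apply: (def_extremum (R := fun s t => s <= t)) => //; first by dsolve.
by move=> s t st ts; apply/eqP; rewrite eq_le st ts.
Qed.

Lemma greatest_fun (P : ('I_n -> M) -> M -> Prop) : def2 I setT P ->
  exists2 f, dfn I setT f & forall x t, P x t -> (forall u, P x u -> u <= t) -> f x = t.
Proof.
move=> dP; apply: (def_extremum (R := fun s t => t <= s)) => //; first by dsolve.
by move=> s t st ts; apply/eqP; rewrite eq_le st ts.
Qed.

(** On a box with nonempty fibres the least point of the fibre is a definable function, and it is
    bounded below near a point of continuity. *)
Lemma nrmL_dense X : D X -> (forall x, X x -> ~ nrmL x) -> ~ hasbox X.
Proof.
move=> dX XN hX; have [m dm mP] := least_fun dY.
have dE : D (fun x => exists t, Y x t) by dsolve.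
have [[x nx]|[x nx]] := shrinkP un dX dE hX; last first.
  have [p _] := omin_nonempty om; apply: (XN x); first by have [] := nbx_in nx.
  by exists p; apply: nbx_sub nx => y [_ nE] t _ Yt; apply: nE; exists t.
have [||z nz] := shrinkf un pc _ dm (X := fun x => X x /\ exists t, Y x t);
  [by dsolve|by exists x|].
have [[Xz _] cm] := nbx_in nz; apply: (XN z Xz).
have [c cm'] := omin_no_min om (m z); have [e me] := omin_no_max om (m z).
exists c; apply: nbx_sub (nbx_and nz (cm c e cm' me)) => y [[[_ Ey] _] /(_ Logic.I)[cy _]] t tc Yt.
have [u Yu Hu] := fin_min (fY y) Ey.
by have := Hu t Yt; have := mP y u Yu Hu => E; rewrite -E => ?; ord.
Qed.

Lemma nrmR_dense X : D X -> (forall x, X x -> ~ nrmR x) -> ~ hasbox X.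
Proof.
move=> dX XN hX; have [m dm mP] := greatest_fun dY.
have dE : D (fun x => exists t, Y x t) by dsolve.
have [[x nx]|[x nx]] := shrinkP un dX dE hX; last first.
  have [p _] := omin_nonempty om; apply: (XN x); first by have [] := nbx_in nx.
  by exists p; apply: nbx_sub nx => y [_ nE] t _ Yt; apply: nE; exists t.
have [||z nz] := shrinkf un pc _ dm (X := fun x => X x /\ exists t, Y x t);
  [by dsolve|by exists x|].
have [[Xz _] cm] := nbx_in nz; apply: (XN z Xz).
have [c cm'] := omin_no_min om (m z); have [e me] := omin_no_max om (m z).
exists e; apply: nbx_sub (nbx_and nz (cm c e cm' me)) => y [[[_ Ey] _] /(_ Logic.I)[_ ye]] t et Yt.
have [u Yu Hu] := fin_max (fY y) Ey.
by have := Hu t Yt; have := mP y u Yu Hu => E; rewrite -E => ?; ord.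
Qed.

(** The next point of [Y] above [f], if any, is a definable function of the base point; where it and
    [f] are continuous, a constant [e] separates the two. *)
Lemma upper_side X f : D X -> dfn I setT f -> hasbox X ->
  exists X', [/\ D X', hasbox X', forall x, X' x -> X x &
    forall x, nbx x X' -> exists2 e, f x < e &
      nbx x (fun y => forall t, Y y t -> t < e -> t <= f y)].
Proof.
move=> dX df hX.
have dE : D (fun x => exists t, Y x t /\ f x < t) by dsolve.
have [h|h] := shrinkP un dX dE hX; last first.
  exists (fun x => X x /\ ~ exists t, Y x t /\ f x < t); split=> //; [by dsolve|by move=> ? []|].
  move=> x nx; have [e fe] := omin_no_max om (f x); exists e => //.
  apply: nbx_sub nx => y [_ nE] t Yt _; rewrite leNgt; apply/negP => ft.
  by apply: nE; exists t.
have [|g dg gP] := least_fun (P := fun x t => Y x t /\ f x < t); first by dsolve.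
have d1 : D (fun x => X x /\ exists t, Y x t /\ f x < t) by dsolve.
have h1 := shrinkf un pc d1 df h.
have d2 : D (fun x => (X x /\ exists t, Y x t /\ f x < t) /\ contT f x) by dsolve.
have h2 := shrinkf un pc d2 dg h1.
eexists; split; [|exact: h2|by move=> ? [[[]]]|]; first by dsolve.
have gS y : (exists t, Y y t /\ f y < t) -> f y < g y /\ forall t, Y y t -> f y < t -> g y <= t.
  move=> E; have fE : fin (fun t => Y y t /\ f y < t) by apply: fin_sub (fY y) => t [].
  have [u [Yu fu] Hu] := fin_min fE E.
  by rewrite (gP y u) //; split=> // t Yt ft; apply: Hu.
move=> x nx; have [[[Xx Ex] cf] cg] := nbx_in nx; have [fg _] := gS x Ex.
have [e [fe eg]] := btw om fg; exists e => //.
have [c cf'] := omin_no_min om (f x); have [c' gc'] := omin_no_max om (g x).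
have := nbx_and nx (nbx_and (cf c e cf' fe) (cg e c' eg gc')).
apply: nbx_sub => y [[[[_ Ey] _] _] [/(_ Logic.I)[_ fye] /(_ Logic.I)[egy _]]] t Yt te.
rewrite leNgt; apply/negP => ft; have [_ /(_ t Yt ft) gt] := gS y Ey.
by ord.
Qed.

Lemma lower_side X f : D X -> dfn I setT f -> hasbox X ->
  exists X', [/\ D X', hasbox X', forall x, X' x -> X x &
    forall x, nbx x X' -> exists2 e, e < f x &
      nbx x (fun y => forall t, Y y t -> e < t -> f y <= t)].
Proof.
move=> dX df hX.
have dE : D (fun x => exists t, Y x t /\ t < f x) by dsolve.
have [h|h] := shrinkP un dX dE hX; last first.
  exists (fun x => X x /\ ~ exists t, Y x t /\ t < f x); split=> //; [by dsolve|by move=> ? []|].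
  move=> x nx; have [e fe] := omin_no_min om (f x); exists e => //.
  apply: nbx_sub nx => y [_ nE] t Yt _; rewrite leNgt; apply/negP => ft.
  by apply: nE; exists t.
have [|g dg gP] := greatest_fun (P := fun x t => Y x t /\ t < f x); first by dsolve.
have d1 : D (fun x => X x /\ exists t, Y x t /\ t < f x) by dsolve.
have h1 := shrinkf un pc d1 df h.
have d2 : D (fun x => (X x /\ exists t, Y x t /\ t < f x) /\ contT f x) by dsolve.
have h2 := shrinkf un pc d2 dg h1.
eexists; split; [|exact: h2|by move=> ? [[[]]]|]; first by dsolve.
have gS y : (exists t, Y y t /\ t < f y) -> g y < f y /\ forall t, Y y t -> t < f y -> t <= g y.
  move=> E; have fE : fin (fun t => Y y t /\ t < f y) by apply: fin_sub (fY y) => t [].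
  have [u [Yu fu] Hu] := fin_max fE E.
  by rewrite (gP y u) //; split=> // t Yt ft; apply: Hu.
move=> x nx; have [[[Xx Ex] cf] cg] := nbx_in nx; have [fg _] := gS x Ex.
have [e [ge ef]] := btw om fg; exists e => //.
have [c cf'] := omin_no_max om (f x); have [c' gc'] := omin_no_min om (g x).
have := nbx_and nx (nbx_and (cf e c ef cf') (cg c' e gc' ge)).
apply: nbx_sub => y [[[[_ Ey] _] _] [/(_ Logic.I)[efy _] /(_ Logic.I)[_ gye]]] t Yt et.
rewrite leNgt; apply/negP => ft; have [_ /(_ t Yt ft) gt] := gS y Ey.
by ord.
Qed.

(** The least abnormal height [b] is a definable function; it is attained because abnormality is a
    closed condition on the height. Shrink to a box where [b] is continuous, where [Y] has no other
    points close to it, and where membership of the graph of [b] in [Y] is decided: then [(x, b x)]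
    is normal after all. *)
Lemma good_dense : ~ hasbox (fun x => ~ good x).
Proof.
move=> hB; have dg := def_good; have dl := def_nrmL; have dr := def_nrmR; have dn := def_nrm.
have dB : D (fun x => ~ good x) by dsolve.
have [h1|h1] := shrinkP un dB dl hB; last first.
  by apply: nrmL_dense h1; [dsolve|move=> x []].
have d1 : D (fun x => ~ good x /\ nrmL x) by dsolve.
have [h2|h2] := shrinkP un d1 dr h1; last first.
  by apply: nrmR_dense h2; [dsolve|move=> x []].
pose X x := (~ good x /\ nrmL x) /\ nrmR x; have dX : D X by rewrite /X; dsolve.
have [|b db bP] := least_fun (P := fun x t => ~ nrm x t); first by dsolve.
have bS x : X x -> ~ nrm x (b x).
  move=> [[ng [c nc]] nr].
  have [b0 nb0] : exists b0, ~ nrm x b0.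
    apply: contrapT => nE; apply: ng; split=> //; first by exists c.
    by move=> b0; apply: contrapT => nb; apply: nE; exists b0.
  have dN : def1 I setT (fun t => ~ nrm x t) by dsolve.
  have cb t : ~ nrm x t -> c <= t.
    move=> nt; rewrite leNgt; apply/negP => tc; apply: nt.
    have [c' c't] := omin_no_min om t; exists c', c; split=> //; left.
    by apply: nbx_sub nc => y H u _ uc; apply: H.
  have [||s [s1 s2]] := has_inf om (b := c) dN; [by exists b0|by []|].
  have ns : ~ nrm x s.
    move=> /nrm_open[c' [e [c's se H]]]; have [t nt te] := s2 _ se.
    have st := s1 t nt.
    by apply: nt; apply: H => //; ord.
  by rewrite (bP x s).
have [X1 [dX1 hX1 X1X up]] := upper_side dX db h2.
have [X2 [dX2 hX2 X2X lw]] := lower_side dX1 db hX1.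
have hX3 := shrinkf un pc dX2 db hX2.
have d3 : D (fun x => X2 x /\ contT b x) by dsolve.
have dYb : D (fun x => Y x (b x)) by dsolve.
have side x : nbx x X2 -> exists c e, [/\ c < b x, b x < e &
    nbx x (fun y => forall t, Y y t -> c < t -> t < e -> t = b y)].
  move=> nx; have [c cb nc] := lw x nx.
  have [|e be ne] := up x; first by apply: nbx_sub nx.
  exists c, e; split=> //; apply: nbx_sub (nbx_and nc ne) => y [Hc He] t Yt ct te.
  by apply/eqP; rewrite eq_le Hc ?He.
have [[x nx]|[x nx]] := shrinkP un d3 dYb hX3;
  have [[Xx cb] Yx] := nbx_in nx; apply: (bS x (X1X _ (X2X _ Xx))).
- have [|c [e [cbx bxe H]]] := side x; first by apply: nbx_sub nx => y [[]].
  exists c, e; split=> //; right; split=> //.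
    by apply: nbx_sub H => y Hy t t' ct te ct' te' Yt Yt'; rewrite (Hy t) // (Hy t').
  move=> c' e' c'b be'; apply: nbx_sub (nbx_and nx (cb c' e' c'b be')).
  by move=> y [[_ Yy] /(_ Logic.I)[? ?]]; exists (b y).
have [|c [e [cbx bxe H]]] := side x; first by apply: nbx_sub nx => y [[]].
exists c, e; split=> //; left; apply: nbx_sub (nbx_and nx H) => y [[_ nY] Hy] t ct te Yt.
by apply: nY; rewrite -(Hy t).
Qed.

(** The number of points below a height [b] outside [Y x] is locally constant in the base point:
    clearly so for very low [b], and the property propagates upwards, since crossing a normal height
    adds either nothing or exactly one point in all nearby fibres at once. A very high [b] then
    counts the whole fibre. *)
Lemma good_locally_constant x : good x ->
  nbx x (fun y => size (els (Y y)) = size (els (Y x))).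
Proof.
move=> [[cl nl] [cr nr] nb].
pose C b := nbx x (fun y => ~ Y y b /\ cnt (Y y) b = cnt (Y x) b).
pose K0 := size (els (Y x)).
(* Equality of two counts is not a formula, but the count at [x] is at most [K0], which turns it
   into a finite disjunction. *)
have dC : def1 I setT C.
  pose C' b := exists k : 'I_K0.+1, nbx x (fun y => ~ Y y b /\
    (atl k (fun u => Y y u /\ u < b) /\ ~ atl k.+1 (fun u => Y y u /\ u < b))).
  have dC' : def1 I setT C' by rewrite /C'; dsolve.
  apply: def_iff dC' => e; set b := e tt.
  have kE y k : atl k (fun u => Y y u /\ u < b) /\ ~ atl k.+1 (fun u => Y y u /\ u < b) <->
    cnt (Y y) b = k by apply: cnt_exact.
  split=> [[k nk]|nC].
    have [_ /kE xk] := nbx_in nk.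
    by apply: nbx_sub nk => y [nY /kE yk]; rewrite yk xk.
  have kK : (cnt (Y x) b < K0.+1)%N by rewrite ltnS; apply: cnt_size.
  by exists (Ordinal kK); apply: nbx_sub nC => y [nY yk]; split=> //; apply/kE.
have loc b : exists c e, [/\ c < b, b < e & forall b1 b2, c < b1 -> b1 < e -> c < b2 -> b2 < e ->
    ~ Y x b2 -> C b1 -> C b2].
  have [c [e [cb be HY]]] := nb b; exists c, e; split=> // b1 b2 cb1 b1e cb2 b2e nY2 C1.
  have same y u v : u <= v -> (forall t, u <= t -> t <= v -> ~ Y y t) -> cnt (Y y) u = cnt (Y y) v.
    by move=> uv H; apply: cnt_const => // t h1 h2; apply: H => //; ord.
  case: HY => [HE|[Yb Hu Hx]].
    have Hy y : (forall t, c < t -> t < e -> ~ Y y t) -> cnt (Y y) b1 = cnt (Y y) b2.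
      move=> H; case/orP: (le_total b1 b2) => bb; last symmetry;
        by apply: same => // t h1 h2; apply: H; ord.
    have Hx := Hy x (nbx_in HE).
    apply: nbx_sub (nbx_and C1 HE) => y [[nY1 E] H]; split; first exact: H.
    by rewrite -(Hy y H) E Hx.
  have nY1 : ~ Y x b1 by have [] := nbx_in C1.
  have n1b : b1 != b by apply/eqP => E; apply: nY1; rewrite E.
  have n2b : b2 != b by apply/eqP => E; apply: nY2; rewrite E.
  (* near [x] the only point of [Y] in [(c, e)] lies in [(c', e')], which avoids [b1], [b2] *)
  have [c' [c'b h1 h2 cc']] : exists c', [/\ c' < b, (b1 < b -> b1 < c'), (b2 < b -> b2 < c') & c < c'].
    have [m [mb cm h1 h2]] : exists m, [/\ m < b, c <= m, b1 < b -> b1 <= m & b2 < b -> b2 <= m].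
      case: (ltP b1 b) => l1; case: (ltP b2 b) => l2.
      - have [m [mb m1 m2]] := max_lt l1 l2; exists m; split=> //; ord.
      - by exists b1; split=> //; ord.
      - by exists b2; split=> //; ord.
      - by exists c.
    have [c' [mc' c'b]] := btw om mb.
    by exists c'; split=> // [/h1|/h2|]; ord.
  have [e' [be' h3 h4 e'e]] : exists e', [/\ b < e', (b < b1 -> e' < b1), (b < b2 -> e' < b2) & e' < e].
    have [m [mb cm h3 h4]] : exists m, [/\ b < m, m <= e, b < b1 -> m <= b1 & b < b2 -> m <= b2].
      case: (ltP b b1) => l1; case: (ltP b b2) => l2.
      - have [m [mb m1 m2]] := min_lt l1 l2; exists m; split=> //; ord.
      - by exists b1; split=> //; ord.
      - by exists b2; split=> //; ord.
      - by exists e.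
    have [e' [be' e'm]] := btw om mb.
    by exists e'; split=> // [/h3|/h4|]; ord.
  have nH := nbx_and Hu (Hx c' e' c'b be').
  pose H y := exists v, [/\ c' < v, v < e', Y y v & forall t, c < t -> t < e -> Y y t -> t = v].
  have {}nH : nbx x H.
    apply: nbx_sub nH => y [Hu' [v [c'v ve' Yv]]]; exists v; split=> // t ct te Yt.
    by apply: Hu' => //; ord.
  have nY y u : H y -> c < u -> u < e -> (u < b -> u < c') -> (b < u -> e' < u) -> u != b -> ~ Y y u.
    move=> [v [c'v ve' Yv Hv]] cu ue k1 k2 ub Yu; have E := Hv u cu ue Yu; subst v.
    by case: (ltgtP u b) ub => // [/k1|/k2] ? _; ord.
  have low y u v : H y -> c < u -> u <= v -> v < c' -> cnt (Y y) u = cnt (Y y) v.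
    move=> [w [c'w we' Yw Hw]] cu uv vc'; apply: same => // t ut tv Yt.
    have E : t = w by apply: Hw => //; ord.
    by subst; ord.
  have high y u v : H y -> e' < u -> u <= v -> v < e -> cnt (Y y) u = cnt (Y y) v.
    move=> [w [c'w we' Yw Hw]] cu uv vc'; apply: same => // t ut tv Yt.
    have E : t = w by apply: Hw => //; ord.
    by subst; ord.
  have mid y u v : H y -> c < u -> u < c' -> e' < v -> v < e -> cnt (Y y) v = (cnt (Y y) u).+1.
    move=> [w [c'w we' Yw Hw]] cu uc' e'v ve; apply: (@cnt_one _ _ _ u v w) => //; try ord.
    by move=> t ut tv; apply: Hw; ord.
  have Hx0 := nbx_in nH.
  apply: nbx_sub (nbx_and C1 nH) => y [[nYy E] Hy]; split; first by apply: nY Hy _ _ _ _ _.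
  case: (ltgtP b1 b) n1b => // l1 _; case: (ltgtP b2 b) n2b => // l2 _.
  - by case/orP: (le_total b1 b2) => bb;
      [rewrite -(low y b1 b2) ?E ?(low x b1 b2)|rewrite (low y b2 b1) ?E -?(low x b2 b1)] => //; auto.
  - by rewrite (mid y b1 b2) ?(mid x b1 b2) ?E //; auto.
  - apply/eqP; rewrite -eqSS -(mid y b2 b1) -?(mid x b2 b1) ?E //; auto.
  - by case/orP: (le_total b1 b2) => bb;
      [rewrite -(high y b1 b2) ?E ?(high x b1 b2)|rewrite (high y b2 b1) ?E -?(high x b2 b1)] => //; auto.
pose S b := forall b', b' <= b -> ~ Y x b' -> C b'.
have dS : def1 I setT S by rewrite /S; dsolve.
have [b0 b0c] := omin_no_min om cl.
have Cl b : b < cl -> C b.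
  move=> bc; have nl0 := nbx_in nl; apply: nbx_sub (nl) => y Hy; split; first exact: Hy.
  by rewrite !cnt0 // => u ub; [apply: nl0|apply: Hy]; ord.
have S0 : S b0 by move=> b' b'b _; apply: Cl; ord.
have allS b1 : S b1.
  apply: contrapT => nS.
  have Sdown u v : S u -> v <= u -> S v by move=> Su vu w wv; apply: Su; ord.
  have [||s [s1 s2]] := has_sup om (b := b1) dS; first by exists b0.
    by move=> t St; rewrite leNgt; apply/negP => bt; apply: nS; apply: Sdown St _; ord.
  have [c [e [cs se Hs]]] := loc s.
  have [b' [cb' b's nYb']] := lgerm_ex om (fin_lgerm om s (fY x)) cs.
  have Cb' : C b' by have [u Su b'u] := s2 b' b's; apply: Su => //; ord.
  have [u [su ue]] := btw om se.
  suff : S u by move=> /s1 ?; ord.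
  move=> w wu nYw; have [ws|sw] := ltP w s.
    by have [v Sv wv] := s2 w ws; apply: Sv => //; ord.
  by apply: (Hs b' w) => //; ord.
have [b crb] := omin_no_max om cr.
have Cb : C b by apply: (allS b b (lexx _)); apply: (nbx_in nr).
apply: nbx_sub (nbx_and nr Cb) => y [Hy [_ E]].
rewrite -(cnt_all (t := b) (fY y)) ?E ?cnt_all // => u Yu; rewrite ltNge; apply/negP => bu.
  by apply: (nbx_in nr) Yu; ord.
by apply: Hy Yu; ord.
Qed.

End Step.

Lemma atl_le k j (P : M -> Prop) : (j <= k)%N -> atl k P -> atl j P.
Proof.
move=> jk [z [zi zP]]; exists (fun i => z (widen_ord jk i)); split=> // i i' /zi E.
by apply/val_inj; move/(congr1 val): E.
Qed.

(** On the good points the cardinality is locally constant, hence bounded; the other points lie on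
    finitely many graphs, over which the bound in dimension [n] applies. *)
Lemma unif_finite_step n : unif_finite I n -> box_of_union I n.+1 ->
  pw_continuous I n.+1 -> small_in_graphs I n -> loc_const_bounded I n.+1 ->
  unif_finite I n.+1.
Proof.
move=> uf un pc sm lc Y dY fY.
have dg := def_good dY; have nB := good_dense dY fY un pc.
have [K hK] : exists K, forall x, good Y x -> (size (els (Y x)) <= K)%N.
  apply: lc => // [k|x gx].
    have da : D (fun x => atl k (Y x)) by dsolve.
    by apply: def_iff da => x; rewrite els_atl.
  by apply: nbx_sub (good_locally_constant dY fY gx) => y ->.
have [|J [i [h [dh hP]]]] := sm _ _ nB; first by dsolve.
have /choice[N hN] : forall j, exists N, forall y, ~ atl N (Y (ins (i j) y (h j y))).
  by move=> j; have dhj := dh j; apply: (uf (fun y => Y (ins (i j) y (h j y)))) => //; dsolve.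
exists (maxn K.+1 (\max_j N j)) => x ax.
have [gx|/hP[j xE]] := pselect (good Y x).
  have := hK x gx; rewrite leqNgt => /negP; apply; apply/els_atl => //.
  by apply: atl_le ax; apply: leq_maxl.
apply: (hN j (del (i j) x)); rewrite -xE ins_del.
by apply: atl_le ax; rewrite leq_max leq_bigmax orbT.
Qed.

(** The order inside the step matters: finiteness in dimension [n.+1] relies on continuity there,
    which itself uses boxes in dimension [n.+1] but finiteness in dimension [n] only. *)
Lemma tameness n : [/\ pw_continuous I n, unif_finite I n, chain_has_box I n,
  thin_no_box I n & loc_const_bounded I n].
Proof.
elim: n => [|n [pc uf dn nt lc]].
  have [p _] := omin_nonempty om; pose x0 : 'I_0 -> M := fun=> p.
  have x0E (x : 'I_0 -> M) : x = x0 by apply/funext => -[].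
  have all0 (P : ('I_0 -> M) -> Prop) x : P x0 -> nbx x P by move=> Px; apply: (nbxT om) => y; rewrite (x0E y).
  split.
  - move=> f df; exists unit, (fun _ _ => True); split=> [_|x|_ x _ c e]; [exact: def_cst|by exists tt|].
    by rewrite (x0E x) => h1 h2; apply: all0.
  - move=> Y dY fY; exists (size (els (Y x0))).+1 => x; rewrite (x0E x) els_atl // ltnn.
    by [].
  - by move=> X dX x; rewrite (size0nil (size_enum_ord 0)) (x0E x) /= => X0; exists x0; apply: all0.
  - by move=> Z _ _ [x /nbx_in[[]]].
  - by move=> G N _ _ _; exists (N x0) => x _; rewrite (x0E x).
have un := box_of_union_of om dn nt.
have dn1 := chain_has_box_step om dn un pc; have nt1 := thin_no_box_step om uf nt.
have un1 := box_of_union_of om dn1 nt1; have sm := small_in_graphs_of om uf dn1.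
have pc1 := pw_continuous_step om un pc un1 sm; have lc1 := loc_const_bounded_step om lc pc uf.
by split=> //; apply: unif_finite_step.
Qed.

Theorem uniform_finiteness (W : finType) (Y : (W -> M) -> M -> Prop) : def2 I setT Y ->
  (forall x, fin (Y x)) -> exists N, forall x, ~ atl N (Y x).
Proof.
move=> dY fY; have [_ uf _ _ _] := tameness #|W|.
have [||N HN] := uf (fun x => Y (fun w => x (enum_rank w))); [by dsolve|by []|].
exists N => x; have := HN (fun i => x (enum_val i)).
by rewrite (_ : (fun w => _) = x) //; apply/funext => w; rewrite enum_rankK.
Qed.

Theorem piecewise_continuity n : pw_continuous I n.
Proof. by have [] := tameness n. Qed.

End UniformFiniteness.

(** * Types and directed families *)

Section NamingConstants.
Context {d : Order.disp_t} {M : orderType d} {L : language} (I : structure L M).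

Fixpoint tabs (V W : Type) (s : V -> W) (r : M -> option W) (t : term L M V) : term L M W :=
  match t with
  | TVar v => TVar L M (s v)
  | TPar a => if r a is Some w then TVar L M w else TPar L W a
  | TApp f ts => TApp (fun i => tabs s r (ts i))
  end.

Fixpoint fabs (V : Type) (phi : formula L M V) :
    forall W : Type, (V -> W) -> (M -> option W) -> formula L M W :=
  match phi with
  | FEq t u => fun W s r => FEq (tabs s r t) (tabs s r u)
  | FLt t u => fun W s r => FLt (tabs s r t) (tabs s r u)
  | FRel R ts => fun W s r => FRel (fun i => tabs s r (ts i))
  | FNot psi => fun W s r => FNot (fabs psi s r)
  | FAnd psi chi => fun W s r => FAnd (fabs psi s r) (fabs chi s r)
  | FEx psi => fun W s r => FEx (fabs psi (omap s) (fun a => omap Some (r a)))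
  end.

Lemma tabsP (A : set M) (V : Type) (t : term L M V) : term_over A t ->
  exists l : seq M, (forall a, a \in l -> A a) /\
    forall W (s : V -> W) r, (forall a, a \in l -> exists w, r a = Some w) ->
      term_over set0 (tabs s r t) /\
      forall e, (forall a w, a \in l -> r a = Some w -> e w = a) ->
        Defs.eval I e (tabs s r t) = Defs.eval I (fun v => e (s v)) t.
Proof.
elim: t => [v|a|f ts IH] /= Ht.
- by exists [::]; split.
- exists [:: a]; split=> [b|W s r]; first by rewrite inE => /eqP ->.
  move=> /(_ a); rewrite inE eqxx => /(_ isT)[w E]; rewrite E; split=> // e /(_ a w).
  by rewrite inE eqxx; apply.
have /choice[l hl] := fun i => IH i (Ht i).
have sub i a : a \in l i -> a \in flatten [seq l i | i <- enum 'I_(farity f)].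
  by move=> ai; apply/flattenP; exists (l i) => //; apply/map_f; rewrite mem_enum.
exists (flatten [seq l i | i <- enum 'I_(farity f)]); split.
  by move=> a /flattenP[x /mapP[i _ ->]]; apply: (hl i).1.
move=> W s r Hr; split=> [i|e He].
  by have [] := (hl i).2 W s r (fun a ai => Hr a (sub i a ai)).
congr finterp; apply/funext => i; have [_ H] := (hl i).2 W s r (fun a ai => Hr a (sub i a ai)).
by apply: H => a w /sub; apply: He.
Qed.

(** The list of parameters is produced before the renaming [r] is given, because [r] gets shifted
    under each quantifier while the list does not change. *)
Lemma fabsP (A : set M) (V : Type) (phi : formula L M V) : formula_over A phi ->
  exists l : seq M, (forall a, a \in l -> A a) /\
    forall W (s : V -> W) r, (forall a, a \in l -> exists w, r a = Some w) ->
      formula_over set0 (fabs phi s r) /\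
      forall e, (forall a w, a \in l -> r a = Some w -> e w = a) ->
        sat I (fabs phi s r) e <-> sat I phi (fun v => e (s v)).
Proof.
have two (V' : Type) (t u : term L M V') : term_over A t -> term_over A u ->
    exists l : seq M, (forall a, a \in l -> A a) /\
    forall W (s : V' -> W) r, (forall a, a \in l -> exists w, r a = Some w) ->
      (term_over set0 (tabs s r t) /\ term_over set0 (tabs s r u)) /\
      forall e, (forall a w, a \in l -> r a = Some w -> e w = a) ->
        Defs.eval I e (tabs s r t) = Defs.eval I (fun v => e (s v)) t /\
        Defs.eval I e (tabs s r u) = Defs.eval I (fun v => e (s v)) u.
  move=> /tabsP[l [lA hl]] /tabsP[k [kA hk]]; exists (l ++ k); split.
    by move=> a; rewrite mem_cat => /orP[/lA|/kA].
  move=> W s r Hr.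
  have [h1 h2] := hl W s r (fun a al => Hr a (etrans (mem_cat _ _ _) (introT orP (or_introl al)))).
  have [h3 h4] := hk W s r (fun a al => Hr a (etrans (mem_cat _ _ _) (introT orP (or_intror al)))).
  by split=> // e He; split; [apply: h2|apply: h4] => a w al; apply: He; rewrite mem_cat al ?orbT.
elim: phi => {V} [V t u|V t u|V R ts|V psi IH|V psi IH1 chi IH2|V psi IH] /=.
- move=> [ht hu]; have [l [lA hl]] := two _ _ _ ht hu; exists l; split=> // W s r /(hl W s r)[h1 h2].
  by split=> // e /h2[-> ->].
- move=> [ht hu]; have [l [lA hl]] := two _ _ _ ht hu; exists l; split=> // W s r /(hl W s r)[h1 h2].
  by split=> // e /h2[-> ->].
- move=> Ht; have /choice[l hl] := fun i => tabsP (Ht i).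
  have sub i a : a \in l i -> a \in flatten [seq l i | i <- enum 'I_(rarity R)].
    by move=> ai; apply/flattenP; exists (l i) => //; apply/map_f; rewrite mem_enum.
  exists (flatten [seq l i | i <- enum 'I_(rarity R)]); split.
    by move=> a /flattenP[x /mapP[i _ ->]]; apply: (hl i).1.
  move=> W s r Hr; split=> [i|e He].
    by have [] := (hl i).2 W s r (fun a ai => Hr a (sub i a ai)).
  suff -> : (fun i => Defs.eval I e (tabs s r (ts i))) =
      (fun i => Defs.eval I (fun v => e (s v)) (ts i)) by [].
  apply/funext => i; have [_ H] := (hl i).2 W s r (fun a ai => Hr a (sub i a ai)).
  by apply: H => a w /sub; apply: He.
- move=> /IH[l [lA hl]]; exists l; split=> // W s r /(hl W s r)[h1 h2].
  by split=> // e /h2 E; split=> H /E.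
- move=> [/IH1[l [lA hl]] /IH2[k [kA hk]]]; exists (l ++ k); split.
    by move=> a; rewrite mem_cat => /orP[/lA|/kA].
  move=> W s r Hr.
  have [h1 h2] := hl W s r (fun a al => Hr a (etrans (mem_cat _ _ _) (introT orP (or_introl al)))).
  have [h3 h4] := hk W s r (fun a al => Hr a (etrans (mem_cat _ _ _) (introT orP (or_intror al)))).
  split=> // e He; rewrite h2 ?h4 // => a w al; apply: He; by rewrite mem_cat al ?orbT.
- move=> /IH[l [lA hl]]; exists l; split=> // W s r Hr.
  have [|h1 h2] := hl _ (omap s) (fun a => omap Some (r a)).
    by move=> a /Hr[w ->]; exists (Some w).
  split=> // e He.
  have E t : (fun v => ext e t (omap s v)) = ext (fun v => e (s v)) t.
    by apply/funext => -[].
  have K t : sat I (fabs psi (omap s) (fun a => omap Some (r a))) (ext e t) <->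
      sat I psi (ext (fun v => e (s v)) t).
    rewrite h2 ?E // => a w al; case Era : (r a) => [w'|] //= [<-] /=.
    exact: He Era.
  by split=> -[t Ht]; exists t; apply/K.
Qed.

Lemma def_params (A : set M) (V : Type) (X : (V -> M) -> Prop) : def I A X ->
  exists k (a : 'I_k -> M) (Y : (V + 'I_k -> M) -> Prop),
    [/\ forall i, A (a i), def I set0 Y & forall e, X e <-> Y (pr e a)].
Proof.
move=> [phi /fabsP[l [lA hl]] phiE].
pose r a : option (V + 'I_(size l)) := omap inr (insub (index a l)).
have rE a : a \in l -> exists i : 'I_(size l), r a = Some (inr i) /\ val i = index a l.
  move=> al; have il : (index a l < size l)%N by rewrite index_mem.
  by exists (Ordinal il); rewrite /r insubT.
have [|h1 h2] := hl _ inl r; first by move=> a /rE[i [-> _]]; exists (inr i).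
exists (size l), (tnth (in_tuple l)), (sat I (fabs phi inl r)); split.
- by move=> i; apply: lA; apply: mem_tnth.
- by exists (fabs phi inl r).
move=> e; rewrite -phiE h2 // => a w al.
have [i [-> iE]] := rE a al => -[<-] /=.
by rewrite (tnth_nth a) iE nth_index.
Qed.

End NamingConstants.

(** * Definable families and the calculus of a type *)

Section Families.
Context {d : Order.disp_t} {M : orderType d} {L : language} (I : structure L M).

Definition fam (W : Type) n (Om : (W -> M) -> Prop) (X : (W -> M) -> ('I_n -> M) -> Prop) :
  set (set (tup M n)) := [set X u | u in Om].

Lemma defp_fiber (A : set M) m n (phi : formula L M ('I_m + 'I_n)%type) :
  formula_over set0 phi -> defp I A (fiber I phi).
Proof.
move=> ophi; apply: (def_mono (A := set0)) => //.
by exists phi => // e; rewrite /fiber /mkset -/(pr _ _) prE.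
Qed.

Lemma definable_familyP (A : set M) n (S : set (set (tup M n))) : definable_family I A S ->
  exists (W : finType) (Om : (W -> M) -> Prop) (X : (W -> M) -> ('I_n -> M) -> Prop),
    [/\ def I A Om, defp I A X & S = fam Om X].
Proof.
move=> [m [phi [Om [ophi dOm ->]]]].
exists 'I_m, Om, (fiber I phi); split=> //; first exact/definableE.
by exists phi => // e; rewrite /fiber /mkset -/(pr _ _) prE.
Qed.

Lemma fam_definable (A : set M) n (W : finType) (Om : (W -> M) -> Prop)
    (X : (W -> M) -> ('I_n -> M) -> Prop) :
  def I A Om -> defp I A X -> definable_family I A (fam Om X).
Proof.
move=> dOm dX; pose m := #|W|.
pose s (o : W + 'I_n) : 'I_m + 'I_n := match o with inl w => inl (enum_rank w) | inr i => inr i end.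
have [phi ophi phiE] := def_ren s dX.
pose Om' : set (tup M m) := [set u | Om (fun w => u (enum_rank w))].
have fE (u : tup M m) : fiber I phi u = X (fun w => u (enum_rank w)).
  by apply/seteqP; split=> v; rewrite /fiber /mkset phiE.
exists m, phi, Om'; split=> //.
  by apply/definableE; apply: (def_ren (fun w => enum_rank w) dOm).
have rk (u : W -> M) : (fun w => u (enum_val (enum_rank w))) = u.
  by apply/funext => w; rewrite enum_rankK.
apply/seteqP; split=> _ [u Omu <-].
  by exists (fun i => u (enum_val i)); [rewrite /Om' /= rk|rewrite fE rk].
by exists (fun w => u (enum_rank w)); rewrite ?fE.
Qed.

(** The parameters of [X] become additional variables of a parameter-free formula, to which
    definability of [p] applies; afterwards these variables are specialised to elements of [A]. *)
Lemma definable_typeP (A : set M) n (p : set (set (tup M n))) : definable_type I A p ->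
  forall (W : finType) (X : (W -> M) -> ('I_n -> M) -> Prop), defp I A X ->
    def I A (fun u => p (X u)).
Proof.
move=> dp W X /def_params[k [a [Y [Aa dY XE]]]].
pose J : finType := (W + 'I_k)%type; pose m := #|J|.
pose s (o : (W + 'I_n) + 'I_k) : 'I_m + 'I_n := match o with
  | inl (inl w) => inl (enum_rank (inl w : J))
  | inl (inr j) => inr j
  | inr i => inl (enum_rank (inr i : J)) end.
have [phi ophi phiE] := def_ren s dY.
have /definableE dP := dp m phi ophi.
have := def_sub (F := fun (e : W -> M) (i : 'I_m) => pr e a (enum_val i : J)) dP.
move=> H; apply: (def_iff _ (H _)) => [u|i]; last first.
  by case: (enum_val i) => [w|j] /=; [left; exists w|right; exists (a j)].
rewrite /mkset (_ : fiber I phi _ = X u) //.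
apply/seteqP; split=> v; rewrite /fiber /mkset phiE.
  move=> H'; have := XE (pr u v); rewrite /= => ->; move: H'.
  set e1 := (X in Y X); set e2 := (X in _ -> Y X); suff -> : e1 = e2 by [].
  by apply/funext => -[[w|j]|i]; rewrite /e1 /e2 /= ?enum_rankK.
move=> H'; have := (XE (pr u v)).1 H'.
set e1 := (X in Y X -> _); set e2 := (X in _ -> Y X); suff -> : e1 = e2 by [].
by apply/funext => -[[w|j]|i]; rewrite /e1 /e2 /= ?enum_rankK.
Qed.

Section NType.
Variables (n : nat) (p : set (set (tup M n))).
Hypothesis tp : n_type I p.
Notation D := (def I setT).
Implicit Types X Y : ('I_n -> M) -> Prop.

Lemma type_def X : p X -> D X.
Proof. by move=> /(n_type_definable tp)/definableE. Qed.

Lemma type_up X Y : D Y -> (forall x, X x -> Y x) -> p X -> p Y.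
Proof. by move=> /definableE dY XY pX; apply: (n_type_up tp pX). Qed.

Lemma type_and X Y : p X -> p Y -> p (fun x => X x /\ Y x).
Proof. by move=> pX pY; apply: (n_type_setI tp pX pY). Qed.

Lemma type_dec X : D X -> p X \/ p (fun x => ~ X x).
Proof. by move=> /definableE dX; apply: (n_type_ultra tp dX). Qed.

Lemma type_inh X : p X -> exists x, X x.
Proof.
move=> pX; apply: contrapT => nE; apply: (n_type_proper tp).
by rewrite (_ : set0 = X) //; apply/seteqP; split=> x // Xx; apply: nE; exists x.
Qed.

Lemma type_meet X Y : p X -> p Y -> exists x, X x /\ Y x.
Proof. by move=> pX pY; apply: (type_inh (type_and pX pY)). Qed.

Lemma type_or X Y : D X -> D Y -> p (fun x => X x \/ Y x) -> p X \/ p Y.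
Proof.
move=> dX dY pXY; have [|nX] := type_dec dX; [by left|right].
by apply: type_up (type_and pXY nX) => // x [[]].
Qed.

Lemma type_ex (J : finType) (P : J -> ('I_n -> M) -> Prop) : (forall j, D (P j)) ->
  p (fun x => exists j, P j x) -> exists j, p (P j).
Proof.
move=> dP pE; apply: contrapT => nE.
have nP j : p (fun x => ~ P j x).
  by have [pj|//] := type_dec (dP j); case: nE; exists j.
have H (s : seq J) : p (fun x => forall j, j \in s -> ~ P j x).
  elim: s => [|j s IH].
    by apply: type_up pE => //; apply: def_iff (def_cst _ setT _ True).
  apply: type_up (type_and (nP j) IH) => [|x [nj Hs] k]; last first.
    by rewrite inE => /orP[/eqP ->|/Hs].
  by apply: def_alli => k; apply: def_imp; [exact: def_cst|exact: def_not].
by have [x [[j Pj] /(_ j)]] := type_meet pE (H (enum J)); rewrite mem_enum => /(_ isT).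
Qed.

Lemma type_true : p (fun _ => True).
Proof.
have [//|H] := type_dec (def_cst I setT 'I_n True).
by have [x []] := type_inh H.
Qed.

Lemma type_all X : (forall x, X x) -> p X.
Proof.
move=> HX; apply: (type_up _ _ type_true) => //.
by apply: def_iff (def_cst _ _ _ True).
Qed.

(** Two up-sets of a linear order are comparable; this holds in every fibre, and the type decides
    which inclusion is generic. [R] will be the order or its converse. *)
Lemma type_nested (R : M -> M -> Prop) (U V : ('I_n -> M) -> M -> Prop) :
  def2 I setT U -> def2 I setT V -> (forall s t, R s t \/ R t s) ->
  (forall y s t, U y s -> R s t -> U y t) -> (forall y s t, V y s -> R s t -> V y t) ->
  p (fun y => forall t, U y t -> V y t) \/ p (fun y => forall t, V y t -> U y t).
Proof.
move=> dU dV tR uU uV; have dUV : D (fun y => forall t, U y t -> V y t) by dsolve.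
have dVU : D (fun y => forall t, V y t -> U y t) by dsolve.
have [|np] := type_dec dUV; [by left|right].
apply: (type_up dVU _ np) => y nUV t Vt; apply: contrapT => nUt; apply: nUV => s Us.
by case: (tR s t) => [/(uU y s t Us)|/(uV y t s Vt)].
Qed.

End NType.

End Families.

(** * Strata of a definable subset of the line *)

Section Strata.
Context {d : Order.disp_t} {M : orderType d} {L : language} (I : structure L M).
Hypothesis om : o_minimal I.

(* The boundary points of [P] cut [M] into strata, alternately open and singletons;
   [t] lies in the stratum of index [idx P t]. *)
Definition idx (P : M -> Prop) (t : M) : nat := `[< bd P t >] + (cnt (bd P) t).*2.

Definition strat (j : nat) (P : M -> Prop) (t : M) : Prop :=
  [/\ bd P t <-> odd j, atl j./2 (fun u => bd P u /\ u < t) &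
      ~ atl j./2.+1 (fun u => bd P u /\ u < t)].

Section OneSet.
Variable P : M -> Prop.
Hypothesis dP : def1 I setT P.
Let fb := bd_fin om dP.

Lemma stratE j t : strat j P t <-> idx P t = j.
Proof.
have c k : atl k (fun u => bd P u /\ u < t) <-> (k <= cnt (bd P) t)%N by apply: cnt_atl.
rewrite /strat /idx; split=> [[H /c h1 nh]|<-].
  have h2 : (cnt (bd P) t <= j./2)%N by rewrite leqNgt; apply/negP => /c.
  have -> : cnt (bd P) t = j./2 by apply/eqP; rewrite eqn_leq h1 h2.
  by rewrite (_ : `[< bd P t >] = odd j) ?odd_double_half //; apply/asboolP/idP => /H.
rewrite half_bit_double oddD odd_double addbF oddb; split.
- by split=> [?|/asboolP]; first exact/asboolP.
- exact/c.
by move=> /c; rewrite ltnn.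
Qed.

Lemma idx_lt t t' : t < t' -> bd P t -> (idx P t < idx P t')%N.
Proof.
move=> tt' bt; have := cnt_lt fb bt tt'; rewrite /idx => H.
rewrite (asboolT bt).
apply: leq_trans (leq_addl _ _).
by rewrite -ltn_double in H; rewrite add1n -doubleS leq_double -ltn_double.
Qed.

Lemma idx_le t t' : t <= t' -> (idx P t <= idx P t')%N.
Proof.
rewrite le_eqVlt => /orP[/eqP -> //|tt']; have [bt|nt] := pselect (bd P t).
  by apply: ltnW; apply: idx_lt.
rewrite /idx (asboolF nt).
by apply: leq_trans (leq_addl _ _); rewrite leq_double cnt_le // ltW.
Qed.

Lemma idx_nobd t t' u : idx P t = idx P t' -> t < t' -> t <= u -> u <= t' -> ~ bd P u.
Proof.
move=> E tt' tu ut' bu; move: ut'; rewrite le_eqVlt => /orP[/eqP ut'|ut'].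
  have nt : ~ bd P t by move=> /(idx_lt tt'); rewrite E ltnn.
  have bt' : bd P t' by rewrite -ut'.
  have := congr1 odd E; rewrite /idx !oddD !odd_double !addbF !oddb.
  rewrite (asboolF nt).
  by rewrite (asboolT bt').
by have := idx_lt ut' bu; rewrite -E ltnNge idx_le.
Qed.

Lemma idx_const t t' : idx P t = idx P t' -> P t <-> P t'.
Proof.
have H s s' : s < s' -> idx P s = idx P s' -> P s <-> P s'.
  move=> ss' E; apply: (bd_const om dP (ltW ss')) => u; exact: idx_nobd.
by case: (ltgtP t t') => [h|h|->//] E; [apply: H|symmetry; apply: H].
Qed.

Lemma idx_nobd_itv c e s s' : (forall t, c < t -> t < e -> ~ bd P t) ->
  c < s -> s < e -> c < s' -> s' < e -> idx P s = idx P s'.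
Proof.
move=> nb; wlog ss' : s s' / s <= s' => [H|] cs se cs' se'.
  by case/orP: (le_total s s') => h; [apply: H|symmetry; apply: H].
rewrite /idx (cnt_const fb ss') => [|w h1 h2]; last by apply: nb; ord.
by rewrite (asboolF (nb s cs se)) (asboolF (nb s' cs' se')).
Qed.

Lemma idx_itv t u c e : c < t -> t < e -> (forall s, c < s -> s < e -> P s) ->
  c < u -> u < e -> idx P u = idx P t.
Proof.
move=> ct te H cu ue; apply: (idx_nobd_itv _ cu ue ct te) => s cs se.
by apply; exists c, e; split=> // w cw we; split=> _; apply: H.
Qed.

Lemma idx_open t : ~ bd P t -> exists c e, [/\ c < t, t < e &
  forall u, c < u -> u < e -> (P u <-> P t) /\ idx P u = idx P t].
Proof.
move=> /contrapT[c [e [ct te H]]]; exists c, e; split=> // u cu ue; split; first exact: H.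
apply: (idx_nobd_itv _ cu ue ct te) => s cs se.
by apply; exists c, e; split=> // w cw we; rewrite (H w) // (H s).
Qed.

Lemma idx_bound N t : ~ atl N (bd P) -> (idx P t < N.*2)%N.
Proof.
move=> nN; have sN : (size (els (bd P)) < N)%N.
  by rewrite ltnNge; apply/negP => h; apply: nN; apply/els_atl.
have h := leq_ltn_trans (cnt_size (bd P) t) sN; rewrite /idx.
apply: leq_ltn_trans (_ : (cnt (bd P) t).*2.+1 < _)%N; last by rewrite -doubleS leq_double.
by case: `[< _ >] => //=; rewrite add0n.
Qed.

End OneSet.

Lemma ninf_dec (P : M -> Prop) : def1 I setT P ->
  exists c, (forall t, t < c -> P t) \/ (forall t, t < c -> ~ P t).
Proof.
move=> dP; have fb := bd_fin om dP; have [p _] := omin_nonempty om.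
have [c Hc] : exists c, forall t, t < c -> ~ bd P t.
  have [[t bt]|nE] := pselect (exists t, bd P t); last first.
    by exists p => t _ bt; apply: nE; exists t.
  have [c _ Hc] := fin_min fb (ex_intro _ t bt); exists c => u uc /Hc ?; ord.
have K u v : u <= v -> v < c -> P u <-> P v.
  by move=> uv vc; apply: (bd_const om dP uv) => t h1 h2; apply: Hc; ord.
have [t0 t0c] := omin_no_min om c; exists c.
have [Pt|nPt] := pselect (P t0); [left|right] => t tc;
  by case/orP: (le_total t t0) => h; [rewrite (K _ _ h)|rewrite -(K _ _ h)].
Qed.

(* An up-set [U] of [M] determines a complete 1-type, that of points just above its infimum. *)
Lemma upset_dec (U P : M -> Prop) : def1 I setT U -> def1 I setT P ->
  (forall s t, U s -> s <= t -> U t) -> (exists t, U t) ->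
  (exists t, U t /\ forall s, U s -> s <= t -> P s) \/
  (exists t, U t /\ forall s, U s -> s <= t -> ~ P s).
Proof.
move=> dU dP up [t0 Ut0].
have [[b Hb]|nb] := pselect (exists b, forall t, U t -> b <= t); last first.
  have [c Hc] := ninf_dec dP; have [c' c'c] := omin_no_min om c.
  have Uc' : U c'.
    apply: contrapT => nU; apply: nb; exists c' => t Ut; rewrite leNgt; apply/negP => tc.
    by apply: nU; apply: up Ut (ltW tc).
  by case: Hc => Hc; [left|right]; exists c'; split=> // s _ sc; apply: Hc; ord.
have [||h [h1 h2]] := has_inf om (b := b) dU; [by exists t0|by []|].
have [Uh|nUh] := pselect (U h).
  have E s : U s -> s <= h -> s = h by move=> /h1 hs sh; apply/eqP; rewrite eq_le hs sh.
  by have [Ph|nPh] := pselect (P h); [left|right]; exists h; split=> // s Us sh; rewrite (E s).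
have hU t : U t -> h < t.
  by move=> Ut; rewrite lt_neqAle h1 // andbT; apply/eqP => E; apply: nUh; rewrite E.
have [[c hc Hc]|[c hc Hc]] := rgerm_dec om h dP; [left|right];
  have [t Ut tc] := h2 c hc; exists t; split=> // s Us st; apply: Hc; [exact: hU|by ord|exact: hU|by ord].
Qed.

End Strata.

Ltac dhook ::=
  match goal with
  | H : definable_type ?I ?A ?q |- def ?I ?A (fun e => ?q (@?X e)) =>
      apply: (definable_typeP H (X := X))
  | |- def _ _ (fun e => bd _ _) => rewrite /bd
  | |- def _ _ (fun e => strat _ _ _) => rewrite /strat
  | |- def _ _ (fun e => atl _ _) => rewrite /atl
  | |- def _ _ (fun e => is_inf _ _) => rewrite /is_inf
  | |- def _ _ (fun e => is_sup _ _) => rewrite /is_sup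
  | |- def _ _ (fun e => nbx _ _) => rewrite /nbx /bx
  | |- def _ _ (fun e => contpt _ _ _) => rewrite /contpt
  | |- def _ _ (fun e => conton _ _) => rewrite /conton
  end.

(** * Components, directed families inside a type, and extension of a type by one variable *)

Section Types.
Context {d : Order.disp_t} {M : orderType d} {L : language} (I : structure L M).
Hypothesis om : o_minimal I.

Definition fb n (Z : ('I_n.+1 -> M) -> Prop) (y : 'I_n -> M) (t : M) : Prop :=
  Z (ins ord_max y t).

Definition St n (j : nat) (Z : ('I_n.+1 -> M) -> Prop) (x : 'I_n.+1 -> M) : Prop :=
  strat j (fb Z (del ord_max x)) (x ord_max).

Lemma def_toT (A : set M) (V : Type) (X : (V -> M) -> Prop) : def I A X -> def I setT X.
Proof. by apply: def_mono. Qed.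

Lemma defp_toT (A : set M) (V W : Type) (X : (W -> M) -> (V -> M) -> Prop) :
  defp I A X -> defp I setT X.
Proof. exact: def_toT. Qed.

Lemma defp_at (W : finType) n (X : (W -> M) -> ('I_n -> M) -> Prop) u :
  defp I setT X -> def I setT (X u).
Proof. by move=> dX; dsolve. Qed.

Lemma def_fb n (Z : ('I_n.+1 -> M) -> Prop) y : def I setT Z -> def1 I setT (fb Z y).
Proof. by move=> dZ; rewrite /fb; dsolve. Qed.

Lemma def_St n j (Z : ('I_n.+1 -> M) -> Prop) : def I setT Z -> def I setT (St j Z).
Proof. by move=> dZ; rewrite /St /fb; dsolve. Qed.

Lemma bd_bound n (W : finType) (X : (W -> M) -> ('I_n.+1 -> M) -> Prop) : defp I setT X ->
  exists N, forall u y, ~ atl N (bd (fb (X u) y)).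
Proof.
move=> dX.
pose Y (e : W + 'I_n -> M) t := bd (fb (X (fun w => e (inl w))) (fun i => e (inr i))) t.
have [||N HN] := @uniform_finiteness _ _ _ _ om _ Y; first by rewrite /Y /fb; dsolve.
  by move=> e; apply: (bd_fin om); apply: def_fb; apply: defp_at.
by exists N => u y; have := HN (pr u y).
Qed.

Section Component.
Variables (A : set M) (n : nat) (p : set (set (tup M n.+1))).
Hypotheses (tp : n_type I p) (dp : definable_type I A p).
Variables (W : finType) (Om : (W -> M) -> Prop) (X : (W -> M) -> ('I_n.+1 -> M) -> Prop).
Hypotheses (dX : defp I A X) (pX : forall u, Om u -> p (X u)).

(** The two shapes come from strata of odd index, single points, and of even index, open sets. In
    the open case the fibres of [E] are maximal: an open interval of [Z] around a point of [E] stays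
    in [E]. This is what later compares the components of nested members. *)
Record component (Z E : ('I_n.+1 -> M) -> Prop) : Prop := Component {
  comp_def : def I setT E;
  comp_sub : forall x, E x -> Z x;
  comp_mem : p E;
  comp_convex : forall y t s t', fb E y t -> fb E y t' -> t <= s -> s <= t' -> fb E y s;
  comp_shape : (forall y t t', fb E y t -> fb E y t' -> t = t') \/
    (forall y t, fb E y t -> (exists c e, [/\ c < t, t < e & forall s, c < s -> s < e -> fb E y s])
      /\ forall c e, c < t -> t < e -> (forall s, c < s -> s < e -> fb Z y s) ->
           forall s, c < s -> s < e -> fb E y s) }.

Lemma components : exists E, defp I A E /\ forall u, Om u -> component (X u) (E u).
Proof.
have dXT := defp_toT dX; have [N HN] := bd_bound dXT.
(* The index of the stratum that lies in [p] varies with [u]. Quantifying over it within the uniform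
   bound [N.*2], instead of choosing it, keeps [E] definable over [A]. *)
pose E u x := X u x /\ exists j : 'I_N.*2, p (St j (X u)) /\ St j (X u) x.
have dE : defp I A E by rewrite /E /St /fb; dsolve.
exists E; split=> // u Omu.
have dXu := defp_at u dXT; have dfy y := def_fb y dXu.
have idxE j x : St j (X u) x <-> idx (fb (X u) (del ord_max x)) (x ord_max) = j.
  by rewrite /St (stratE om).
have [j pj] : exists j : 'I_N.*2, p (St j (X u)).
  apply: (type_ex tp) => [j|]; first exact: def_St.
  apply: (type_all tp) => x; pose i := idx (fb (X u) (del ord_max x)) (x ord_max).
  have iN : (i < N.*2)%N by apply: (idx_bound om).
  by exists (Ordinal iN); apply/idxE.
have EE x : E u x <-> X u x /\ St j (X u) x.
  split=> [[Xx [k [pk Sk]]]|[Xx Sj]]; last by split=> //; exists j.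
  have [x' [/idxE Ej /idxE Ek]] := type_meet tp pj pk.
  have jk : j = k by apply/val_inj; rewrite /= -Ej -Ek.
  by rewrite jk.
have EE' y t : fb (E u) y t <-> fb (X u) y t /\ idx (fb (X u) y) t = j.
  by rewrite {1}/fb EE idxE del_ins ins_id.
have dEu : def I setT (E u) by apply: defp_at; apply: defp_toT dE.
split=> //.
- by move=> x /EE[].
- by apply: (type_up tp dEu) (type_and tp (pX Omu) pj) => x /EE.
- move=> y t s t' /EE'[Xt it] /EE'[Xt' it'] ts st'; apply/EE'.
  have is_ : idx (fb (X u) y) s = j.
    apply/eqP; rewrite eqn_leq -{1}it' -it.
    by rewrite !(idx_le om).
  by split=> //; apply/(idx_const om (dfy y) (t' := t)); rewrite ?is_ ?it.
have nbd y t : idx (fb (X u) y) t = j -> bd (fb (X u) y) t <-> odd j.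
  by move/(stratE om (dfy y)) => -[].
case oj : (odd j); [left|right].
  move=> y t t' /EE'[Xt it] /EE'[Xt' it'].
  case: (ltgtP t t') => // h.
    have bt : bd (fb (X u) y) t by apply/(nbd _ _ it).
    by have := idx_lt om (dfy y) h bt; rewrite it it' ltnn.
  have bt : bd (fb (X u) y) t' by apply/(nbd _ _ it').
  by have := idx_lt om (dfy y) h bt; rewrite it it' ltnn.
move=> y t /EE'[Xt it]; split.
  have nb : ~ bd (fb (X u) y) t by move=> /(nbd _ _ it); rewrite oj.
  have [c [e [ct te H]]] := idx_open om (dfy y) nb; exists c, e; split=> // s cs se.
  by apply/EE'; have [h1 h2] := H s cs se; rewrite h1 h2.
move=> c e ct te H s cs se; apply/EE'; split; first exact: H.
by rewrite (idx_itv om (dfy y) ct te H).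
Qed.

End Component.

Lemma component1 A n (p : set (set (tup M n.+1))) Z : n_type I p -> definable_type I A p ->
  p Z -> exists E, component p Z E.
Proof.
move=> tp dp pZ; have dZ := type_def tp pZ.
(* [Z] may have parameters outside [A]. *)
have dp' : definable_type I setT p.
  by move=> m phi ophi; apply/definableE; apply: def_toT; apply/definableE; apply: dp.
have dX : defp I setT (fun _ : void -> M => Z) by dsolve.
have [E [dE HE]] := components (Om := fun _ => True) tp dp' dX (fun _ _ => pZ).
have u : void -> M by case.
by exists (E u); apply: HE.
Qed.

Definition proj_type n (p : set (set (tup M n.+1))) : set (set (tup M n)) :=
  [set Y | definable I setT Y /\ p (fun x => Y (del ord_max x))].

Lemma def_pullback n (Y : ('I_n -> M) -> Prop) : def I setT Y ->
  def I setT (fun x : 'I_n.+1 -> M => Y (del ord_max x)).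
Proof. by move=> dY; dsolve. Qed.

Lemma proj_typeP n (p : set (set (tup M n.+1))) : n_type I p -> n_type I (proj_type p).
Proof.
move=> tp; split.
- by move=> X [].
- by move=> [_ /(type_inh tp)[x]].
- move=> X Y [/definableE dX pX] [/definableE dY pY]; split.
    by apply/definableE; apply: def_and.
  exact: (type_and tp pX pY).
- move=> X Y [/definableE dX pX] /[dup] /definableE dY dY' XY; split=> //.
  by apply: (type_up tp _ _ pX); [exact: def_pullback|move=> x; apply: XY].
move=> X /[dup] /definableE dX dX'.
have [|] := type_dec tp (def_pullback dX); [by left|right]; split=> //.
by apply/definableE; apply: def_not.
Qed.

Lemma proj_type_definable A n (p : set (set (tup M n.+1))) :
  definable_type I A p -> definable_type I A (proj_type p).
Proof.
move=> dp m phi ophi.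
have dF := defp_fiber I A ophi.
have H : def I A (fun u : 'I_m -> M => p (fun x => fiber I phi u (del ord_max x))) by dsolve.
apply/definableE; apply: def_iff H => u; split=> [pF|[]//]; split=> //.
by apply/definableE; apply: defp_at; apply: defp_toT dF.
Qed.

Section Filter.
Variable A : set M.

Theorem type_family_directed n : forall (p : set (set (tup M n))), n_type I p ->
  definable_type I A p ->
  forall (W : finType) (Om : (W -> M) -> Prop) (X : (W -> M) -> ('I_n -> M) -> Prop),
  def I A Om -> defp I A X -> (forall u, Om u -> p (X u)) ->
  exists (W' : finType) (Om' : (W' -> M) -> Prop) (Z : (W' -> M) -> ('I_n -> M) -> Prop),
    [/\ def I A Om', defp I A Z, forall v, Om' v -> p (Z v),
        forall v v', Om' v -> Om' v' ->
          exists v'', Om' v'' /\ forall x, Z v'' x -> Z v x /\ Z v' x &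
        forall u, Om u -> exists v, Om' v /\ forall x, Z v x -> X u x].
Proof.
elim: n => [|n IH] p tp dp W Om X dOm dX pX.
  (* [M^0] is a single point, so every member of the type is the whole space. *)
  have u0 (x y : 'I_0 -> M) : x = y by apply/funext => -[].
  exists W, Om, X; split=> // [v v' Ov Ov'|u Ou]; last by exists u.
  exists v; split=> // x Xx; split=> //.
  by have [y Xy] := type_inh tp (pX _ Ov'); rewrite (u0 x y).
have [E [dE HE]] := components tp dp dX pX.
set q := proj_type p; have tq : n_type I q := proj_typeP tp.
have dq : definable_type I A q := proj_type_definable dp.
pose Up (u : W -> M) y t := exists s, fb (E u) y s /\ s <= t.
pose Dn (u : W -> M) y t := exists s, fb (E u) y s /\ t <= s.
have dET := defp_toT dE.
(* One inclusion of up-closures together with one of down-closures makes a single index, so that one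
   directed family on the base witnesses both kinds at once. *)
pose G (z : (W + W) + (W + W) -> M) (y : 'I_n -> M) :=
  (forall t, Up (fun w => z (inl (inl w))) y t -> Up (fun w => z (inl (inr w))) y t) /\
  (forall t, Dn (fun w => z (inr (inl w))) y t -> Dn (fun w => z (inr (inr w))) y t).
pose OmG (z : (W + W) + (W + W) -> M) :=
  [/\ Om (fun w => z (inl (inl w))), Om (fun w => z (inl (inr w))),
      Om (fun w => z (inr (inl w))) & Om (fun w => z (inr (inr w)))] /\ q (G z).
have dG : defp I A G by rewrite /G /Up /Dn /fb; dsolve.
have dOmG : def I A OmG by rewrite /OmG; dsolve.
have [W1 [Om1 [Z1 [dOm1 dZ1 qZ1 dir1 fin1]]]] :=
  IH q tq dq _ OmG G dOmG dG (fun z (h : OmG z) => h.2).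
have dZ1T := defp_toT dZ1.
pose Om' (z : W1 + (W + W) -> M) := [/\ Om1 (fun w => z (inl w)),
  Om (fun w => z (inr (inl w))) & Om (fun w => z (inr (inr w)))].
(* The up-closure and the down-closure are taken from two different members, since the one starting
   last and the one ending first need not coincide. *)
pose Z (z : W1 + (W + W) -> M) (x : 'I_n.+1 -> M) := [/\ Z1 (fun w => z (inl w)) (del ord_max x),
  Up (fun w => z (inr (inl w))) (del ord_max x) (x ord_max) &
  Dn (fun w => z (inr (inr w))) (del ord_max x) (x ord_max)].
have dZ : defp I A Z by rewrite /Z /Up /Dn /fb; dsolve.
have totU u u' : Om u -> Om u' -> q (fun y => forall t, Up u y t -> Up u' y t) \/
    q (fun y => forall t, Up u' y t -> Up u y t).
  move=> _ _; apply: (type_nested tq (R := fun s t => s <= t)); try by rewrite /Up /fb; dsolve.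
  - by move=> s t; apply/orP/le_total.
  - by move=> y s t [r [Er rs]] st; exists r; split=> //; ord.
  by move=> y s t [r [Er rs]] st; exists r; split=> //; ord.
have totD u u' : Om u -> Om u' -> q (fun y => forall t, Dn u y t -> Dn u' y t) \/
    q (fun y => forall t, Dn u' y t -> Dn u y t).
  move=> _ _; apply: (type_nested tq (R := fun s t => t <= s)); try by rewrite /Dn /fb; dsolve.
  - by move=> s t; apply/orP/le_total.
  - by move=> y s t [r [Er rs]] st; exists r; split=> //; ord.
  by move=> y s t [r [Er rs]] st; exists r; split=> //; ord.
have minU u u' : Om u -> Om u' -> exists w, [/\ Om w, q (fun y => forall t, Up w y t -> Up u y t)
    & q (fun y => forall t, Up w y t -> Up u' y t)].
  move=> Ou Ou'; have [h|h] := totU _ _ Ou Ou'; [exists u|exists u']; split=> //;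
    by apply: (type_all tq).
have minD u u' : Om u -> Om u' -> exists w, [/\ Om w, q (fun y => forall t, Dn w y t -> Dn u y t)
    & q (fun y => forall t, Dn w y t -> Dn u' y t)].
  move=> Ou Ou'; have [h|h] := totD _ _ Ou Ou'; [exists u|exists u']; split=> //;
    by apply: (type_all tq).
have get a b a' b' : Om a -> Om b -> Om a' -> Om b' ->
    q (fun y => forall t, Up a y t -> Up b y t) -> q (fun y => forall t, Dn a' y t -> Dn b' y t) ->
    exists v, Om1 v /\ forall y, Z1 v y -> (forall t, Up a y t -> Up b y t) /\
                                          (forall t, Dn a' y t -> Dn b' y t).
  move=> Oa Ob Oa' Ob' qU qD; apply: (fin1 (pr (pr a b) (pr a' b'))).
  by split=> //; apply: (type_and tq qU qD).
exists (W1 + (W + W))%type, Om', Z; split=> //.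
- by rewrite /Om'; dsolve.
- move=> z [O1 Ou Ov].
  have dZz : def I setT (Z z) by apply: defp_at; apply: defp_toT dZ.
  have [_ pZ1] := qZ1 _ O1.
  have pEu := comp_mem (HE _ Ou); have pEv := comp_mem (HE _ Ov).
  apply: (type_up tp dZz) (type_and tp pZ1 (type_and tp pEu pEv)) => x [h1 [h2 h3]].
  by split=> //; exists (x ord_max); rewrite /fb ins_del.
- move=> z z' [O1 Ou Ov] [O1' Ou' Ov'].
  have [a [Oa qa qa']] := minU _ _ Ou Ou'; have [b [Ob qb qb']] := minD _ _ Ov Ov'.
  have [v1 [Ov1 H1]] := get a _ b _ Oa Ou Ob Ov qa qb.
  have [v2 [Ov2 H2]] := get a _ b _ Oa Ou' Ob Ov' qa' qb'.
  have [v3 [Ov3 H3]] := dir1 _ _ O1 O1'.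
  have [v4 [Ov4 H4]] := dir1 _ _ Ov1 Ov2.
  have [v5 [Ov5 H5]] := dir1 _ _ Ov3 Ov4.
  exists (pr v5 (pr a b)); split=> // x [/= /H5[/H3[h h'] /H4[/H1[k1 k2] /H2[k3 k4]]] Ux Dx].
  by split; split=> //; [apply: k1|apply: k2|apply: k3|apply: k4].
move=> u Ou; have qT (P : M -> ('I_n -> M) -> Prop) : q (fun y => forall t, P t y -> P t y).
  exact: (type_all tq).
have [v [Ov Hv]] := get u u u u Ou Ou Ou Ou (qT _) (qT _).
exists (pr v (pr u u)); split=> // x [_ [s [Es sx]] [s' [Es' xs']]].
apply: (comp_sub (HE _ Ou)); rewrite -(ins_del ord_max x).
exact: (comp_convex (HE _ Ou) Es Es' sx xs').
Qed.

(* [v] is deeper than [u] when the fibre of [X v] starts later; the type extending [X] over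
   [q] is the limit, along deeper and deeper [v], of the types of points just above the
   infimum of the fibre of [X v]. *)
Theorem type_over n (q : set (set (tup M n))) (W : finType) (Om : (W -> M) -> Prop)
    (X : (W -> M) -> ('I_n.+1 -> M) -> Prop) :
  n_type I q -> definable_type I A q -> def I A Om -> defp I A X -> (exists u, Om u) ->
  (forall u v, Om u -> Om v -> exists w, Om w /\ forall x, X w x -> X u x /\ X v x) ->
  (forall u, Om u -> q (fun y => exists t, fb (X u) y t)) ->
  exists p : set (set (tup M n.+1)), [/\ n_type I p, definable_type I A p,
    forall u, Om u -> p (X u) & forall Y, q Y -> p (fun x => Y (del ord_max x))].
Proof.
move=> tq dq dOm dX [u0 Ou0] dir qX.
have dXT := defp_toT dX.
pose Up (u : W -> M) y t := exists s, fb (X u) y s /\ s <= t.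
pose le u v := q (fun y => forall t, Up v y t -> Up u y t).
pose In u (Z : ('I_n.+1 -> M) -> Prop) y := exists t, Up u y t /\ forall s, Up u y s -> s <= t -> fb Z y s.
pose pv u Z := q (In u Z).
have dIn u Z : def I setT Z -> def I setT (In u Z).
  by move=> dZ; rewrite /In /Up /fb; dsolve.
have dle u v : def I setT (fun y => forall t, Up v y t -> Up u y t).
  by rewrite /Up /fb; dsolve.
have UpT u : Om u -> q (fun y => exists t, Up u y t).
  move=> Ou; apply: (type_up tq _ _ (qX u Ou)); first by rewrite /Up /fb; dsolve.
  by move=> y [t Xt]; exists t, t.
have le_refl u : le u u by apply: (type_all tq).
have le_trans' u v w : le u v -> le v w -> le u w.
  by move=> h1 h2; apply: (type_up tq (dle u w)) (type_and tq h1 h2) => y [k1 k2] t /k2/k1.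
have le_tot u v : le u v \/ le v u.
  apply: (type_nested tq (R := fun s t => s <= t)); try by rewrite /Up /fb; dsolve.
  - by move=> s t; apply/orP/le_total.
  - by move=> y s t [r [Er rs]] st; exists r; split=> //; ord.
  by move=> y s t [r [Er rs]] st; exists r; split=> //; ord.
have pv_and u Z Z' : def I setT Z -> def I setT Z' -> pv u Z -> pv u Z' -> pv u (fun x => Z x /\ Z' x).
  move=> dZ dZ' h1 h2; apply: (type_up tq) (type_and tq h1 h2).
    by apply: dIn; apply: def_and.
  move=> y [[t [Ut Ht]] [t' [Ut' Ht']]]; case/orP: (le_total t t') => tt'.
    by exists t; split=> // s Us st; split; [apply: Ht|apply: Ht'] => //; ord.
  by exists t'; split=> // s Us st; split; [apply: Ht|apply: Ht'] => //; ord.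
have pv_up u Z Z' : def I setT Z' -> (forall x, Z x -> Z' x) -> pv u Z -> pv u Z'.
  move=> dZ' ZZ'; apply: (type_up tq); first exact: dIn.
  by move=> y [t [Ut Ht]]; exists t; split=> // s Us st; apply: ZZ'; apply: Ht.
have pv_inh u Z : pv u Z -> ~ pv u (fun x => ~ Z x).
  move=> h1 h2; have [y [[t [Ut Ht]] [t' [Ut' Ht']]]] := type_meet tq h1 h2.
  case/orP: (le_total t t') => tt'.
    by apply: (Ht' t Ut tt'); apply: Ht.
  by apply: (Ht' t' Ut' (lexx _)); apply: Ht.
have pv_dec u Z : Om u -> def I setT Z -> pv u Z \/ pv u (fun x => ~ Z x).
  move=> Ou dZ; apply: (type_or tq); [exact: dIn|by apply: dIn; apply: def_not|].
  apply: (type_up tq _ _ (UpT u Ou)); first by apply: def_or; apply: dIn => //; apply: def_not.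
  move=> y E; apply: (upset_dec om) => //.
  - by rewrite /Up /fb; dsolve.
  - exact: def_fb.
  by move=> s t [r [Xr rs]] st; exists r; split=> //; ord.
have pull u Y : q Y -> Om u -> pv u (fun x => Y (del ord_max x)).
  move=> qY Ou; have dY := type_def tq qY.
  apply: (type_up tq) (type_and tq qY (UpT u Ou)); first by apply: dIn; apply: def_pullback.
  by move=> y [Yy [t Ut]]; exists t; split=> // s _ _; rewrite /fb del_ins.
pose p : set (set (tup M n.+1)) :=
  [set Z | definable I setT Z /\ exists u, Om u /\ forall v, Om v -> le u v -> pv v Z].
have pE Z : def I setT Z -> p Z <-> exists u, Om u /\ forall v, Om v -> le u v -> pv v Z.
  by move=> dZ; split=> [[]//|?]; split=> //; apply/definableE.
(* along deeper [v], the stratum of [Z] met by [pv v] increases, hence stabilizes *)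
have stab Z : def I setT Z -> exists j u, Om u /\ forall v, Om v -> le u v -> pv v (St j Z).
  move=> dZ; have dZ' : defp I setT (fun _ : void -> M => Z) by dsolve.
  have [N HN] := bd_bound dZ'.
  have u : void -> M by case.
  pose ix (x : 'I_n.+1 -> M) := idx (fb Z (del ord_max x)) (x ord_max).
  have ixE j x : St j Z x <-> ix x = j by rewrite /St (stratE om) //; apply: def_fb.
  pose Lv j (x : 'I_n.+1 -> M) := (ix x <= j)%N.
  have dLv j : def I setT (Lv j).
    apply: (def_iff (X := fun x => exists i : 'I_j.+1, St i Z x)).
      move=> x; rewrite /Lv; split=> [[i /ixE ->]|h]; first by rewrite -ltnS ltn_ord.
      by exists (inord (ix x)); apply/ixE; rewrite inordK.
    by apply: def_exi => i; apply: def_St.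
  have Lv_down u1 v j : le u1 v -> pv v (Lv j) -> pv u1 (Lv j).
    move=> h1 h2; apply: (type_up tq) (type_and tq h1 h2); first exact: dIn.
    move=> y [HU [t [Ut Ht]]]; exists t; split=> [|s _ st]; first exact: HU.
    have := Ht t Ut (lexx _); rewrite /fb /Lv /ix !del_ins !ins_id.
    by apply: leq_trans; apply: (idx_le om (def_fb y dZ) st).
  have exj : exists j, `[< forall v, Om v -> pv v (Lv j) >].
    exists N.*2; apply/asboolP => v Ov; apply: (type_up tq _ _ (UpT v Ov)); first exact: dIn.
    move=> y [t Ut]; exists t; split=> // s _ _; rewrite /fb /Lv; apply: ltnW.
    rewrite /ix del_ins ins_id; apply: (idx_bound om (def_fb y dZ)); exact: (HN u).
  have jP := ex_minnP exj; case: jP => j /asboolP Hj min_j; exists j.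
  case: j Hj min_j => [|j] Hj min_j.
    exists u0; split=> // v Ov _; apply: pv_up (Hj v Ov); first exact: def_St.
    by move=> x; rewrite /Lv leqn0 => /eqP /ixE.
  have [u1 [Ou1 nu1]] : exists u, Om u /\ ~ pv u (Lv j).
    apply: contrapT => nE; suff /min_j : `[< forall v, Om v -> pv v (Lv j) >] by rewrite ltnn.
    by apply/asboolP => v Ov; apply: contrapT => nv; apply: nE; exists v.
  exists u1; split=> // v Ov uv.
  have nv : pv v (fun x => ~ Lv j x).
    by have [h|//] := pv_dec v (Lv j) Ov (dLv j); case: nu1; apply: Lv_down h.
  apply: pv_up (pv_and v _ _ (dLv j.+1) (def_not (dLv j)) (Hj v Ov) nv); first exact: def_St.
  move=> x [h1 /negP]; rewrite /Lv -ltnNge => h2; apply/ixE/eqP.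
  by rewrite eqn_leq; apply/andP.
have complete Z : def I setT Z -> p Z \/ p (fun x => ~ Z x).
  move=> dZ; have [j [u [Ou Hu]]] := stab Z dZ.
  (* Within one stratum membership in [Z] depends on the base point alone, and [q] decides such
     conditions. *)
  pose Q y := forall t, strat j (fb Z y) t -> fb Z y t.
  have dQ : def I setT Q by rewrite /Q /fb; dsolve.
  have [qQ|qQ] := type_dec tq dQ; [left|right]; apply/pE; rewrite //.
  - exists u; split=> // v Ov uv; apply: pv_up (pv_and v _ _ _ _ (pull v _ qQ Ov) (Hu v Ov uv)) => //.
    + by move=> x [Qx Sx]; rewrite -(ins_del ord_max x); apply: Qx.
    + exact: def_pullback.
    + exact: def_St.
  - exact: def_not.
  exists u; split=> // v Ov uv; apply: pv_up (pv_and v _ _ _ _ (pull v _ qQ Ov) (Hu v Ov uv)).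
  - exact: def_not.
  - move=> x [nQx Sx] Zx; apply: nQx => t St'.
    have it := (stratE om (def_fb (del ord_max x) dZ) j t).1 St'.
    have ix := (stratE om (def_fb (del ord_max x) dZ) j (x ord_max)).1 Sx.
    apply/(idx_const om (def_fb (del ord_max x) dZ) (t' := x ord_max)); first by rewrite it ix.
    by rewrite /fb ins_del.
  - exact: (def_pullback (def_not dQ)).
  - exact: def_St.
have tp : n_type I p.
  split.
  - by move=> Z [].
  - move=> [_ [u [Ou /(_ u Ou (le_refl u))]]] h.
    by have [y [t [Ut /(_ t Ut (lexx _))]]] := type_inh tq h.
  - move=> Z Z' [/definableE dZ [u [Ou Hu]]] [/definableE dZ' [u' [Ou' Hu']]].
    split; first by apply/definableE; apply: def_and.
    have [h|h] := le_tot u u'.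
      by exists u'; split=> // v Ov uv; apply: pv_and; [| |apply: Hu|apply: Hu'] => //; apply: le_trans' h _.
    by exists u; split=> // v Ov uv; apply: pv_and; [| |apply: Hu|apply: Hu'] => //; apply: le_trans' h _.
  - move=> Z Z' [/definableE dZ [u [Ou Hu]]] /[dup] /definableE dZ' dZ'' ZZ'; split=> //.
    by exists u; split=> // v Ov uv; apply: pv_up (Hu v Ov uv).
  - by move=> Z /definableE; apply: complete.
exists p; split=> //.
- move=> m phi ophi.
  have dF := defp_fiber I A ophi.
  have H : def I A (fun c : 'I_m -> M => exists u, Om u /\
      forall v, Om v -> le u v -> pv v (fiber I phi c)).
    by rewrite /le /pv /In /Up /fb; dsolve.
  apply/definableE; apply: def_iff H => c; split=> [pF|[]//]; split=> //.
  by apply/definableE; apply: defp_at; apply: defp_toT dF.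
- move=> u Ou; have dXu := defp_at u dXT.
  (* If the complement of [X u] were in [p], it would contain, for a deep [w] with [X w] inside
     [X u], an initial part of the fibre of [X w]. *)
  have [//|[_ [u' [Ou' Hu']]]] := complete _ dXu.
  have [w [Ow Hw]] := dir u u' Ou Ou'.
  have u'w : le u' w.
    by apply: (type_all tq) => y t [s [Xs st]]; exists s; split=> //; have [] := Hw _ Xs.
  have [y [t [[s [Xs st]] Ht]]] := type_inh tq (Hu' w Ow u'w).
  exfalso; apply: (Ht s _ st); first by exists s.
  by have [] := Hw _ Xs.
move=> Y qY; apply/pE; first exact: (def_pullback (type_def tq qY)).
by exists u0; split=> // v Ov _; apply: pull.
Qed.

End Filter.

End Types.

(** * Bases of cells *)

Section CellTypes.
Context {d : Order.disp_t} {M : orderTopologicalType d} {L : language} (I : structure L M).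
Hypothesis om : o_minimal I.
Notation D := (def I setT).

Lemma nbx_nbhs n (x : tup M n) (P : ('I_n -> M) -> Prop) :
  nbx x P -> nbhs (x : {ptws 'I_n -> M}) (P : set {ptws 'I_n -> M}).
Proof.
move=> [lo [hi [xb HP]]].
pose px : {ptws 'I_n -> M} := x.
have FF : Filter (nbhs px) := nbhs_filter px.
have H i : nbhs px [set y : {ptws 'I_n -> M} | lo i < y i /\ y i < hi i].
  have [l h] := xb i.
  have Hi : nbhs (x i) `]lo i, hi i[%classic.
    by apply: open_nbhs_nbhs; split; [exact: itv_open|rewrite /= in_itv /= l h].
  apply: (@filterS _ (nbhs px) FF _ _ _ (@proj_continuous _ (fun _ : 'I_n => M) i px _ Hi)) => y.
  by rewrite /= in_itv /= => /andP.
by apply: (@filterS _ (nbhs px) FF _ _ _ (@filter_forall _ _ _ (nbhs px) FF H)) => y; apply: HP.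
Qed.

Lemma conton_continuous n (C : set (tup M n)) (f : ('I_n -> M) -> M) :
  conton C f -> {within (C : set {ptws 'I_n -> M}), continuous f}.
Proof.
move=> Cf; apply/subspace_continuousP => x Cx U /=; rewrite itv_nbhsE => -[i [oi fi] iU].
have H c e : c < f x -> f x < e -> (forall t, c < t -> t < e -> t \in i) ->
    nbhs (x : {ptws 'I_n -> M}) [set y | C y -> U (f y)].
  move=> cf fe sub; apply: (nbx_nbhs (x := x)); apply: nbx_sub (Cf x Cx c e cf fe) => y Hy Cy.
  by have [h1 h2] := Hy Cy; apply/iU/sub.
have [c0 c0f] := omin_no_min om (f x); have [e0 fe0] := omin_no_max om (f x).
suff [c [e [cf fe sub]]] : exists c e, [/\ c < f x, f x < e & forall t, c < t -> t < e -> t \in i].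
  by have := H c e cf fe sub; rewrite /within /=; apply: filterS => y.
case: i oi fi {iU H} => [[[] l|[]] [[] r|[]]] //= _; rewrite in_itv /= ?andbT => fi.
- move: fi => /andP[l1 r1]; exists l, r; split=> // t h1 h2.
  by rewrite in_itv /= h1 h2.
- by exists l, e0; split=> // t h1 h2; rewrite in_itv /= h1.
- by exists c0, r; split=> // t h1 h2; rewrite in_itv /= h2.
- by exists c0, e0; split=> // t h1 h2; rewrite in_itv.
Qed.

Lemma conton_sub n (C P : ('I_n -> M) -> Prop) f :
  (forall x, C x -> P x) -> conton P f -> conton C f.
Proof.
move=> CP cf x Cx c e h1 h2; apply: nbx_sub (cf x (CP x Cx) c e h1 h2) => y H Cy.
exact/H/CP.
Qed.

Lemma definable_continuousP n (C : set (tup M n)) (f : ('I_n -> M) -> M) :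
  D C -> dfn I setT f -> conton C f -> definable_continuous I C f.
Proof.
move=> dC df cf; split; last exact: conton_continuous.
apply/definableE.
have H : D (fun x : 'I_n.+1 -> M => C (del ord_max x) /\ x ord_max = f (del ord_max x)) by dsolve.
by apply: def_iff H => x; rewrite /fgraph_on /= tup_init_del.
Qed.

Lemma is_inf_uniq (P : M -> Prop) s s' : is_inf P s -> is_inf P s' -> s = s'.
Proof.
move=> [h1 h2] [h1' h2']; apply/eqP; rewrite eq_le.
apply/andP; split; rewrite leNgt; apply/negP.
  by move=> /h2'[w /h1 w1 w2]; ord.
by move=> /h2[w /h1' w1 w2]; ord.
Qed.

(** Membership in [p] amounts to containing a member of the basis, a first-order condition on the
    parameters of the set. *)
Lemma basis_definable_type n (p : set (set (tup M n))) (W : finType) (Om : (W -> M) -> Prop)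
    (B : (W -> M) -> ('I_n -> M) -> Prop) : n_type I p -> def I setT Om -> defp I setT B ->
  (forall b, Om b -> p (B b)) -> (forall Z, p Z -> exists b, Om b /\ forall x, B b x -> Z x) ->
  definable_type I setT p.
Proof.
move=> tp dOm dB pB basis m phi ophi.
have dF := defp_fiber I setT ophi.
have H : D (fun u : 'I_m -> M => exists b, Om b /\ forall x, B b x -> fiber I phi u x) by dsolve.
apply/definableE; apply: def_iff H => u; split=> [[b [Ob Hb]]|]; last exact: basis.
by apply: (type_up tp _ Hb (pB b Ob)); apply: defp_at.
Qed.

Definition has_cell_basis n (p : set (set (tup M n))) : Prop :=
  exists (W : finType) (Om : (W -> M) -> Prop) (B : (W -> M) -> ('I_n -> M) -> Prop),
    [/\ def I setT Om, defp I setT B, forall b, Om b -> is_cell I (B b : set (tup M n)),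
        forall b, Om b -> p (B b) & forall Z, p Z -> exists b, Om b /\ forall x, B b x -> Z x].

(** The type is the image of [q] under [y |-> (y, h y)]. [q] selects one piece of continuity of [h],
    and the graphs over the basis cells inside that piece form the basis. *)
Lemma graph_type n (q : set (set (tup M n))) (h : ('I_n -> M) -> M) :
  n_type I q -> has_cell_basis q -> dfn I setT h ->
  exists p : set (set (tup M n.+1)), [/\ n_type I p, has_cell_basis p &
    forall Z, D Z -> q (fun y => fb Z y (h y)) -> p Z].
Proof.
move=> tq [WB [OmB [B [dOmB dB cB qB basis]]]] dh.
pose p : set (set (tup M n.+1)) := [set Z | definable I setT Z /\ q (fun y => fb Z y (h y))].
have dgr (Z : ('I_n.+1 -> M) -> Prop) : D Z -> D (fun y => fb Z y (h y)).
  by move=> dZ; rewrite /fb; dsolve.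
have tp : n_type I p.
  split.
  - by move=> Z [].
  - by move=> [_ /(type_inh tq)[y]].
  - move=> Z Z' [/definableE dZ qZ] [/definableE dZ' qZ']; split.
      by apply/definableE; apply: def_and.
    exact: (type_and tq qZ qZ').
  - move=> Z Z' [_ qZ] /[dup] /definableE dZ' dZ'' ZZ'; split=> //.
    by apply: (type_up tq (dgr _ dZ') _ qZ) => y; apply: ZZ'.
  move=> Z /[dup] /definableE dZ dZ'.
  have [|] := type_dec tq (dgr _ dZ); [by left|right]; split=> //.
  by apply/definableE; apply: def_not.
exists p; split=> //; last by move=> Z dZ qZ; split=> //; apply/definableE.
have [J [P [dP cP kP]]] := piecewise_continuity om dh.
have [j qPj] : exists j, q (P j).
  by apply: (type_ex tq dP); apply: (type_all tq).
have dPj := dP j.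
exists WB, (fun b => OmB b /\ forall y, B b y -> P j y),
  (fun b x => B b (del ord_max x) /\ x ord_max = h (del ord_max x)).
have dgb : defp I setT (fun b (x : 'I_n.+1 -> M) =>
    B b (del ord_max x) /\ x ord_max = h (del ord_max x)) by dsolve.
split=> //.
- by dsolve.
- move=> b [Ob BP]; exists (B b); first exact: cB.
  left; exists h.
    by apply: definable_continuousP => //; [apply: defp_at|apply: conton_sub (kP j)].
  by apply/seteqP; split=> x; rewrite /fgraph_on /= tup_init_del.
- move=> b [Ob BP]; split; first by apply/definableE; apply: (defp_at b dgb).
  apply: (type_up tq _ _ (qB b Ob)); first exact: (dgr _ (defp_at b dgb)).
  by move=> y By; rewrite /fb del_ins ins_id.
move=> Z [_ qZ]; have [b [Ob Hb]] := basis _ (type_and tq qPj qZ).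
exists b; split; first by split=> // y /Hb[].
by move=> x [/Hb[_ Zx] xE]; rewrite -(ins_del ord_max x) xE.
Qed.

(** * The type above the infima when no graph is generic *)

Section Band.
Variables (n : nat) (q : set (set (tup M n))).
Hypotheses (tq : n_type I q) (cq : has_cell_basis q) (dq : definable_type I setT q).
Variables (W : finType) (Om : (W -> M) -> Prop) (X : (W -> M) -> ('I_n.+1 -> M) -> Prop).
Hypotheses (dOm : def I setT Om) (dX : defp I setT X).
Hypothesis dir : forall u v, Om u -> Om v ->
  exists w, Om w /\ forall x, X w x -> X u x /\ X v x.
Hypothesis no_graph : forall h, dfn I setT h -> exists u, Om u /\ ~ q (fun y => fb (X u) y (h y)).
Variable p : set (set (tup M n.+1)).
Hypotheses (tp : n_type I p) (dp : definable_type I setT p).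
Hypotheses (pX : forall u, Om u -> p (X u)) (pq : forall Y, q Y -> p (fun x => Y (del ord_max x))).

Lemma band_proj (Z : ('I_n.+1 -> M) -> Prop) : p Z -> q (fun y => exists t, fb Z y t).
Proof.
move=> pZ; have dZ := type_def tp pZ.
have dE : D (fun y => exists t, fb Z y t) by rewrite /fb; dsolve.
have [//|/pq nE] := type_dec tq dE.
have [x [Zx []]] := type_meet tp pZ nE.
by exists (x ord_max); rewrite /fb ins_del.
Qed.

(** Such an [E] would be part of the graph of a definable [h]; each [X u] meets [E] over generic
    base points, so it would contain [(y, h y)] generically, against [no_graph]. *)
Lemma band_not_single E : p E -> ~ (forall y t t', fb E y t -> fb E y t' -> t = t').
Proof.
move=> pE uE; have dE := type_def tp pE.
have [||h dh hP] := @select_fun _ _ _ _ om _ (fb E); [by rewrite /fb; dsolve|by []|].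
have [u [Ou nu]] := no_graph dh; apply: nu.
apply: (type_up tq _ _ (band_proj (type_and tp (pX Ou) pE))).
  by have := defp_at u dX => dXu; rewrite /fb; dsolve.
by move=> y [t [Xt Et]]; rewrite (hP y t).
Qed.

(* The infimum of the fibre of [E] is a definable function of [y], so by [no_graph] it
   generically misses some [X u]; a component of [X u] meeting [E] then stays above it. *)
Lemma band_above Z E : component I p Z E -> exists u, Om u /\ forall Eu, component I p (X u) Eu ->
  q (fun y => forall t, fb Eu y t -> exists s, fb E y s /\ s <= t).
Proof.
move=> cE; have dE := comp_def cE; have pE := comp_mem cE.
have dR Eu : D Eu -> D (fun y => forall t, fb Eu y t -> exists s, fb E y s /\ s <= t).
  by move=> dEu; rewrite /fb; dsolve.
have [||a da aP] := @select_fun _ _ _ _ om _ (fun y t => is_inf (fb E y) t).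
- by rewrite /fb; dsolve.
- by move=> y t t'; apply: is_inf_uniq.
have [u [Ou nu]] := no_graph da; exists u; split=> // Eu cEu.
have dEu := comp_def cEu; have dXu := defp_at u dX.
have qn : q (fun y => ~ fb (X u) y (a y)).
  have dn : D (fun y => fb (X u) y (a y)) by rewrite /fb; dsolve.
  by have [/nu|] := type_dec tq dn.
have := type_and tq qn (band_proj (type_and tp (comp_mem cEu) pE)).
apply: (type_up tq); first exact: dR.
move=> y [nXa [t0 [Eut0 Et0]]] t Eut; apply: contrapT => nE.
have bE s : fb E y s -> t <= s.
  by move=> Es; rewrite leNgt; apply/negP => st; apply: nE; exists s; split=> //; apply: ltW.
have dEy := def_fb y dE.
have [||i iP] := has_inf om (b := t) dEy; [by exists t0|by []|].
have ai := aP y i iP; rewrite ai in nXa.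
have ti : t <= i by rewrite leNgt; apply/negP => /(iP.2)[s Es st]; have := bE s Es => ?; ord.
have it0 : i <= t0 by apply: iP.1.
by apply: nXa; apply: (comp_sub cEu); apply: (comp_convex cEu Eut Eut0).
Qed.

(** The mirror image of [band_above], with suprema in place of infima. *)
Lemma band_below Z E : component I p Z E -> exists u, Om u /\ forall Eu, component I p (X u) Eu ->
  q (fun y => forall t, fb Eu y t -> exists s, fb E y s /\ t <= s).
Proof.
move=> cE; have dE := comp_def cE; have pE := comp_mem cE.
have dR Eu : D Eu -> D (fun y => forall t, fb Eu y t -> exists s, fb E y s /\ t <= s).
  by move=> dEu; rewrite /fb; dsolve.
have [||a da aP] := @select_fun _ _ _ _ om _ (fun y t => is_sup (fb E y) t).
- by rewrite /fb; dsolve.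
- by move=> y t t'; apply: is_sup_uniq.
have [u [Ou nu]] := no_graph da; exists u; split=> // Eu cEu.
have dEu := comp_def cEu; have dXu := defp_at u dX.
have qn : q (fun y => ~ fb (X u) y (a y)).
  have dn : D (fun y => fb (X u) y (a y)) by rewrite /fb; dsolve.
  by have [/nu|] := type_dec tq dn.
have := type_and tq qn (band_proj (type_and tp (comp_mem cEu) pE)).
apply: (type_up tq); first exact: dR.
move=> y [nXa [t0 [Eut0 Et0]]] t Eut; apply: contrapT => nE.
have bE s : fb E y s -> s <= t.
  by move=> Es; rewrite leNgt; apply/negP => st; apply: nE; exists s; split=> //; apply: ltW.
have dEy := def_fb y dE.
have [||i iP] := has_sup om (b := t) dEy; [by exists t0|by []|].
have ai := aP y i iP; rewrite ai in nXa.
have ti : i <= t by rewrite leNgt; apply/negP => /(iP.2)[s Es st]; have := bE s Es => ?; ord.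
have it0 : t0 <= i by apply: iP.1.
by apply: nXa; apply: (comp_sub cEu); apply: (comp_convex cEu Eut0 Eut).
Qed.

(** The cells are the components [E w] over those basis cells of [q] on which both ends of the fibre
    behave uniformly. To get inside a given [Z], take [w] below two members, one missing the lower
    end of a component of [Z] and one missing its upper end. *)
Lemma band_cell_basis : has_cell_basis p.
Proof.
have [WB [OmB [B [dOmB dB cB qB basis]]]] := cq.
have [E [dE HE]] := components om (A := setT) tp dp dX pX.
have opE u : Om u -> forall y t, fb (E u) y t ->
    (exists c e, [/\ c < t, t < e & forall s, c < s -> s < e -> fb (E u) y s]) /\
    forall c e, c < t -> t < e -> (forall s, c < s -> s < e -> fb (X u) y s) ->
           forall s, c < s -> s < e -> fb (E u) y s.
  move=> Ou; have [uE|//] := comp_shape (HE _ Ou).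
  by case: (band_not_single (comp_mem (HE _ Ou)) uE).
have [||lo0 dlo loP] := @select_fun _ _ _ _ om _ (fun (e : W + 'I_n -> M) t =>
    is_inf (fb (E (fun w => e (inl w))) (fun i => e (inr i))) t).
- by rewrite /fb; dsolve.
- by move=> y t t'; apply: is_inf_uniq.
have [||hi0 dhi hiP] := @select_fun _ _ _ _ om _ (fun (e : W + 'I_n -> M) t =>
    is_sup (fb (E (fun w => e (inl w))) (fun i => e (inr i))) t).
- by rewrite /fb; dsolve.
- by move=> y t t'; apply: is_sup_uniq.
pose lo u (y : 'I_n -> M) := lo0 (pr u y); pose hi u (y : 'I_n -> M) := hi0 (pr u y).
have loE u y t : is_inf (fb (E u) y) t -> lo u y = t by apply: (loP (pr u y)).
have hiE u y t : is_sup (fb (E u) y) t -> hi u y = t by apply: (hiP (pr u y)).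
pose bdl u y := exists c, forall t, fb (E u) y t -> c < t.
pose bdu u y := exists c, forall t, fb (E u) y t -> t < c.
(* A cell has one kind of bound on each side, so an end must be finite or infinite as it is
   [q]-generically, at every point of the base. *)
pose ok u y := [/\ exists t, fb (E u) y t, bdl u y <-> q (bdl u) & bdu u y <-> q (bdu u)].
pose Om' (e : W + WB -> M) := [/\ Om (fun w => e (inl w)), OmB (fun w => e (inr w)),
  forall y, B (fun w => e (inr w)) y -> ok (fun w => e (inl w)) y &
  conton (B (fun w => e (inr w))) (lo (fun w => e (inl w))) /\
  conton (B (fun w => e (inr w))) (hi (fun w => e (inl w)))].
pose B' (e : W + WB -> M) (x : 'I_n.+1 -> M) :=
  B (fun w => e (inr w)) (del ord_max x) /\ E (fun w => e (inl w)) x.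
have dB' : defp I setT B' by rewrite /B'; dsolve.
have dOm' : def I setT Om' by rewrite /Om' /ok /bdl /bdu /lo /hi /fb; dsolve.
have fibE u y t : Om u -> ok u y -> fb (E u) y t <->
    (q (bdl u) -> lo u y < t) /\ (q (bdu u) -> t < hi u y).
  move=> Ou [[t0 Et0] bl bu]; have dEy := def_fb y (comp_def (HE _ Ou)).
  have infE : bdl u y -> is_inf (fb (E u) y) (lo u y).
    move=> [c Hc]; have [||i iP] := has_inf om (b := c) dEy; [by exists t0|by move=> s /Hc/ltW|].
    by rewrite (loE _ _ _ iP).
  have supE : bdu u y -> is_sup (fb (E u) y) (hi u y).
    move=> [c Hc]; have [||i iP] := has_sup om (b := c) dEy; [by exists t0|by move=> s /Hc/ltW|].
    by rewrite (hiE _ _ _ iP).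
  split=> [Et|[Hl Hh]].
    have [[c [e [ct te H]]] _] := opE u Ou y t Et; split=> [/bl/infE[h1 _]|/bu/supE[h1 _]].
      have [s [cs st]] := btw om ct; have : fb (E u) y s by apply: H => //; ord.
      by move/h1 => ?; ord.
    have [s [ts se]] := btw om te; have : fb (E u) y s by apply: H => //; ord.
    by move/h1 => ?; ord.
  have [s1 Es1 s1t] : exists2 s, fb (E u) y s & s <= t.
    have [b|nb] := pselect (bdl u y).
      by have [s Es st] := (infE b).2 t (Hl (bl.1 b)); exists s => //; apply: ltW.
    apply: contrapT => nE; apply: nb; exists t => s Es; rewrite ltNge; apply/negP => st.
    by apply: nE; exists s.
  have [s2 Es2 s2t] : exists2 s, fb (E u) y s & t <= s.
    have [b|nb] := pselect (bdu u y).
      by have [s Es st] := (supE b).2 t (Hh (bu.1 b)); exists s => //; apply: ltW.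
    apply: contrapT => nE; apply: nb; exists t => s Es; rewrite ltNge; apply/negP => st.
    by apply: nE; exists s.
  exact: (comp_convex (HE _ Ou) Es1 Es2).
have dlo' u : dfn I setT (lo u) by rewrite /lo; dsolve.
have dhi' u : dfn I setT (hi u) by rewrite /hi; dsolve.
exists (W + WB)%type, Om', B'; split=> //.
- move=> e [Ou Ob Bok [clo chi]]; set u := fun w => e (inl w) in Ou Bok clo chi *.
  set b := fun w => e (inr w) in Ob Bok clo chi *.
  have dBb : D (B b) by apply: defp_at.
  exists (B b); first exact: cB.
  right; exists (if `[< q (bdl u) >] then Some (lo u) else None),
    (if `[< q (bdu u) >] then Some (hi u) else None); split.
  + by move=> f0; case: ifP => // _ [<-]; apply: definable_continuousP.
  + by move=> g0; case: ifP => // _ [<-]; apply: definable_continuousP.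
  + move=> f0 g0; case: ifP => // /asboolP ql [<-]; case: ifP => // /asboolP qu [<-] y By.
    have [[t Et] _ _] := Bok y By.
    by have [/(_ ql) h1 /(_ qu) h2] := (fibE u y t Ou (Bok y By)).1 Et; ord.
  apply/seteqP; split=> x; rewrite /band /= tup_init_del.
    move=> [Bx Ex]; have Ex' : fb (E u) (del ord_max x) (x ord_max) by rewrite /fb ins_del.
    have [h1 h2] := (fibE u _ _ Ou (Bok _ Bx)).1 Ex'.
    by split=> //; case: ifP => // /asboolP.
  move=> [Bx h1 h2]; split=> //; rewrite -(ins_del ord_max x).
  apply/(fibE u _ _ Ou (Bok _ Bx)); split=> [ql|qu].
    by move: h1; rewrite asboolT.
  by move: h2; rewrite asboolT.
- move=> e [Ou Ob _ _]; apply: (type_and tp (pq (qB _ Ob)) (comp_mem (HE _ Ou))).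
move=> Z pZ; have [EZ cZ] := component1 om tp dp pZ.
have [u [Ou Hu]] := band_above cZ; have [u' [Ou' Hu']] := band_below cZ.
have [w [Ow Hw]] := dir Ou Ou'.
(* The fibre of [E w] is an open interval inside the fibre of [X v], and generically it meets [E v];
   maximality in [comp_shape] puts it inside [E v]. *)
have sub v : Om v -> (forall x, X w x -> X v x) ->
    q (fun y => forall t, fb (E w) y t -> fb (E v) y t).
  move=> Ov wv; have dEv := comp_def (HE _ Ov); have dEw := comp_def (HE _ Ow).
  apply: (type_up tq _ _ (band_proj (type_and tp (comp_mem (HE _ Ow)) (comp_mem (HE _ Ov))))).
    by rewrite /fb; dsolve.
  move=> y [t0 [Ewt0 Evt0]] t Ewt.
  have K a b : a <= b -> fb (E w) y a -> fb (E w) y b -> exists c e,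
      [/\ c < a, b < e & forall s, c < s -> s < e -> fb (E w) y s].
    move=> ab Ea Eb; have [[c1 [e1 [h1 h2 H1]]] _] := opE w Ow y a Ea.
    have [[c2 [e2 [h3 h4 H2]]] _] := opE w Ow y b Eb.
    exists c1, e2; split=> // s c1s se2.
    have [sa|as_] := ltP s a; first by apply: H1 => //; ord.
    have [bs|sb] := ltP b s; first by apply: H2 => //; ord.
    exact: (comp_convex (HE _ Ow) Ea Eb).
  have [c [e [ct te ct0 t0e H]]] : exists c e, [/\ c < t, t < e, c < t0, t0 < e &
      forall s, c < s -> s < e -> fb (E w) y s].
    case/orP: (le_total t t0) => h.
      by have [c [e [h1 h2 H]]] := K _ _ h Ewt Ewt0; exists c, e; split=> //; ord.
    by have [c [e [h1 h2 H]]] := K _ _ h Ewt0 Ewt; exists c, e; split=> //; ord.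
  apply: ((opE v Ov y t0 Evt0).2 c e) => // s cs se.
  by apply: wv; apply: (comp_sub (HE _ Ow)); apply: H.
have [J [P [dP cP kP]]] := piecewise_continuity om (dlo' w).
have [j qPj] : exists j, q (P j) by apply: (type_ex tq dP); apply: (type_all tq).
have [J' [P' [dP' cP' kP']]] := piecewise_continuity om (dhi' w).
have [j' qPj'] : exists j, q (P' j) by apply: (type_ex tq dP'); apply: (type_all tq).
have dEw := comp_def (HE _ Ow).
have dbl : D (bdl w) by rewrite /bdl /fb; dsolve.
have dbu : D (bdu w) by rewrite /bdu /fb; dsolve.
have flag (Q : ('I_n -> M) -> Prop) : D Q -> q (fun y => Q y <-> q Q).
  move=> dQ; have dQ' : D (fun y => Q y <-> q Q) by dsolve.
  have [qQ|qQ] := type_dec tq dQ; apply: (type_up tq dQ' _ qQ) => y Qy; split=> //.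
  by move=> qQ'; have [y' []] := type_meet tq qQ qQ'.
have qok : q (ok w).
  have := type_and tq (band_proj (comp_mem (HE _ Ow))) (type_and tq (flag _ dbl) (flag _ dbu)).
  by apply: (type_up tq) => [|y [h1 [h2 h3]] //]; rewrite /ok /fb; dsolve.
have qs := type_and tq (type_and tq (sub u Ou (fun x h => (Hw x h).1)) (Hu _ (HE _ Ou)))
  (type_and tq (sub u' Ou' (fun x h => (Hw x h).2)) (Hu' _ (HE _ Ou'))).
have [b [Ob Hb]] := basis _ (type_and tq (type_and tq qPj qPj') (type_and tq qok qs)).
exists (pr w b); split.
  split=> //; first by move=> y /Hb[_ []].
  by split; [apply: conton_sub (kP j)|apply: conton_sub (kP' j')] => y /Hb[[]].
move=> x [/= /Hb[_ [_ [[s1 s2] [s3 s4]]]] Ex].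
have Ex' : fb (E w) (del ord_max x) (x ord_max) by rewrite /fb ins_del.
have [t1 [Et1 t1x]] := s2 _ (s1 _ Ex'); have [t2 [Et2 xt2]] := s4 _ (s3 _ Ex').
apply: (comp_sub cZ); rewrite -(ins_del ord_max x).
exact: (comp_convex cZ Et1 Et2).
Qed.

End Band.

(** * Types from directed families, and the equivalences *)

Theorem directed_cell_type n : forall (W : finType) (Om : (W -> M) -> Prop)
    (X : (W -> M) -> ('I_n -> M) -> Prop), def I setT Om -> defp I setT X -> (exists u, Om u) ->
  (forall u v, Om u -> Om v -> exists w, Om w /\ forall x, X w x -> X u x /\ X v x) ->
  (forall u, Om u -> exists x, X u x) ->
  exists p : set (set (tup M n)), [/\ n_type I p, has_cell_basis p & forall u, Om u -> p (X u)].
Proof.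
elim: n => [|n IH] W Om X dOm dX [u0 Ou0] dir inh.
  have [a _] := omin_nonempty om; pose x0 : 'I_0 -> M := fun=> a.
  have x0E (x : 'I_0 -> M) : x = x0 by apply/funext => -[].
  pose p : set (set (tup M 0)) := [set Z | definable I setT Z /\ Z x0].
  have dT : definable I setT (fun _ : tup M 0 => True) by apply/definableE; apply: def_cst.
  exists p; split.
  - split=> [Z []//|[]//|Z Z' [/definableE dZ Z0] [/definableE dZ' Z0']|Z Z' [_ Z0] dZ' ZZ'|Z dZ].
    + by split=> //; apply/definableE; apply: def_and.
    + by split=> //; apply: ZZ'.
    have [Z0|nZ0] := pselect (Z x0); [by left|right; split=> //].
    by apply/definableE; apply: def_not; apply/definableE.
  - exists void, (fun _ => True), (fun _ _ => True); split=> //.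
    + exact: def_cst.
    + exact: def_cst.
    move=> Z [_ Z0]; have b : void -> M by case.
    by exists b; split=> // x _; rewrite (x0E x).
  move=> u Ou; have [x Xx] := inh u Ou; rewrite (x0E x) in Xx; split=> //.
  by apply/definableE; apply: defp_at.
pose X' u y := exists t, fb (X u) y t.
have dX' : defp I setT X' by rewrite /X' /fb; dsolve.
have [|||q [tq cq qX']] := IH W Om X' dOm dX'; [by exists u0| | |].
- move=> u v Ou Ov; have [w [Ow Hw]] := dir u v Ou Ov; exists w; split=> // y [t /Hw[h1 h2]].
  by split; exists t.
- by move=> u Ou; have [x Xx] := inh u Ou; exists (del ord_max x), (x ord_max); rewrite /fb ins_del.
have dq : definable_type I setT q.
  by have [WB [OmB [B [dOmB dB _ qB basis]]]] := cq; apply: (basis_definable_type tq dOmB dB).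
(* In the first case [h] is any function that works, with parameters unrelated to those of the
   family. *)
have [[h [dh qh]]|nh] := pselect (exists h, dfn I setT h /\
    forall u, Om u -> q (fun y => fb (X u) y (h y))).
  have [p [tp cp pZ]] := graph_type tq cq dh; exists p; split=> // u Ou.
  by apply: pZ; [apply: defp_at|apply: qh].
have no_graph h : dfn I setT h -> exists u, Om u /\ ~ q (fun y => fb (X u) y (h y)).
  move=> dh; apply: contrapT => nE; apply: nh; exists h; split=> // u Ou.
  by apply: contrapT => nq; apply: nE; exists u.
have [p [tp dp pX pq]] := type_over om tq dq dOm dX (ex_intro _ u0 Ou0) dir qX'.
by exists p; split=> //; apply: (band_cell_basis tq cq dq dOm dX dir no_graph tp dp pX pq).
Qed.

(** The cut of [type_over] is used in every dimension, even when some graph is generic, because it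
    introduces no parameter outside [A]. *)
Theorem directed_type (A : set M) n : forall (W : finType) (Om : (W -> M) -> Prop)
    (X : (W -> M) -> ('I_n -> M) -> Prop), def I A Om -> defp I A X -> (exists u, Om u) ->
  (forall u v, Om u -> Om v -> exists w, Om w /\ forall x, X w x -> X u x /\ X v x) ->
  (forall u, Om u -> exists x, X u x) ->
  exists p : set (set (tup M n)),
    [/\ n_type I p, definable_type I A p & forall u, Om u -> p (X u)].
Proof.
elim: n => [|n IH] W Om X dOm dX [u0 Ou0] dir inh.
  have [|p [tp _ pX]] := directed_cell_type (def_toT dOm) (defp_toT dX) _ dir inh.
    by exists u0.
  have [a _] := omin_nonempty om; pose x0 : 'I_0 -> M := fun=> a.
  have x0E (x : 'I_0 -> M) : x = x0 by apply/funext => -[].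
  exists p; split=> // m phi ophi.
  have dF := defp_fiber I A ophi.
  have H : def I A (fun u : 'I_m -> M => forall x, fiber I phi u x) by dsolve.
  apply/definableE; apply: def_iff H => u; split=> [Hx|pF x].
    exact: (type_all tp).
  by have [y Fy] := type_inh tp pF; rewrite (x0E x) -(x0E y).
pose X' u y := exists t, fb (X u) y t.
have dX' : defp I A X' by rewrite /X' /fb; dsolve.
have [|||q [tq dq qX']] := IH W Om X' dOm dX'; [by exists u0| | |].
- move=> u v Ou Ov; have [w [Ow Hw]] := dir u v Ou Ov; exists w; split=> // y [t /Hw[h1 h2]].
  by split; exists t.
- by move=> u Ou; have [x Xx] := inh u Ou; exists (del ord_max x), (x ord_max); rewrite /fb ins_del.
by have [p [tp dp pX _]] := type_over om tq dq dOm dX (ex_intro _ u0 Ou0) dir qX'; exists p.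
Qed.

Lemma directed_index (A : set M) n (S F : set (set (tup M n))) :
  definable_family I A F -> downward_directed F -> finer F S ->
  exists (W : finType) (Om : (W -> M) -> Prop) (X : (W -> M) -> ('I_n -> M) -> Prop),
    [/\ def I A Om, defp I A X, exists u, Om u,
        forall u v, Om u -> Om v -> exists w, Om w /\ forall x, X w x -> X u x /\ X v x &
        (forall u, Om u -> exists x, X u x) /\
        forall Y, S Y -> exists u, Om u /\ forall x, X u x -> Y x].
Proof.
move=> /definable_familyP[W [Om [X [dOm dX FE]]]] [F0 Fdir] FS.
have [[u0 Ou0]|nO] := pselect (exists u, Om u); last first.
  (* An empty [F] forces [S] to be empty. As [void -> M] has exactly one element, this is the family
     whose only member is the whole space. *)
  exists void, (fun _ => True), (fun _ _ => True); have [a _] := omin_nonempty om.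
  split; [exact: def_cst|exact: def_cst| | |split].
  - by have u : void -> M by case; exists u.
  - by move=> u v _ _; exists u.
  - by move=> u _; exists (fun=> a).
  move=> Y /FS[Z]; rewrite FE => -[u Ou _] _; by case: nO; exists u.
have FX u : Om u -> F (X u) by move=> Ou; rewrite FE; exists u.
exists W, Om, X; split=> //; first by exists u0.
  move=> u v Ou Ov; have [Z] := Fdir _ _ (FX u Ou) (FX v Ov).
  by rewrite FE => -[w Ow <-] sub; exists w; split=> // x /sub.
split.
  move=> u Ou; apply: contrapT => nE; apply: F0; rewrite (_ : set0 = X u); first exact: FX.
  by apply/seteqP; split=> x // Xx; apply: nE; exists x.
by move=> Y /FS[Z]; rewrite FE => -[u Ou <-] sub; exists u; split=> // x /sub.
Qed.

Lemma family_members_def (A : set M) n (S : set (set (tup M n))) Y :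
  definable_family I A S -> S Y -> def I setT Y.
Proof.
move=> /definable_familyP[W [Om [X [dOm dX ->]]]] [u _ <-].
exact: (defp_at u (defp_toT dX)).
Qed.

Theorem definable_type_iff_directed (A : set M) n (S : set (set (tup M n))) :
  definable_family I A S ->
  (exists p, [/\ n_type I p, definable_type I A p & S `<=` p]) <->
  (exists F, [/\ definable_family I A F, downward_directed F & finer F S]).
Proof.
move=> dS; split=> [[p [tp dp Sp]]|[F [dF Fd FS]]].
  have [W [Om [X [dOm dX SE]]]] := definable_familyP dS.
  have pX u : Om u -> p (X u) by move=> Ou; apply: Sp; rewrite SE; exists u.
  have [W' [Om' [Z [dOm' dZ pZ dir fin_]]]] := type_family_directed om tp dp dOm dX pX.
  exists (fam Om' Z); split; first exact: fam_definable.
    split=> [[v Ov E]|Y Y' [v Ov <-] [v' Ov' <-]].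
      by apply: (n_type_proper tp); rewrite -E; apply: pZ.
    have [v'' [Ov'' sub]] := dir v v' Ov Ov'; exists (Z v''); first by exists v''.
    by move=> x /sub.
  move=> Y; rewrite SE => -[u Ou <-]; have [v [Ov sub]] := fin_ u Ou.
  by exists (Z v); [exists v|move=> x /sub].
have [W [Om [X [dOm dX ne dir [inh sub]]]]] := directed_index dF Fd FS.
have [p [tp dp pX]] := directed_type dOm dX ne dir inh.
exists p; split=> // Y SY; have [u [Ou XY]] := sub Y SY.
by apply: (type_up tp _ XY (pX u Ou)); apply: family_members_def dS SY.
Qed.

Theorem cell_basis_iff_directed n (S : set (set (tup M n))) : definable_family I setT S ->
  (exists F, [/\ definable_family I setT F, downward_directed F & finer F S]) <->
  (exists p, [/\ n_type I p, S `<=` p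
    & exists q, [/\ basis_of_type I p q, definable_family I setT q
        & forall X, q X -> is_cell I X]]).
Proof.
move=> dS; split=> [[F [dF Fd FS]]|[p [tp Sp [q [[_ qd _ pE] dq _]]]]]; last first.
  exists q; split=> // Y /Sp; rewrite pE => -[_ [Z qZ ZY]].
  by exists Z.
have [W [Om [X [dOm dX ne dir [inh sub]]]]] := directed_index dF Fd FS.
have [p [tp [WB [OmB [B [dOmB dB cB pB basis]]]] pX]] := directed_cell_type dOm dX ne dir inh.
exists p; split=> //.
  move=> Y SY; have [u [Ou XY]] := sub Y SY.
  by apply: (type_up tp _ XY (pX u Ou)); apply: family_members_def dS SY.
have dfB : definable_family I setT (fam OmB B) by apply: fam_definable.
exists (fam OmB B); split=> //; last by move=> Y [b Ob <-]; apply: cB.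
split.
- by have [m [phi [Omega [_ _ E]]]] := dfB; exists m, phi, Omega.
- split=> [[b Ob E]|Y Y' [b Ob <-] [b' Ob' <-]].
    by apply: (n_type_proper tp); rewrite -E; apply: pB.
  have [b'' [Ob'' sub']] := basis _ (type_and tp (pB b Ob) (pB b' Ob')).
  by exists (B b''); [exists b''|move=> x /sub'].
- by move=> Y [b Ob <-]; apply: pB.
apply/seteqP; split=> Y.
  move=> pY; split; first exact: (n_type_definable tp pY).
  by have [b [Ob sub']] := basis Y pY; exists (B b); [exists b|].
by move=> [dY [_ [b Ob <-] sub']]; apply: (n_type_up tp (pB b Ob) dY sub').
Qed.

End CellTypes.

Theorem theoremA (d : Order.disp_t) (M : orderTopologicalType d)
    (L : language) (I : structure L M) (n : nat) (S : set (set (tup M n))) :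
  o_minimal I -> definable_family I setT S ->
  [/\ (exists p, [/\ n_type I p, definable_type I setT p & S `<=` p]) <->
      (exists F, [/\ definable_family I setT F, downward_directed F & finer F S]),
      (exists F, [/\ definable_family I setT F, downward_directed F & finer F S]) <->
      (exists p, [/\ n_type I p, S `<=` p
        & exists q, [/\ basis_of_type I p q, definable_family I setT q
            & forall X, q X -> is_cell I X]])
    & forall A : set M, definable_family I A S ->
      ((exists p, [/\ n_type I p, definable_type I A p & S `<=` p]) <->
       (exists F, [/\ definable_family I A F, downward_directed F & finer F S]))].
Proof.
move=> om dS; split; [exact: definable_type_iff_directed|exact: cell_basis_iff_directed|].
by move=> A dAS; apply: definable_type_iff_directed.
Qed.
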